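(* Let $b>0$ and $q\in\mathbb{N}=\{1,2,\dots\}$. For $r\in(0,\infty)$ let $\mathcal{C}_r\subset\mathbb{R}^2$ be a circle of radius $r$, and let $T_q(\delta_{\mathcal{C}_r})$ be the corresponding operator of Berezin–Toeplitz type. (i) For any $r\in(0,\infty)$ one has $\dim\ker(T_q(\delta_{\mathcal{C}_r}))\le q$. (ii) The set $$\mathcal{D}_q:=\{r\in(0,\infty)\,|\,\dim\ker(T_q(\delta_{\mathcal{C}_r}))\ge1\}$$ is infinite and discrete.
   Context: Let $b>0$, $A(x)=\frac b2(-x_2,x_1)$ for $x=(x_1,x_2)\in\mathbb{R}^2$, and $\Pi(A)=-i\nabla-A$. Let $\mathrm{H}^1_A(\mathbb{R}^2)=\{u\in L^2(\mathbb{R}^2):\Pi(A)u\in L^2(\mathbb{R}^2)^2\}$ with norm squared $\|u\|_{L^2}^2+\|\Pi(A)u\|_{L^2}^2$. For a circle $\Gamma=\mathcal{C}_r$, $\tau:\mathrm{H}^1_A(\mathbb{R}^2)\to\mathrm{H}^{1/2}(\Gamma)$ is the Dirichlet trace operator, i.e. the continuous extension of the restriction map $u\mapsto u|_\Gamma$; $ds$ is arc length. $H_0=(-i\nabla-A)^2$ is the Landau Hamiltonian, the self-adjoint operator in $L^2(\mathbb{R}^2)$ associated with the closed form $\int_{\mathbb{R}^2}|\Pi(A)u|^2\,dx$, $u\in\mathrm{H}^1_A(\mathbb{R}^2)$. Its spectrum consists of the infinitely degenerate eigenvalues $\Lambda_q=b(2q+1)$, $q\in\{0,1,2,\dots\}$.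 $p_q$ is the orthogonal projection in $L^2(\mathbb{R}^2)$ onto $\ker(H_0-\Lambda_q)$. The Berezin–Toeplitz type operator $T_q(\delta_{\mathcal{C}_r})=(\tau p_q)^*(\tau p_q)$ is the bounded self-adjoint operator in the Hilbert space $p_qL^2(\mathbb{R}^2)$ associated with the quadratic form $u\mapsto\int_{\mathcal{C}_r}|\tau u|^2\,ds$, $u\in p_qL^2(\mathbb{R}^2)$. *)

(* Defs.v *)
From HB Require Import structures.
From mathcomp Require Import all_boot all_order all_algebra.
From mathcomp Require Import all_classical all_reals all_analysis.
From mathcomp Require Import complex.

Set Implicit Arguments.
Unset Strict Implicit.
Unset Printing Implicit Defensive.

Import Order.TTheory GRing.Theory Num.Theory numFieldNormedType.Exports.

Local Open Scope classical_set_scope.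
Local Open Scope ring_scope.
Local Open Scope complex_scope.

(* Elements of the complex L2-spaces are represented by functions; equality
   in L2 is equality almost everywhere.  Operators and the trace are given by
   their graphs, i.e. as relations between representatives. *)

Notation lebesgue2 R := (@lebesgue_measure R \x @lebesgue_measure R)%E.

Definition abs2 {R : realType} (z : R[i]) : R :=
  complex.Re z ^+ 2 + complex.Im z ^+ 2.

Definition cintegral {d : measure_display} {T : measurableType d}
    {R : realType} (mu : {measure set T -> \bar R}) (D : set T)
    (f : T -> R[i]) : R[i] :=
  (\int[mu]_(x in D) complex.Re (f x)) +i* (\int[mu]_(x in D) complex.Im (f x)).

Definition cmeasurable {d : measure_display} {T : measurableType d}
    {R : realType} (D : set T) (f : T -> R[i]) : Prop :=
  measurable_fun D (fun x => complex.Re (f x)) /\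
  measurable_fun D (fun x => complex.Im (f x)).

Definition L2normsq {R : realType} (u : R * R -> R[i]) : \bar R :=
  (\int[lebesgue2 R]_x (abs2 (u x))%:E)%E.

Definition L2 {R : realType} (u : R * R -> R[i]) : Prop :=
  cmeasurable setT u /\ (L2normsq u < +oo)%E.

Definition L2inner {R : realType} (u v : R * R -> R[i]) : R[i] :=
  cintegral (lebesgue2 R) setT (fun x => u x * (v x)^*%C).

(* Dimension (in [0, +oo]) of the image in L2 of a set S of functions that
   represents a linear subspace: the supremum of the sizes of the families in
   S that are linearly independent modulo a.e. equality. *)
Definition L2free {R : realType} (n : nat) (u : 'I_n -> R * R -> R[i]) : Prop :=
  forall a : 'I_n -> R[i],
    {ae (lebesgue2 R), forall x, \sum_(i < n) a i * u i x = 0} ->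
    forall i, a i = 0.

Definition L2dim {R : realType} (S : set (R * R -> R[i])) : \bar R :=
  ereal_sup [set n%:R%:E | n in [set n : nat |
    exists u : 'I_n -> R * R -> R[i], (forall i, S (u i)) /\ L2free u]].

Definition basis_vec {R : realType} (j : 'I_2) : R * R :=
  if j == ord0 then (1, 0) else (0, 1).

Fixpoint Ck {R : realType} (k : nat) (f : R * R -> R) : Prop :=
  if k is k'.+1 then
    forall j : 'I_2, (forall x, derivable f x (basis_vec j)) /\
                     Ck k' ('D_(basis_vec j) f)
  else continuous f.

Definition smooth {R : realType} (f : R * R -> R) : Prop := forall k, Ck k f.

Definition test_function {R : realType} (phi : R * R -> R[i]) : Prop :=
  [/\ smooth (fun x => complex.Re (phi x)),
      smooth (fun x => complex.Im (phi x)) &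
      compact (closure [set x | phi x != 0])].

Definition cpartial {R : realType} (j : 'I_2) (phi : R * R -> R[i])
    (x : R * R) : R[i] :=
  'D_(basis_vec j) (fun y => complex.Re (phi y)) x +i*
  'D_(basis_vec j) (fun y => complex.Im (phi y)) x.

Definition vector_potential {R : realType} (b : R) (j : 'I_2)
    (x : R * R) : R :=
  b / 2 * (if j == ord0 then - x.2 else x.1).

Definition Pi_classical {R : realType} (b : R) (j : 'I_2)
    (phi : R * R -> R[i]) (x : R * R) : R[i] :=
  - 'i%C * cpartial j phi x - (vector_potential b j x)%:C * phi x.

(* u is in H^1_A and Pi(A) u = p, in the sense of distributions. *)
Definition magnetic_gradient {R : realType} (b : R) (u : R * R -> R[i])
    (p : 'I_2 -> R * R -> R[i]) : Prop :=
  L2 u /\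
  forall j, L2 (p j) /\
    forall phi, test_function phi ->
      L2inner (p j) phi = L2inner u (Pi_classical b j phi).

(* H_0 u = w, where H_0 is the operator associated with the form
   int |Pi(A) u|^2 on H^1_A. *)
Definition landau_hamiltonian {R : realType} (b : R)
    (u w : R * R -> R[i]) : Prop :=
  L2 w /\
  exists2 p, magnetic_gradient b u p &
    forall v q, magnetic_gradient b v q ->
      \sum_(j < 2) L2inner (p j) (q j) = L2inner w v.

Definition landau_level {R : realType} (b : R) (q : nat) : R :=
  b * (2 * q%:R + 1).

Definition landau_eigenspace {R : realType} (b : R) (q : nat) :
    set (R * R -> R[i]) :=
  [set u | landau_hamiltonian b u (fun x => (landau_level b q)%:C * u x)].

(* p_q u = w *)
Definition landau_projection {R : realType} (b : R) (q : nat)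
    (u w : R * R -> R[i]) : Prop :=
  [/\ L2 u, landau_eigenspace b q w &
      forall v, landau_eigenspace b q v ->
        L2inner (fun x => u x - w x) v = 0].

Definition landau_projection_range {R : realType} (b : R) (q : nat) :
    set (R * R -> R[i]) :=
  [set w | exists u, landau_projection b q u w].

Definition circle_param {R : realType} (c : R * R) (r t : R) : R * R :=
  (c.1 + r * cos t, c.2 + r * sin t).

Definition circle_integral {R : realType} (c : R * R) (r : R)
    (f : R * R -> \bar R) : \bar R :=
  (\int[@lebesgue_measure R]_(t in `[0%R, (2 * pi)%R])
     (r%:E * f (circle_param c r t)))%E.

Definition circle_inner {R : realType} (c : R * R) (r : R)
    (g h : R * R -> R[i]) : R[i] :=
  cintegral (@lebesgue_measure R) `[0, 2 * pi]
    (fun t => r%:C * (g (circle_param c r t) * (h (circle_param c r t))^*%C)).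

(* Squared Sobolev-Slobodeckij norm of H^{1/2} of the circle. *)
Definition H12normsq {R : realType} (c : R * R) (r : R)
    (g : R * R -> R[i]) : \bar R :=
  (circle_integral c r (fun x => (abs2 (g x))%:E) +
   circle_integral c r (fun x => circle_integral c r (fun y =>
     (abs2 (g x - g y) / ((x.1 - y.1) ^+ 2 + (x.2 - y.2) ^+ 2))%:E)))%E.

Definition H12 {R : realType} (c : R * R) (r : R)
    (g : R * R -> R[i]) : Prop :=
  cmeasurable `[0, 2 * pi] (fun t => g (circle_param c r t)) /\
  (H12normsq c r g < +oo)%E.

(* tau u = g on the circle: the graph of tau is the closure in
   H^1_A x H^{1/2} of the graph of the restriction map on test functions.
   Only the values of g on the circle are relevant. *)
Definition dirichlet_trace {R : realType} (b : R) (c : R * R) (r : R)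
    (u g : R * R -> R[i]) : Prop :=
  H12 c r g /\
  exists p (phi : nat -> R * R -> R[i]),
    [/\ magnetic_gradient b u p,
        (forall n, test_function (phi n)),
        (fun n => L2normsq (fun x => (phi n x - u x)%R) +
           \sum_(j < 2)
             L2normsq (fun x => (Pi_classical b j (phi n) x - p j x)%R))%E
          @ \oo --> 0%E &
        (fun n => H12normsq c r (fun x => phi n x - g x)) @ \oo --> 0%E].

(* T_q u = w, where T_q = (tau p_q)^* (tau p_q) is the operator in p_q L2
   associated with the form u |-> int_{C_r} |tau u|^2 ds. *)
Definition toeplitz {R : realType} (b : R) (q : nat) (c : R * R) (r : R)
    (u w : R * R -> R[i]) : Prop :=
  [/\ landau_projection_range b q u, landau_projection_range b q w &
      exists2 g, dirichlet_trace b c r u g &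
        forall v h, landau_projection_range b q v ->
          dirichlet_trace b c r v h ->
          circle_inner c r g h = L2inner w v].

Definition toeplitz_kernel {R : realType} (b : R) (q : nat) (c : R * R)
    (r : R) : set (R * R -> R[i]) :=
  [set u | toeplitz b q c r u (fun=> 0)].

(* Main.v *)
Require Import Defs.
From HB Require Import structures.
From mathcomp Require Import all_boot all_order all_algebra.
From mathcomp Require Import all_classical all_reals all_analysis.
From mathcomp Require Import measurable_realfun complex polyrcf ring lra zify.

Set Implicit Arguments.
Unset Strict Implicit.
Unset Printing Implicit Defensive.

Import Order.TTheory GRing.Theory Num.Theory numFieldNormedType.Exports.

Local Open Scope classical_set_scope.
Local Open Scope ring_scope.

(** Let z be the complex coordinate centred at the centre of the circle, rho = |z|^2
    and w = exp(- b rho / 4).  Up to the phase of a magnetic translation, the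
    states g_{a,k} = z^a zbar^k w (gauss_state) are mapped by the Landau
    Hamiltonian in a triangular way,
      H g_{a,k} = b (2 k + 1) g_{a,k} - 4 a k g_{a-1,k-1}   (magH_gE).
    Hence the moments M(a,k) = <u, g_{a,k}> of an eigenfunction u of level q
    satisfy 2 b (k - q) M(a,k) = 4 a k M(a-1,k-1) (eigen_moment).  All of them
    follow from the numbers M(n,q), one for each angular momentum n - q; since
    the Gaussian states are complete (gE_complete), u vanishes if these numbers
    do.  There is an explicit eigenfunction e_n of level q and angular momentum
    n - q (eigenstate), and on the circle of radius r the product of e_n and the
    conjugate of g_{n,q} is a constant: a nonzero factor times the value
    C_q(n; y) of a Charlier polynomial at y = 2 / (b r^2) (estate_circle).

    If C_q(n; y) = 0, then e_n vanishes on the circle and lies in the kernel of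
    the Toeplitz operator (estate_kernel).  Conversely, the trace of an element
    u of the kernel is zero.  The function psi = (r^2 - rho) g_{n,q}, cut off
    outside the disc, belongs to the form domain because it vanishes on the
    circle, and Green's formula for u and psi reads
      <u, 1_disc (Lambda_q - H) psi> = - 2 r int_C (tau u) conj(g_{n,q}) ds
    (eigen_trace).  For u in the kernel this is zero; for e_n it is not, unless
    C_q(n; y) = 0; and it only involves the component of u of angular momentum
    n - q (theta_sector).  So M(n,q) = 0 whenever C_q(n; y) is nonzero
    (kernel_moment), and the dimension of the kernel is at most the number of
    zeros n of C_q(n; y) (kernel_dim_le).

    The theorem is thus reduced to facts on Charlier polynomials.  As a function
    of n, C_q(n; y) is a polynomial of degree q, which gives (i).  As a function
    of y it has a zero in (0, 1/n] for every n > 0 (charlier_zero), and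
    r^2 = 2 / (b y) >= 2 n / b is then arbitrarily large, so there are infinitely
    many exceptional radii.  Finally C_q(n; y) is nonzero once y (n - 2 q) >= 2
    (charlier_neq0): near a given radius only finitely many n matter, each of
    them with finitely many zeros y, so the exceptional radii do not accumulate
    in (0, oo).

    The completeness and the separation of angular momenta rest on moment
    problems: a density that remains integrable after multiplication by an
    exponential, respectively a Gaussian, is determined by its moments
    (sublevel_moment, gaussian_moment2). *)

(** * Moment problems for densities with exponential decay *)

Notation intg mu f := (mu.-integrable setT (EFin \o f)).

Section integration.
Context {d : measure_display} {T : measurableType d} {R : realType}.
Variable mu : {measure set T -> \bar R}.
Implicit Types (f g h X G : T -> R).

Lemma intg_measurable f : intg mu f -> measurable_fun setT f.
Proof. by move=> /measurable_int /measurable_EFinP. Qed.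

Lemma le_intg f g : measurable_fun setT f -> (forall x, `|f x| <= `|g x|) ->
  intg mu g -> intg mu f.
Proof.
move=> mf fg; apply: le_integrable => //; first exact/measurable_EFinP.
by move=> x _ /=; rewrite lee_fin.
Qed.

Lemma intgZl (k : R) f : intg mu f -> intg mu (fun x => k * f x).
Proof. by move=> /(integrableZl measurableT k). Qed.

Lemma intgD f g : intg mu f -> intg mu g -> intg mu (fun x => f x + g x).
Proof. by move=> fi /(integrableD measurableT fi). Qed.

Lemma Rint0 : \int[mu]_x (0 : R) = 0.
Proof. by rewrite /Rintegral integral0. Qed.

Lemma dct (f_ : nat -> T -> R) f g :
  (forall n, measurable_fun setT (f_ n)) ->
  (forall x, f_ n x @[n --> \oo] --> f x) ->
  intg mu g -> (forall n x, `|f_ n x| <= g x) ->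
  intg mu f /\ (\int[mu]_x f_ n x @[n --> \oo] --> \int[mu]_x f x).
Proof.
move=> mf_ ff ig fg.
have mf : measurable_fun setT f by apply: measurable_fun_cvg mf_ _ => x _; exact: ff.
have := @dominated_convergence _ _ _ mu setT measurableT
  (fun n => EFin \o f_ n) (EFin \o f) (EFin \o g).
case.
- by move=> n; exact/measurable_EFinP.
- exact/measurable_EFinP.
- by apply: aeW => x _; apply: cvg_EFin; [exact: nearW|exact: ff].
- exact: ig.
- by apply: aeW => x n _; rewrite /= lee_fin.
move=> i1 _ /= c1; split => //.
have ifn n : intg mu (f_ n).
  by apply: le_intg ig => // x; apply: (le_trans (fg n x)); exact: ler_norm.
apply: fine_cvg; rewrite fineK ?integrable_fin_num//.
Qed.

(** A single term of the exponential series dominates the power. *)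
Lemma expr_le_expR (t y : R) (j : nat) : 0 < t -> 0 <= y ->
  y ^+ j <= j`!%:R / t ^+ j * expR (t * y).
Proof.
move=> t0 y0.
have H : forall (z : R), 0 <= z -> z ^+ j / j`!%:R <= expR z.
  move=> z z0; rewrite /expR.
  have := @nondecreasing_cvgn_le R (series (exp_coeff z)).
  move=> /(_ _ (is_cvg_series_exp_coeff z) j.+1) H.
  apply: (le_trans _ (H _)); last first.
    by apply: nondecreasing_series => n _ _; exact: exp_coeff_ge0.
  rewrite /series /= big_nat_recr //= /exp_coeff lerDr.
  by apply: sumr_ge0 => i _; exact: exp_coeff_ge0.
have := H _ (mulr_ge0 (ltW t0) y0).
rewrite exprMn ler_pdivrMr ?ltr0n ?fact_gt0// => {}H.
rewrite mulrAC ler_pdivlMr ?exprn_gt0// mulrC (le_trans H)//.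
by rewrite mulrC.
Qed.

(** Power series are integrated term by term, the exponential of the
    modulus being the dominating function. *)
Lemma exp_moment h X (t : R) : measurable_fun setT h -> measurable_fun setT X ->
  intg mu (fun x => h x * expR `|t * X x|) ->
  (forall j, \int[mu]_x (h x * X x ^+ j) = 0) ->
  \int[mu]_x (h x * expR (t * X x)) = 0.
Proof.
move=> mh mX hi m0.
have mtX : measurable_fun setT (fun x => t * X x) by exact: measurable_funM.
pose s n x := h x * series (exp_coeff (t * X x)) n.
have ts x j : `|h x * (t * X x) ^+ j / j`!%:R| <= `|h x * expR `|t * X x| |.
  move: (t * X x) => y.
  rewrite -mulrA !normrM ler_wpM2l// normrX normfV (ger0_norm (ler0n _ _)).
  rewrite (ger0_norm (expR_ge0 _)).
  have := @expr_le_expR 1 `|y| j ltr01 (normr_ge0 _).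
  rewrite expr1n divr1 mul1r => H.
  by rewrite ler_pdivrMr ?ltr0n ?fact_gt0// mulrC.
have it j : intg mu (fun x => h x * (t * X x) ^+ j / j`!%:R).
  apply: (le_intg _ (ts ^~ j) hi).
  apply: measurable_funM => //; apply: measurable_funM => //.
  exact: measurable_funX.
have sE n x : s n.+1 x = s n x + h x * (t * X x) ^+ n / n`!%:R.
  by rewrite /s /series /= big_nat_recr //= mulrDr /exp_coeff mulrA.
have si n : intg mu (s n) /\ \int[mu]_x s n x = 0.
  elim: n => [|n [IH1 IH2]].
    have -> : s 0%N = fun=> 0.
      by apply/funext => x; rewrite /s /series /= big_nil mulr0.
    by split; [exact: integrable0|exact: Rint0].
  have -> : s n.+1 = fun x => s n x + h x * (t * X x) ^+ n / n`!%:R.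
    by apply/funext => x; exact: sE.
  split; first exact: intgD.
  rewrite RintegralD// IH2 add0r.
  under eq_Rintegral do rewrite exprMn mulrCA -mulrA mulrC -!mulrA.
  have [tn0|tn0] := eqVneq (t ^+ n / n`!%:R) 0.
    under eq_Rintegral => x _.
      rewrite (_ : _ * _ = (h x * X x ^+ n) * (t ^+ n / n`!%:R)).
        rewrite tn0 mulr0; over.
      ring.
    exact: Rint0.
  under eq_Rintegral => x _.
    rewrite (_ : _ * _ = (t ^+ n / n`!%:R) * (h x * X x ^+ n)); first over.
    ring.
  rewrite RintegralZl ?m0 ?mulr0//.
  have := intgZl (t ^+ n / n`!%:R)^-1 (it n).
  congr (integrable _ _ _); apply/funext => x /=; congr EFin.
  rewrite (_ : _ * _ = (t ^+ n / n`!%:R)^-1 * (t ^+ n / n`!%:R) * (h x * X x ^+ n)).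
    by rewrite mulVf// mul1r.
  rewrite exprMn; ring.
have [||||_] := @dct s (fun x => h x * expR (t * X x))
  (fun x => `|h x * expR `|t * X x| |).
- by move=> n; apply: intg_measurable; exact: (si n).1.
- by move=> x; apply: cvgMr; exact: is_cvg_series_exp_coeff.
- exact: integrable_norm.
- move=> n x; rewrite /s; move: (t * X x) => y.
  rewrite !normrM ler_wpM2l// (ger0_norm (expR_ge0 _)).
  apply: (le_trans (ler_norm_sum _ _ _)).
  have -> : \sum_(0 <= i < n) `|exp_coeff y i| =
      series (exp_coeff `|y|) n.
    apply: eq_bigr => i _; rewrite /exp_coeff normrM normrX normfV.
    by rewrite (ger0_norm (ler0n _ _)).
  apply: nondecreasing_cvgn_le; last exact: is_cvg_series_exp_coeff.
  by apply: nondecreasing_series => k _ _; exact: exp_coeff_ge0.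
under eq_fun do rewrite (si _).2.
by move=> /cvg_lim => /(_ (@Rhausdorff _)) <-; rewrite lim_cst.
Qed.

(** The exponential series is integrable term by term only for small exponents.
    The damping factor exp(- s X) is therefore introduced in N steps of length at
    most tau / 2, and the induction carries all powers of X along. *)
Lemma exp_moment_iter h X (tau s : R) : measurable_fun setT h ->
  measurable_fun setT X -> (forall x, 0 <= X x) -> 0 < tau -> 0 <= s ->
  intg mu (fun x => h x * expR (tau * X x)) ->
  (forall j, \int[mu]_x (h x * X x ^+ j) = 0) ->
  forall j, \int[mu]_x (h x * X x ^+ j * expR (- (s * X x))) = 0.
Proof.
move=> mh mX X0 tau0 s0 hi m0.
have [N N0 sN] : exists2 N : nat, (0 < N)%N & s / N%:R <= tau / 2.
  exists (Num.truncn (s / (tau / 2))).+1 => //.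
  rewrite ler_pdivrMr ?ltr0n// mulrC -ler_pdivrMr ?divr_gt0//.
  by rewrite ltW// truncnS_gt.
set delta := s / N%:R in sN.
have d0 : 0 <= delta by rewrite divr_ge0.
have sE : s = N%:R * delta.
  by rewrite /delta mulrC divfK// pnatr_eq0 -lt0n.
suff H k j : \int[mu]_x (h x * X x ^+ j * expR (- (k%:R * delta * X x))) = 0.
  by move=> j; rewrite sE; exact: H.
elim: k j => [|k IH] j.
  by under eq_Rintegral do rewrite !mul0r oppr0 expR0 mulr1.
under eq_Rintegral => x _.
  rewrite (_ : _ * _ = h x * X x ^+ j * expR (- (k%:R * delta * X x)) *
    expR (- delta * X x)); first over.
  by rewrite -[RHS]mulrA -expRD; congr (_ * expR _); rewrite -natr1; ring.
apply: exp_moment => //.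
- apply: measurable_funM => //.
    by apply: measurable_funM => //; exact: measurable_funX.
  by apply: measurableT_comp => //; apply: measurableT_comp => //;
    exact: measurable_funM.
- apply: le_intg (intgZl (j`!%:R / (tau / 2) ^+ j) hi) => [|x].
    apply: measurable_funM.
      apply: measurable_funM.
        by apply: measurable_funM => //; exact: measurable_funX.
      by apply: measurableT_comp => //; apply: measurableT_comp => //;
        exact: measurable_funM.
    by apply: measurableT_comp => //; apply: measurableT_comp => //;
      exact: measurable_funM.
  have := X0 x; move: (X x) => y y0.
  have -> : `|- delta * y| = delta * y by rewrite mulNr normrN ger0_norm// mulr_ge0.
  rewrite (_ : h x * y ^+ j * _ * _ =
    h x * (y ^+ j * expR (- (k%:R * delta * y)) * expR (delta * y))); last by ring.
  rewrite [X in _ <= `|X|]mulrCA 2!(normrM (h x)) ler_wpM2l//.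
  rewrite ger0_norm; last by rewrite !mulr_ge0 ?expR_ge0// exprn_ge0.
  rewrite ger0_norm; last by rewrite !mulr_ge0 ?expR_ge0// invr_ge0 exprn_ge0// divr_ge0// ltW.
  have -> : expR (tau * y) = expR (tau / 2 * y) * expR (tau / 2 * y).
    by rewrite -expRD; congr expR; field.
  rewrite -[leLHS]mulrA [leRHS]mulrA ler_pM//.
  + by rewrite exprn_ge0.
  + by apply: expr_le_expR => //; rewrite divr_gt0.
  + rewrite -expRD ler_expR.
    have := ler_wpM2r y0 sN.
    have : 0 <= k%:R * delta * y by rewrite !mulr_ge0.
    lra.
- move=> i; have := IH (j + i)%N.
  by under eq_Rintegral => x _ do rewrite exprD mulrA mulrAC.
Qed.

Lemma poly_moment h X : measurable_fun setT X ->
  (forall j, intg mu (fun x => h x * X x ^+ j)) ->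
  (forall j, \int[mu]_x (h x * X x ^+ j) = 0) ->
  forall p : {poly R}, \int[mu]_x (h x * p.[X x]) = 0.
Proof.
move=> mX hi m0 p.
suff H n : intg mu (fun x => \sum_(i < n) h x * (p`_i * X x ^+ i)) /\
    \int[mu]_x (\sum_(i < n) h x * (p`_i * X x ^+ i)) = 0.
  by under eq_Rintegral => x _ do rewrite horner_coef mulr_sumr; exact: (H _).2.
elim: n => [|n [IH1 IH2]].
  rewrite (_ : (fun x => _) = fun=> 0); last by apply/funext => x; rewrite big_ord0.
  by split; [exact: integrable0|exact: Rint0].
have it : intg mu (fun x => h x * (p`_n * X x ^+ n)).
  under eq_fun do rewrite mulrCA.
  exact: intgZl.
rewrite (_ : (fun x => _) = fun x => \sum_(i < n) h x * (p`_i * X x ^+ i) +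
    h x * (p`_n * X x ^+ n)); last by apply/funext => x; rewrite big_ord_recr.
split; first exact: intgD.
rewrite RintegralD// IH2 add0r.
under eq_Rintegral do rewrite mulrCA.
by rewrite RintegralZl ?m0 ?mulr0.
Qed.

(** From 1 - m t <= (1 - t)^m <= exp(- m t): the two regimes are separated by
    the growth or decay of n (2 y)^n. *)
Lemma half_threshold_cvg (y : R) : 0 <= y <= 1 ->
  (1 - (1 - y ^+ n) ^+ (n * 2 ^ n)) @[n --> \oo] --> ((2^-1 <= y)%R%:R : R).
Proof.
move=> /andP[y0 y1].
have yn n : 0 <= y ^+ n <= 1 by rewrite exprn_ge0// exprn_ile1.
have b0 n : 0 <= (1 - y ^+ n) ^+ (n * 2 ^ n).
  by rewrite exprn_ge0// subr_ge0; case/andP: (yn n).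
have [hy|hy] := leP 2^-1 y => /=.
  rewrite -[X in _ --> X]subr0; apply: cvgB; first exact: cvg_cst.
  apply: (@squeeze_cvgr _ _ _ _ (fun=> 0) (fun n => expR (- n%:R))).
  - apply: nearW => n; rewrite b0 /=.
    have : 1 - y ^+ n <= expR (- y ^+ n) by rewrite (le_trans _ (expR_ge1Dx _)).
    move=> /(lerXn2r (n * 2 ^ n)); rewrite !nnegrE => H.
    apply: (le_trans (H _ _)).
    + by rewrite subr_ge0; case/andP: (yn n).
    + exact: expR_ge0.
    + rewrite -expRM_natl ler_expR mulrN lerN2 natrM -mulrA ler_peMr//.
      rewrite natrX -exprMn exprn_ege1// mulrC -ler_pdivrMr//.
      by rewrite div1r.
  - exact: cvg_cst.
  - by apply: (@cvg_comp _ _ _ (fun n : nat => n%:R) (fun x : R => expR (- x)));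
      [exact: cvgr_idn|exact: cvgr_expR].
have c0 : (n%:R * (2 * y) ^+ n : R) @[n --> \oo] --> (0 : R).
  pose t := 1 - 2 * y.
  have t0 : 0 < t by rewrite /t; lra.
  apply: (@squeeze_cvgr _ _ _ _ (fun=> 0) (fun n => 4 / t ^+ 2 * harmonic n)).
  - apply: nearW => n; rewrite mulr_ge0//= ?exprn_ge0 ?mulr_ge0//.
    have h1 : (2 * y) ^+ n <= expR (- (t * n%:R)).
      rewrite mulrC -(mulrC n%:R) -mulrN expRM_natl (mulrC y) lerXn2r ?nnegrE ?expR_ge0 ?mulr_ge0//.
      by apply: le_trans (expR_ge1Dx _); rewrite /t; lra.
    have := expr_le_expR 2 t0 (ler0n R n) => h2.
    have h3 : n%:R * (n.+1)%:R <= 2 * n%:R ^+ 2 :> R.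
      by rewrite -natrX -!natrM ler_nat expnS expn1 mulnCA leq_mul2l; case: (n) => // k; rewrite orbC mul2n -addnn addSnnS leq_addl.
    rewrite /harmonic ler_pdivlMr ?ltr0n// mulrAC.
    apply: (@le_trans _ _ (2 * n%:R ^+ 2 * expR (- (t * n%:R)))).
      by rewrite ler_pM// ?mulr_ge0// exprn_ge0// mulr_ge0.
    rewrite expRN ler_pdivrMr ?expR_gt0//.
    apply: (le_trans (ler_wpM2l (ler0n R 2) h2)).
    by rewrite 2!mulrA -natrM.
  - exact: cvg_cst.
  - rewrite -[X in _ --> X](mulr0 (4 / t ^+ 2)).
    by apply: cvgMr; exact: cvg_harmonic.
apply: (@squeeze_cvgr _ _ _ _ (fun=> 0) (fun n => n%:R * (2 * y) ^+ n)) => //.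
  apply: nearW => n; have /andP[yn0 yn1] := yn n.
  rewrite subr_ge0 exprn_ile1 ?subr_ge0// ?gerBl//=.
  have : 1 - (n * 2 ^ n)%:R * y ^+ n <= (1 - y ^+ n) ^+ (n * 2 ^ n).
    elim: (n * 2 ^ n)%N => [|k IH]; first by rewrite mul0r subr0 expr0.
    rewrite exprS -natr1.
    have : (1 - y ^+ n) * (1 - k%:R * y ^+ n) <= (1 - y ^+ n) * (1 - y ^+ n) ^+ k.
      by rewrite ler_wpM2l// subr_ge0.
    apply: le_trans.
    have : 0 <= k%:R * (y ^+ n * y ^+ n) by rewrite !mulr_ge0.
    nra.
  rewrite natrM natrX exprMn; nra.
exact: cvg_cst.
Qed.

(** Polynomials in G, which the hypothesis controls, converge boundedly to
    the indicator of a superlevel set of G. *)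
Lemma superlevel_moment h G : measurable_fun setT G ->
  (forall x, 0 <= G x <= 1) -> intg mu h ->
  (forall j, \int[mu]_x (h x * G x ^+ j) = 0) ->
  \int[mu]_x (h x * (2^-1 <= G x)%R%:R) = 0.
Proof.
move=> mG G01 ih m0; have mh := intg_measurable ih.
have ihG j : intg mu (fun x => h x * G x ^+ j).
  apply: le_intg ih => [|x].
    by apply: measurable_funM => //; exact: measurable_funX.
  have /andP[G0 G1] := G01 x.
  by rewrite normrM ler_piMr// ger0_norm ?exprn_ge0// exprn_ile1.
pose p n : {poly R} := 1 - (1 - 'X^n) ^+ (n * 2 ^ n).
have pE n x : (p n).[G x] = 1 - (1 - G x ^+ n) ^+ (n * 2 ^ n).
  by rewrite /p !(hornerE, hornerXn).
have [||||_] := @dct (fun n x => h x * (p n).[G x])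
  (fun x => h x * (2^-1 <= G x)%R%:R) (fun x => `|h x|).
- move=> n; apply: measurable_funM => //.
  under eq_fun do rewrite pE.
  apply: measurable_funB => //; apply: measurable_funX; apply: measurable_funB => //.
  exact: measurable_funX.
- move=> x; apply: cvgMr; under eq_fun do rewrite pE.
  exact: half_threshold_cvg.
- exact: integrable_norm.
- move=> n x; rewrite pE normrM ler_piMr//.
  have /andP[G0 G1] := G01 x.
  have /andP[a b] : 0 <= (1 - G x ^+ n) ^+ (n * 2 ^ n) <= 1.
    by rewrite exprn_ge0 ?exprn_ile1// ?subr_ge0 ?exprn_ile1// gerBl exprn_ge0.
  rewrite ger0_norm ?subr_ge0//; lra.
under eq_fun do rewrite (poly_moment mG ihG m0).
by move=> /cvg_lim => /(_ (@Rhausdorff _)) <-; rewrite lim_cst.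
Qed.

(** The set X <= M is a superlevel set of G = exp(- s X) for s = ln 2 / M, and
    the powers of G are damping factors. *)
Lemma sublevel_moment h X (tau M : R) : measurable_fun setT h ->
  measurable_fun setT X -> (forall x, 0 <= X x) -> 0 < tau -> 0 < M ->
  intg mu (fun x => h x * expR (tau * X x)) ->
  (forall j, \int[mu]_x (h x * X x ^+ j) = 0) ->
  \int[mu]_x (h x * (X x <= M)%R%:R) = 0.
Proof.
move=> mh mX X0 tau0 M0 hi m0.
pose s : R := ln 2 / M.
have s0 : 0 < s by rewrite divr_gt0// ln_gt0// ltr1n.
have ih : intg mu h.
  apply: le_intg hi => // x; rewrite normrM ler_peMr// ger0_norm ?expR_ge0//.
  by rewrite -expR0 ler_expR mulr_ge0// ltW.
have H x : (X x <= M) = (2^-1 <= expR (- (s * X x))).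
  rewrite -[2^-1]lnK ?posrE ?invr_gt0// ler_expR lnV ?posrE// lerN2.
  by rewrite /s mulrAC ler_pdivrMr// ler_pM2l// ln_gt0// ltr1n.
under eq_Rintegral do rewrite H.
apply: superlevel_moment => //.
- apply: measurableT_comp => //; apply: measurableT_comp => //.
  exact: measurable_funM.
- by move=> x; rewrite expR_ge0/= -expR0 ler_expR oppr_le0 mulr_ge0// ltW.
- move=> j.
  under eq_Rintegral => x _ do rewrite -expRM_natl mulrN mulrA.
  have := @exp_moment_iter h X tau (j%:R * s) mh mX X0 tau0 _ hi m0 0%N.
  under eq_Rintegral => x _ do rewrite expr0 mulr1.
  by apply; rewrite mulr_ge0// ltW.
Qed.

End integration.

(** * Determinacy by moments under Gaussian decay *)

Lemma measurable_sublevel {d : measure_display} {T : measurableType d}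
  {R : realType} (f : T -> R) (M : R) :
  measurable_fun setT f -> measurable [set x | f x <= M].
Proof.
move=> mf; have := mf measurableT _ (measurable_itv `]-oo, M]).
rewrite setTI (_ : f @^-1` _ = [set x | f x <= M]) //.
Qed.

Section gaussian_determinacy.
Context {d : measure_display} {T : measurableType d} {R : realType}.
Variable mu : {measure set T -> \bar R}.
Implicit Types (h X : T -> R).

Lemma normr_bool_le1 (b : bool) : `|b%:R : R| <= 1.
Proof. by case: b; rewrite ?normr1 ?normr0. Qed.

Lemma indic_le1 (U : Type) (A : set U) (x : U) : `|\1_A x : R| <= 1.
Proof. by rewrite indicE; exact: normr_bool_le1. Qed.

Lemma measurable_indic_comp {d' : measure_display} {U : measurableType d'}
    (A : set U) (X : T -> U) : measurable A ->
  measurable_fun setT X -> measurable_fun setT (fun x => \1_A (X x) : R).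
Proof. by move=> mA mX; apply: (measurableT_comp (measurable_indic _)). Qed.

Lemma intgM_indic {d' : measure_display} {U : measurableType d'} h
    (X : T -> U) (A : set U) : measurable A -> measurable_fun setT X ->
  intg mu h -> intg mu (fun x => h x * \1_A (X x)).
Proof.
move=> mA mX ih; apply: le_intg (ih) => [|x].
  apply: measurable_funM; [exact: intg_measurable ih|exact: measurable_indic_comp].
by rewrite normrM ler_piMr// indic_le1.
Qed.

Lemma le_norm_factor (a u k v : R) : `|u| <= `|k * v| -> `|a * u| <= `|k * (a * v)|.
Proof. by move=> H; rewrite mulrCA !(normrM a) ler_wpM2l. Qed.

(** The sets over which the weighted integral vanishes form a Dynkin system. *)
Lemma indic_dynkin {d' : measure_display} {U : measurableType d'}
    (G : set (set U)) h (X : T -> U) :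
  @measurable _ U = <<s G >> -> setI_closed G ->
  measurable_fun setT X -> intg mu h ->
  \int[mu]_x h x = 0 ->
  (forall A, G A -> \int[mu]_x (h x * \1_A (X x)) = 0) ->
  forall A, measurable A -> \int[mu]_x (h x * \1_A (X x)) = 0.
Proof.
move=> mG IG mX ih h0 hr A mA.
pose P (B : set U) := \int[mu]_x (h x * \1_B (X x)) = 0.
apply: (@dynkin_induction _ U G P) => //.
- by rewrite /P; under eq_Rintegral do rewrite indicT mulr1.
- move=> S mS PS; rewrite /P.
  have SE x : h x * \1_(~` S) (X x) = h x - h x * \1_S (X x).
    rewrite !indicE in_setC; case: (_ \in _); rewrite /= ?mulr1 ?mulr0 ?subr0//.
    by rewrite subrr.
  under eq_Rintegral do rewrite SE.
  by rewrite RintegralB ?h0 ?PS ?subrr//; exact: intgM_indic.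
- move=> F mF tF PF; rewrite /P.
  pose f n x := \sum_(k < n) h x * \1_(F k) (X x).
  have fP n : intg mu (f n) /\ \int[mu]_x f n x = 0.
    elim: n => [|n [IH1 IH2]].
      rewrite (_ : f 0%N = fun=> 0); last by apply/funext => x; rewrite /f big_ord0.
      by split; [exact: integrable0|exact: Rint0].
    have -> : f n.+1 = fun x => f n x + h x * \1_(F n) (X x).
      by apply/funext => x; rewrite /f big_ord_recr.
    have i2 := intgM_indic (mF n) mX ih.
    split; first exact: intgD.
    by rewrite RintegralD// IH2 add0r; exact: PF.
  have fE n x : (f n x = h x * \1_(\bigcup_k F k) (X x)) \/ f n x = 0.
    rewrite /f -mulr_sumr.
    have [[k Fk]|nF] := pselect (exists k : 'I_n, F k (X x)).
      left; congr (_ * _); rewrite (bigD1 k)//= big1 => [|i ik].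
        by rewrite addr0 !indicE !mem_set//; exists k.
      rewrite indicE memNset// => Fi.
      have := tF i k I I; move=> /(_ (ex_intro _ _ (conj Fi Fk))) /val_inj ik'.
      by rewrite ik' eqxx in ik.
    right; rewrite big1 ?mulr0// => i _; rewrite indicE memNset// => Fi.
    by apply: nF; exists i.
  have [||||_] := @dct _ _ _ mu f (fun x => h x * \1_(\bigcup_k F k) (X x))
    (fun x => `|h x|).
  + by move=> n; apply: intg_measurable; exact: (fP n).1.
  + move=> x; have [[k _ Fk]|nF] := pselect ((\bigcup_k F k) (X x)).
      apply: cvg_near_cst; exists k.+1 => // n /= kn.
      rewrite /f -mulr_sumr; congr (_ * _).
      rewrite (bigD1 (Ordinal kn))//= big1 => [|i ik].
        by rewrite addr0 !indicE !mem_set//; exists k.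
      rewrite indicE memNset// => Fi.
      have := tF i k I I; move=> /(_ (ex_intro _ _ (conj Fi Fk))) ik'.
      by move/eqP: ik; apply; apply: val_inj.
    apply: cvg_near_cst; apply: nearW => n.
    rewrite indicE (memNset nF) mulr0 /f big1// => i _.
    by rewrite indicE memNset ?mulr0// => Fi; apply: nF; exists i.
  + exact: integrable_norm.
  + move=> n x; have [->|->] := fE n x; last by rewrite normr0.
    by rewrite normrM ler_piMr// indic_le1.
  under eq_fun do rewrite (fP _).2.
  by move=> /cvg_lim => /(_ (@Rhausdorff _)) <-; rewrite lim_cst.
- by rewrite -mG.
Qed.

Lemma intg_pow h X (tau : R) j : measurable_fun setT h ->
  measurable_fun setT X -> 0 < tau ->
  intg mu (fun x => h x * expR (tau * X x ^+ 2)) ->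
  intg mu (fun x => h x * X x ^+ j).
Proof.
move=> mh mX tau0 hi.
apply: le_intg (intgZl (1 + j`!%:R / tau ^+ j) hi) => [|x].
  by apply: measurable_funM => //; exact: measurable_funX.
have := expr_le_expR j tau0 (sqr_ge0 (X x)).
have : `|X x| ^+ j <= 1 + (X x ^+ 2) ^+ j.
  rewrite -(real_normK (num_real (X x))); move: (`|X x|) => y.
  rewrite -exprM mulnC exprM; move: (y ^+ j) => t; nra.
have : 1 <= expR (tau * X x ^+ 2).
  by rewrite -expR0 ler_expR mulr_ge0 ?sqr_ge0// ltW.
move: (expR _) => E E1 H1 H2.
apply: le_norm_factor; rewrite normrX (le_trans H1)//.
rewrite ger0_norm; last first.
  rewrite mulr_ge0 ?addr_ge0 ?divr_ge0 ?exprn_ge0// ?(ltW tau0)//.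
  by apply: le_trans E1.
by rewrite mulrDl mul1r lerD.
Qed.

(** The sublevel sets of (X - p)^2 are intervals.  Those of centre a + n and
    radius n exhaust a half-line, and half-lines generate the Borel sets. *)
Lemma gaussian_moment h X (tau : R) : measurable_fun setT h ->
  measurable_fun setT X -> 0 < tau ->
  intg mu (fun x => h x * expR (tau * X x ^+ 2)) ->
  (forall j, \int[mu]_x (h x * X x ^+ j) = 0) ->
  forall A, measurable A -> \int[mu]_x (h x * \1_A (X x)) = 0.
Proof.
move=> mh mX tau0 hi m0.
have ip j := intg_pow j mh mX tau0 hi.
have ih : intg mu h by have := ip 0%N; under eq_fun do rewrite expr0 mulr1.
have sq p M : 0 < M -> \int[mu]_x (h x * (((X x - p) ^+ 2 <= M)%R%:R)) = 0.
  move=> M0; apply: (@sublevel_moment _ _ _ mu h (fun x => (X x - p) ^+ 2) (tau / 2)) => //.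
  - by apply: measurable_funX; exact: measurable_funB.
  - by move=> x; exact: sqr_ge0.
  - by rewrite divr_gt0.
  - apply: le_intg (intgZl (expR (tau * p ^+ 2)) hi) => [|x].
      apply: measurable_funM => //; apply: measurableT_comp => //.
      by apply: measurable_funM => //; apply: measurable_funX; exact: measurable_funB.
    apply: le_norm_factor; rewrite -expRD !ger0_norm ?expR_ge0//.
    rewrite ler_expR; have := mulr_ge0 (ltW tau0) (sqr_ge0 (X x + p)).
    lra.
  - move=> j; have := poly_moment mX ip m0 ((('X - p%:P) ^+ 2) ^+ j).
    by under eq_Rintegral do rewrite !hornerE.
apply: (@indic_dynkin _ (measurableTypeR R) (@RGenCInfty.G R)) => //.
- exact: RGenCInfty.measurableE.
- move=> _ _ [a ->] [b ->]; exists (Num.max a b).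
  by rewrite predeqE => x; split => /=; rewrite !in_itv/= !andbT ge_max;
    [move=> [-> ->]|move/andP].
- by have := m0 0%N; under eq_Rintegral do rewrite expr0 mulr1.
move=> _ [a ->].
pose f n x := h x * (((X x - (a + n.+1%:R)) ^+ 2 <= n.+1%:R ^+ 2)%R%:R).
have [||||_] := @dct _ _ _ mu f (fun x => h x * \1_(`[a, +oo[%classic) (X x))
    (fun x => `|h x|).
- move=> n; apply: measurable_funM => //.
  rewrite (_ : (fun x => _) = fun x => \1_([set y | (y - (a + n.+1%:R)) ^+ 2 <= n.+1%:R ^+ 2]) (X x)).
    apply: measurable_indic_comp => //.
    apply: (measurable_sublevel (f := fun y : R => (y - (a + n.+1%:R)) ^+ 2)).
    by apply: measurable_funX; exact: measurable_funB.
  by apply/funext => x; rewrite indicE; congr (_%:R); case: (boolP (_ <= _)) => H;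
    [rewrite mem_set|rewrite memNset//; exact/negP].
- move=> x; apply: cvgMr; apply: cvg_near_cst.
  exists (Num.truncn `|X x - a|) => // n /= xn.
  have {xn} : `|X x - a| < n.+1%:R by rewrite (lt_le_trans (truncnS_gt _))// ler_nat ltnS.
  rewrite ltr_norml => /andP[x1 x2].
  rewrite indicE mem_setE in_itv/= andbT; move: (n.+1%:R) x1 x2 => N x1 x2.
  congr (_%:R); apply: congr1; have [ax|ax] := leP a (X x).
    apply/idP; rewrite -subr_ge0.
    rewrite (_ : _ - _ = (X x - a) * (2 * N - (X x - a))); last by ring.
    by rewrite mulr_ge0//; lra.
  apply/negP; apply/negP; rewrite -ltNge -subr_gt0.
  rewrite (_ : _ - _ = (a - X x) * (2 * N - (X x - a))); last by ring.
  by rewrite mulr_gt0//; lra.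
- exact: integrable_norm.
- move=> n x; rewrite /f normrM ler_piMr//.
  exact: normr_bool_le1.
under eq_fun do rewrite sq ?exprn_gt0//.
by move=> /cvg_lim => /(_ (@Rhausdorff _)) <-; rewrite lim_cst.
Qed.

End gaussian_determinacy.

Section plane.
Context {R : realType}.
Notation T := (measurableTypeR R * measurableTypeR R)%type.
Variable mu : {measure set T -> \bar R}.

(** Vanishing on rectangles comes from the one-variable case used twice, and
    rectangles generate the Borel sets of the plane. *)
Lemma gaussian_moment2 (g : T -> R) (c : R * R) (tau : R) : 0 < tau ->
  measurable_fun setT g ->
  intg mu (fun x => g x * expR (tau * ((x.1 - c.1) ^+ 2 + (x.2 - c.2) ^+ 2))) ->
  (forall i j, \int[mu]_x (g x * (x.1 - c.1) ^+ i * (x.2 - c.2) ^+ j) = 0) ->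
  {ae mu, forall x, g x = 0}.
Proof.
move=> tau0 mg gi m0.
pose X (x : T) := x.1 - c.1. pose Y (x : T) := x.2 - c.2.
have mX : measurable_fun setT X by apply: measurable_funB => //; exact: measurable_fst.
have mY : measurable_fun setT Y by apply: measurable_funB => //; exact: measurable_snd.
have mE (Z : T -> R) s : measurable_fun setT Z ->
    measurable_fun setT (fun x => expR (s * Z x ^+ 2)).
  move=> mZ; apply: measurableT_comp => //; apply: measurable_funM => //.
  exact: measurable_funX.
have giY j : intg mu (fun x => g x * expR (tau * X x ^+ 2) * Y x ^+ j).
  apply: (intg_pow _ _ mY tau0) => //.
    by apply: measurable_funM => //; exact: mE.
  by under eq_fun do rewrite -mulrA -expRD -mulrDr.
have ig : intg mu g.
  apply: le_intg gi => // x; rewrite normrM ler_peMr// ger0_norm ?expR_ge0//.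
  by rewrite -expR0 ler_expR mulr_ge0 ?(ltW tau0)// addr_ge0// sqr_ge0.
have XA A : measurable A -> forall j, \int[mu]_x (g x * \1_A (X x) * Y x ^+ j) = 0.
  move=> mA j; under eq_Rintegral do rewrite mulrAC.
  apply: (gaussian_moment _ mX tau0) mA => //.
  - by apply: measurable_funM => //; exact: measurable_funX.
  - by under eq_fun do rewrite mulrAC.
  - by move=> i; under eq_Rintegral do rewrite mulrAC; exact: m0.
have XYAB A B : measurable A -> measurable B ->
    \int[mu]_x (g x * \1_A (X x) * \1_B (Y x)) = 0.
  move=> mA mB; apply: (gaussian_moment _ mY tau0) => //.
  - by apply: measurable_funM => //; exact: measurable_indic_comp.
  - apply: le_intg gi => [|x].
      by apply: measurable_funM; [apply: measurable_funM => //; exact: measurable_indic_comp|exact: mE].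
    rewrite -mulrA !normrM ler_wpM2l// !(ger0_norm (expR_ge0 _)).
    rewrite (@le_trans _ _ (1 * expR (tau * Y x ^+ 2)))//.
      by rewrite ler_wpM2r ?expR_ge0// indic_le1.
    rewrite mul1r ler_expR ler_wpM2l ?(ltW tau0)// lerDr; exact: sqr_ge0.
  - exact: XA.
have rect A B : measurable A -> measurable B -> \int[mu]_(x in A `*` B) g x = 0.
  move=> mA mB; rewrite Rintegral_mkcond.
  have mt (a : R) (S : set R) : measurable S -> measurable [set t | S (t + a)].
    move=> mS; rewrite -[X in measurable X]setTI.
    by apply: (@measurable_funD _ _ R setT id (cst a)).
  rewrite -[RHS](XYAB _ _ (mt c.1 _ mA) (mt c.2 _ mB)).
  apply: eq_Rintegral => x _; rewrite patchE !indicE /X /Y.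
  have -> : (x.1 - c.1 \in [set t | A (t + c.1)]) = (x.1 \in A).
    by apply/idP/idP; rewrite !inE /= subrK.
  have -> : (x.2 - c.2 \in [set t | B (t + c.2)]) = (x.2 \in B).
    by apply/idP/idP; rewrite !inE /= subrK.
  by rewrite in_setX; case: (_ \in A); case: (_ \in B); rewrite /= ?mulr0 ?mulr1 ?mul0r.
have all0 E : measurable E -> \int[mu]_(x in E) g x = 0.
  move=> mE'; rewrite Rintegral_mkcond.
  under eq_Rintegral do rewrite patchE.
  have := @indic_dynkin _ _ _ mu _ T
    [set A `*` B | A in measurable & B in measurable] g id _ _ _ ig _ _ E mE'.
  move=> H; rewrite -[RHS]H//.
  - by apply: eq_Rintegral => x _; rewrite indicE; case: (_ \in _); rewrite /= ?mulr1 ?mulr0.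
  - by rewrite measurable_prod_measurableType.
  - move=> _ _ [A mA [B mB <-]] [A' mA' [B' mB' <-]].
    exists (A `&` A'); first exact: measurableI.
    by exists (B `&` B'); [exact: measurableI|rewrite setXI].
  - by have := m0 0%N 0%N; under eq_Rintegral do rewrite !expr0 !mulr1.
  - move=> _ [A mA [B mB <-]]; rewrite -[RHS](rect A B)// [RHS]Rintegral_mkcond.
    apply: eq_Rintegral => x _; rewrite indicE patchE.
    by case: (_ \in _); rewrite /= ?mulr1 ?mulr0.
have := @integral_ae_eq _ _ _ mu setT measurableT (EFin \o cst 0) (EFin \o g) ig.
case.
- by apply: measurableT_comp => //; exact: measurable_cst.
- move=> E _ mE'.
  rewrite -[LHS]fineK; last by apply: integrable_fin_num => //; apply: integrableS ig.
  by rewrite -[fine _]/(\int[mu]_(x in E) g x) all0// integral0.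
- move=> N [mN N0 sub]; exists N; split => // x /= Hx; apply: sub => /= H.
by apply: Hx; have /= [] := H I.
Qed.

End plane.

(** * Charlier polynomials *)

Section charlier.
Context {R : realType}.
Implicit Types (y : R).

(** The Charlier polynomial of degree q and parameter 1 / y at the integer n, as
    a function of y. *)
Definition charlier (q n : nat) y : R :=
  \sum_(i < q.+1) ('C(q, i) * n ^_ i)%:R * (- y) ^+ i.

Lemma charlierE q n y N : (q < N)%N ->
  charlier q n y = \sum_(i < N) ('C(q, i) * n ^_ i)%:R * (- y) ^+ i.
Proof.
move=> qN; rewrite /charlier (big_ord_widen _ (fun i => ('C(q, i) * n ^_ i)%:R * (- y) ^+ i) qN).
rewrite big_mkcond; apply: eq_bigr => i _; case: ltnP => // qi.
by rewrite bin_small// mul0n mul0r.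
Qed.

(** The three-term recurrence in the degree; at q = 0 its last term vanishes. *)
Lemma charlier_rec q n y :
  charlier q.+1 n y = (1 + y * q%:R - y * n%:R) * charlier q n y
    - y * q%:R * charlier q.-1 n y.
Proof.
rewrite (@charlierE q.+1 n y q.+2)// [LHS]big_ord_recl /=.
rewrite [X in (1 + _ - _) * X](@charlierE q n y q.+2)//.
rewrite [X in _ - _ * X](@charlierE q.-1 n y q.+1) ?ltnS ?leq_pred//.
rewrite [X in _ = X - _](_ : _ =
    \sum_(i < q.+2) ('C(q, i) * n ^_ i)%:R * (- y) ^+ i +
    (y * q%:R - y * n%:R) * \sum_(i < q.+1) ('C(q, i) * n ^_ i)%:R * (- y) ^+ i);
  last by rewrite -!(charlierE n y)//; ring.
rewrite [X in _ = X + _ - _]big_ord_recl /= !mulr_sumr -!addrA.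
rewrite !bin0; congr (_ + _); rewrite -sumrB -big_split /=; apply: eq_bigr => i _.
rewrite /bump /= !add1n binS ffactnSr exprS.
have H : (q%:R * 'C(q.-1, i)%:R = (q%:R - i%:R) * 'C(q, i)%:R :> R).
  have iq : (i <= q)%N by rewrite -ltnS.
  by rewrite -natrB// -!natrM mul_bin_diag mul_bin_left.
have H2 : ((n ^_ i * (n - i))%:R = (n ^_ i)%:R * (n%:R - i%:R) :> R).
  have [iq|iq] := leqP i n; first by rewrite -natrB// -natrM.
  by rewrite ffact_small// mul0r.
rewrite (natrM _ ('C(q, i.+1) + _)) (natrM _ 'C(q, i.+1)) H2 !natrM natrD.
have -> : y * q%:R * ('C(q.-1, i)%:R * (n ^_ i)%:R * (- y) ^+ i) =
   y * (q%:R * 'C(q.-1, i)%:R) * (n ^_ i)%:R * (- y) ^+ i by ring.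
by rewrite H; ring.
Qed.

Lemma charlier0 n y : charlier 0 n y = 1.
Proof. by rewrite /charlier big_ord1 bin0 ffactn0 expr0 mulr1. Qed.

Lemma charlier1 n y : charlier 1 n y = 1 - y * n%:R.
Proof. by rewrite charlier_rec !charlier0; ring. Qed.

(** For fixed y the values are those of a polynomial of degree q in n. *)
Lemma charlier_num_zeros q y (s : seq nat) : 0 < y -> uniq s ->
  (forall n, n \in s -> charlier q n y = 0) -> (size s <= q)%N.
Proof.
move=> y0 us s0.
pose step k (a b : {poly R}) :=
  (1 + y * k.+1%:R)%:P * b - y *: ('X * b) - (y * k.+1%:R) *: a.
have [p [p' [[pE p'E] [sp sp']]]] : exists p p' : {poly R},
    ((forall n, p.[n%:R] = charlier q n y) /\
     (forall n, p'.[n%:R] = charlier q.+1 n y)) /\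
    (size p = q.+1 /\ size p' = q.+2).
  elim: q {s0} => [|q [p [p' [[pE p'E] [sp sp']]]]].
    exists 1, (1 - y *: 'X); split; [split=> n|split].
    - by rewrite charlier0 hornerC.
    - by rewrite charlier1 !hornerE.
    - by rewrite size_poly1.
    - by rewrite addrC -scaleNr size_polyDl size_scale ?oppr_eq0 ?gt_eqF// size_polyX ?size_poly1.
  exists p', (step q p p'); split; split=> //.
    move=> n; rewrite (charlier_rec q.+1) /step !(hornerD, hornerN, hornerZ, hornerM, hornerC, hornerX) pE p'E /=; ring.
  have p'0 : p' != 0 by rewrite -size_poly_eq0 sp'.
  have s2 : size ((y * q.+1%:R) *: p) = q.+1.
    by rewrite size_scale// mulf_neq0 ?gt_eqF.
  have s1 : size ((1 + y * q.+1%:R)%:P * p') = q.+2.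
    by rewrite mul_polyC size_scale// gt_eqF// ltr_wpDr// mulr_ge0// ltW.
  have s3 : size (y *: ('X * p')) = q.+3.
    by rewrite size_scale ?gt_eqF// mulrC size_mulX// sp'.
  rewrite /step size_polyDl ?size_polyN; rewrite addrC size_polyDl ?size_polyN ?s1 ?s2 ?s3//.
have p0 : p != 0 by rewrite -size_poly_eq0 sp.
have := @max_poly_roots _ p [seq n%:R | n <- s] p0; rewrite size_map sp ltnS; apply.
  by apply/allP => _ /mapP[n ns ->]; rewrite /root pE s0.
by rewrite map_inj_uniq// => a b /eqP; rewrite eqr_nat => /eqP.
Qed.

(** By the recurrence, (-1)^k C_k(n; y) is nondecreasing in k <= q when n is so
    large; its first value is 1. *)
Lemma charlier_neq0 q n y : 0 < y -> 2 <= y * (n%:R - 2 * q%:R) ->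
  charlier q n y != 0.
Proof.
move=> y0 yn.
pose D k := (- 1) ^+ k * charlier k n y.
suff H k : (k <= q)%N -> 0 < D k /\ D k.-1 <= D k.
  have [+ _] := H q (leqnn q).
  by rewrite /D => /lt0r_neq0; rewrite mulf_eq0 negb_or => /andP[].
elim: k => [|k IH] kq; first by rewrite /D charlier0 expr0 mulr1.
have [IH1 IH2] := IH (ltnW kq).
have rec : D k.+1 = (y * n%:R - 1 - y * k%:R) * D k - y * k%:R * D k.-1.
  rewrite /D charlier_rec; case: k {IH IH1 IH2 kq} => [|k] /=.
    by rewrite expr0 expr1; ring.
  by rewrite !exprS; ring.
have kq' : y * k%:R <= y * q%:R - y.
  have : k%:R + 1 <= q%:R :> R by rewrite natr1 ler_nat.
  by move=> /(ler_wpM2l (ltW y0)); lra.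
have yk0 : 0 <= y * k%:R by rewrite mulr_ge0// ltW.
suff : D k <= D k.+1 by move=> H; split => //; apply: lt_le_trans H.
rewrite rec; have : 0 <= y * k%:R * (D k - D k.-1) by rewrite mulr_ge0// subr_ge0.
have : 0 <= (y * n%:R - 2 - 2 * (y * k%:R)) * D k.
  by rewrite mulr_ge0 ?(ltW IH1)//; nra.
lra.
Qed.

Lemma charlier_zeros_finite q n : exists s : seq R,
  forall y, charlier q n y = 0 -> y \in s.
Proof.
pose p : {poly R} := \sum_(i < q.+1) ('C(q, i) * n ^_ i)%:R *: (- 'X) ^+ i.
have pE y : p.[y] = charlier q n y.
  by rewrite /p horner_sum; apply: eq_bigr => i _; rewrite !hornerE.
have p0 : p != 0.
  apply/eqP => p0; have := pE 0; rewrite p0 horner0 /charlier big_ord_recl/=.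
  rewrite bin0 ffactn0 expr0 mulr1 big1 ?addr0 => [/esym/eqP|i _].
    by rewrite oner_eq0.
  by rewrite oppr0 expr0n mulr0.
have [s sP] : exists s : seq R, forall y, root p y -> y \in s.
  by exists (rootsR p) => y y0; rewrite -(roots_on_rootsR p0) in_itv.
by exists s => y y0; apply: sP; rewrite /root pE y0.
Qed.

(** Selects the first zero of a polynomial from the list of its zeros. *)
Lemma seq_min (s : seq R) (P : pred R) : has P s ->
  exists x, [/\ x \in s, P x & forall z, z \in s -> P z -> x <= z].
Proof.
elim: s => //= a s IH; have [hs _|ns] := boolP (has P s).
  have [x [xs Px xm]] := IH hs.
  have [Pa|nPa] := boolP (P a); last first.
    exists x; split => //; first by rewrite inE xs orbT.
    by move=> z; rewrite inE => /predU1P[->|/xm//]; rewrite (negbTE nPa).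
  have [xa|ax] := leP x a.
    exists x; split => //; first by rewrite inE xs orbT.
    by move=> z; rewrite inE => /predU1P[->//|/xm].
  exists a; split => //; first by rewrite mem_head.
  by move=> z; rewrite inE => /predU1P[->//|zs Pz]; rewrite (le_trans (ltW ax))// xm.
rewrite orbF => Pa; exists a; split => //; first by rewrite mem_head.
move=> z; rewrite inE => /predU1P[->//|zs Pz].
by move/hasPn: ns => /(_ _ zs); rewrite Pz.
Qed.

Lemma charlier_ivt q n (a b : R) : a <= b -> 0 <= charlier q n a ->
  charlier q n b <= 0 -> exists2 x, a <= x <= b & charlier q n x = 0.
Proof.
move=> ab Ca Cb.
pose p : {poly R} := \sum_(i < q.+1) ('C(q, i) * n ^_ i)%:R *: (- 'X) ^+ i.
have pE y : p.[y] = charlier q n y.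
  by rewrite /p horner_sum; apply: eq_bigr => i _; rewrite !hornerE.
have [|x xab] := @poly_ivt _ (- p) a b ab.
  by rewrite !hornerN !pE oppr_le0 oppr_ge0 Ca Cb.
by rewrite rootN /root pE => /eqP; exists x.
Qed.

Lemma charlier_at0 q n : charlier q n 0 = 1.
Proof.
rewrite /charlier big_ord_recl/= bin0 ffactn0 expr0 mulr1 big1 ?addr0// => i _.
by rewrite oppr0 expr0n mulr0.
Qed.

(** Sturm-type argument: at the first zero of one function of the family the
    next function is negative, so that the first zeros decrease with q. *)
Lemma charlier_zero q n : (0 < n)%N ->
  exists2 y, 0 < y <= n%:R^-1 & charlier q.+1 n y = 0.
Proof.
move=> n0.
suff [y [yn y0 _ _]] : exists y, [/\ 0 < y <= n%:R^-1, charlier q.+1 n y = 0,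
    forall t, 0 <= t < y -> 0 < charlier q.+1 n t & 0 < charlier q n y].
  by exists y.
elim: q => [|q [y [/andP[y0 yn] Cy Cpos Cy']]].
  exists n%:R^-1; split.
  - by rewrite invr_gt0 ltr0n n0/=.
  - by rewrite charlier1 mulVf ?subrr// pnatr_eq0 -lt0n.
  - move=> t /andP[t0 tn]; rewrite charlier1 subr_gt0 -lter_pdivlMr ?ltr0n//.
    by rewrite div1r.
  - by rewrite charlier0.
have neg : charlier q.+2 n y < 0.
  by rewrite charlier_rec Cy mulr0 sub0r oppr_lt0 /= !mulr_gt0// ltr0n.
have [s sP] := charlier_zeros_finite q.+2 n.
pose P (x : R) := (0 < x <= y) && (charlier q.+2 n x == 0).
have [x0 /andP[x00 x0y] Cx0] : exists2 x, 0 <= x <= y & charlier q.+2 n x = 0.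
  apply: charlier_ivt => //; first exact: ltW.
    by rewrite charlier_at0.
  exact: ltW.
have x0pos : 0 < x0.
  rewrite lt_neqAle x00 andbT; apply/eqP => x0E; move: Cx0.
  by rewrite -x0E charlier_at0; apply/eqP; rewrite oner_eq0.
have hs : has P s by apply/hasP; exists x0; [exact: sP|rewrite /P x0pos x0y Cx0 eqxx].
have [x [_ /andP[/andP[xp xy] /eqP Cx] xm]] := seq_min hs.
have xlty : x < y.
  by rewrite lt_neqAle xy andbT; apply/eqP => xE; rewrite xE in Cx; rewrite Cx ltxx in neg.
exists x; split => //.
- by rewrite xp (le_trans xy).
- move=> t /andP[t0 tx]; rewrite ltNge; apply/negP => Ct.
  have [||z /andP[z0 zt] Cz] := @charlier_ivt q.+2 n 0 t t0 => //.
    by rewrite charlier_at0.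
  have zpos : 0 < z.
    rewrite lt_neqAle z0 andbT; apply/eqP => x0E; move: Cz.
    by rewrite -x0E charlier_at0; apply/eqP; rewrite oner_eq0.
  have := xm z (sP _ Cz); rewrite /P zpos Cz eqxx andbT/= => /(_ _).
  have zx := le_lt_trans zt tx.
  by rewrite (le_trans (ltW zx) xy) => /(_ isT); rewrite leNgt zx.
- by apply: Cpos; rewrite (ltW xp) xlty.
Qed.

End charlier.

(** * Smooth functions on the plane *)

Section directional_derivatives.
Context {R : realType}.
Implicit Types (f g : R * R -> R) (F : R -> R) (x v : R * R).

(** Reduces the chain rule for directional derivatives to that on the line. *)
Lemma is_derive_line f x v (df : R) :
  is_derive x v f df <-> is_derive (0 : R) 1 (fun h : R => f (h *: v + x)) df.
Proof.
have E : (fun h : R => h^-1 *: ((f \o shift x) (h *: v) - f x)) =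
    (fun h : R => h^-1 *: (((fun h : R => f (h *: v + x)) \o shift 0) (h *: 1) -
      f (0 *: v + x))).
  by apply/funext => h; rewrite /= scale0r add0r addr0 [h *: 1]mulr1.
split=> -[D1 D2]; apply: DeriveDef.
- by rewrite /derivable -E.
- by rewrite /derive -E.
- by rewrite /derivable E.
- by rewrite /derive E.
Qed.

Lemma is_derive_chain F f x v (a df : R) : is_derive (f x) 1 F a ->
  is_derive x v f df -> is_derive x v (F \o f) (a * df).
Proof.
move=> Fa /is_derive_line fd; apply/is_derive_line.
by apply: (@is_derive1_comp _ F (fun h : R => f (h *: v + x))) => //;
  rewrite scale0r add0r.
Qed.

Lemma is_derive_fst x (v : R * R) : is_derive x v fst v.1.
Proof.
apply/is_derive_line.
have -> : (fun h : R => (h *: v + x).1) = (fun h : R => h * v.1 + x.1) by [].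
have := @is_deriveD _ _ _ (fun h : R => h * v.1) (cst x.1) 0 1 v.1 0.
rewrite addr0; apply.
have := @is_deriveM _ _ id (cst v.1) 0 1 1 0.
by rewrite scaler0 add0r [_ *: _]mulr1; apply.
Qed.

Lemma is_derive_snd x (v : R * R) : is_derive x v snd v.2.
Proof.
apply/is_derive_line.
have -> : (fun h : R => (h *: v + x).2) = (fun h : R => h * v.2 + x.2) by [].
have := @is_deriveD _ _ _ (fun h : R => h * v.2) (cst x.2) 0 1 v.2 0.
rewrite addr0; apply.
have := @is_deriveM _ _ id (cst v.2) 0 1 1 0.
by rewrite scaler0 add0r [_ *: _]mulr1; apply.
Qed.

Lemma is_derive_slice1 f (a b df : R) :
  is_derive (a, b) (1 : R, 0 : R) f df ->
  is_derive a (1 : R) (fun t : R => f (t, b)) df.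
Proof.
have E : (fun h : R => h^-1 *: ((f \o shift (a, b)) (h *: (1 : R, 0 : R)) - f (a, b))) =
    (fun h : R => h^-1 *: (((fun t : R => f (t, b)) \o shift a) (h *: (1 : R)) - f (a, b))).
  apply/funext => h /=; congr (_ *: (f _ - _)).
  have -> : (h *: (1 : R, 0 : R) + (a, b) : R * R) = (h * 1 + a, h * 0 + b) by [].
  by rewrite mulr0 add0r.
by move=> [D1 D2]; apply: DeriveDef; [rewrite /derivable -E|rewrite /derive -E].
Qed.

Lemma is_derive_slice2 f (a b df : R) :
  is_derive (a, b) (0 : R, 1 : R) f df ->
  is_derive b (1 : R) (fun t : R => f (a, t)) df.
Proof.
have E : (fun h : R => h^-1 *: ((f \o shift (a, b)) (h *: (0 : R, 1 : R)) - f (a, b))) =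
    (fun h : R => h^-1 *: (((fun t : R => f (a, t)) \o shift b) (h *: (1 : R)) - f (a, b))).
  apply/funext => h /=; congr (_ *: (f _ - _)).
  have -> : (h *: (0 : R, 1 : R) + (a, b) : R * R) = (h * 0 + a, h * 1 + b) by [].
  by rewrite mulr0 add0r.
by move=> [D1 D2]; apply: DeriveDef; [rewrite /derivable -E|rewrite /derive -E].
Qed.

End directional_derivatives.

Section smooth.
Context {R : realType}.
Implicit Types (f g : R * R -> R) (k : nat).
Notation e j := (@basis_vec R j).

(** Strengthening of Ck that records all intermediate continuities, so that
    it is stable by products. *)
Fixpoint Ckc k f : Prop :=
  continuous f /\
  if k is k'.+1 then
    forall j : 'I_2, exists2 df, (forall x, is_derive x (e j) f (df x)) & Ckc k' df
  else True.

Lemma Ckc_continuous k f : Ckc k f -> continuous f.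
Proof. by case: k => [|k] []. Qed.

Lemma CkcW k f : Ckc k.+1 f -> Ckc k f.
Proof.
elim: k f => [|k IH] f; first by case.
case=> cf H; split=> // j; have [df dfE Cdf] := H j.
by exists df => //; exact: IH.
Qed.

Lemma Ckc_Ck k f : Ckc k f -> Ck k f.
Proof.
elim: k f => [|k IH] f; first by case.
case=> cf H /= j; have [df dfE Cdf] := H j; split=> [x|].
  by have [] := dfE x.
by rewrite (_ : 'D_(e j) f = df); [exact: IH|apply/funext => x; have [] := dfE x].
Qed.

Lemma smooth_Ckc f : smooth f -> forall k, Ckc k f.
Proof.
move=> sf k.
suff H : forall k g, (forall i, Ck i g) -> Ckc k g by exact: H.
elim=> [|{}k IH] g sg; first by split; [exact: sg 0%N|].
split; first exact: sg 0%N.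
move=> j; exists ('D_(e j) g); first by move=> x; apply: derivableP; exact: (sg 1%N j).1.
by apply: IH => i; exact: (sg i.+1 j).2.
Qed.

Lemma Ckc_cst k (a : R) : Ckc k (cst a).
Proof.
elim: k a => [|k IH] a; first by split => // x; exact: cvg_cst.
split; first by move=> x; exact: cvg_cst.
by move=> j; exists (cst 0) => // x; exact: is_derive_cst.
Qed.

Lemma CkcD k f g : Ckc k f -> Ckc k g -> Ckc k (fun x => f x + g x).
Proof.
elim: k f g => [|k IH] f g [cf Hf] [cg Hg].
  by split => // x; apply: cvgD; [exact: cf|exact: cg].
split; first by move=> x; apply: cvgD; [exact: cf|exact: cg].
move=> j; have [df fE Cf] := Hf j; have [dg gE Cg] := Hg j.
exists (fun x => df x + dg x); last exact: IH.
by move=> x; exact: is_deriveD.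
Qed.

Lemma CkcM k f g : Ckc k f -> Ckc k g -> Ckc k (fun x => f x * g x).
Proof.
elim: k f g => [|k IH] f g Cf Cg.
  have [cf _] := Cf; have [cg _] := Cg.
  by split => // x; apply: cvgM; [exact: cf|exact: cg].
have [cf Hf] := Cf; have [cg Hg] := Cg.
split; first by move=> x; apply: cvgM; [exact: cf|exact: cg].
move=> j; have [df fE Cdf] := Hf j; have [dg gE Cdg] := Hg j.
exists (fun x => f x * dg x + g x * df x); first by move=> x; exact: is_deriveM.
by apply: CkcD; apply: IH => //; exact: CkcW.
Qed.

(** The functions F i are the successive derivatives of F 0. *)
Lemma Ckc_chain k f (F : nat -> R -> R) :
  (forall i x, is_derive (f x) 1 (F i) (F i.+1 (f x))) ->
  Ckc k f -> Ckc k (F 0%N \o f).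
Proof.
elim: k F => [|k IH] F FE Cf.
  split=> // x; apply: continuous_comp; first exact: Ckc_continuous Cf x.
  apply: differentiable_continuous; apply/derivable1_diffP.
  by have [] := FE 0%N x.
split.
  move=> x; apply: continuous_comp; first exact: Ckc_continuous Cf x.
  apply: differentiable_continuous; apply/derivable1_diffP.
  by have [] := FE 0%N x.
move=> j; have [_ Hf] := Cf; have [df fE Cdf] := Hf j.
exists (fun x => F 1%N (f x) * df x); first by move=> x; exact: is_derive_chain.
apply: CkcM => //; apply: (IH (fun i => F i.+1)) => //; exact: CkcW.
Qed.

Lemma Ckc_lin k (F : R * R -> R) : continuous F ->
  (forall j, exists a : R, forall x, is_derive x (e j) F a) -> Ckc k F.
Proof.
case: k => [|k] cF H; split=> // j; have [a aE] := H j.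
by exists (cst a) => //; exact: Ckc_cst.
Qed.

Lemma Ckc_fst k : Ckc k fst.
Proof.
apply: Ckc_lin; first by move=> x; exact: cvg_fst.
by move=> j; exists (e j).1 => x; exact: is_derive_fst.
Qed.

Lemma Ckc_snd k : Ckc k snd.
Proof.
apply: Ckc_lin; first by move=> x; exact: cvg_snd.
by move=> j; exists (e j).2 => x; exact: is_derive_snd.
Qed.

End smooth.

Section plane_measurability.
Context {R : realType}.

(** Open sets are countable unions of boxes with rational data, hence measurable
    for the product sigma-algebra. *)
Lemma continuous_measurable2 (f : R * R -> R) :
  continuous f -> measurable_fun setT f.
Proof.
move=> cf; apply: (measurability _ (RGenOInfty.measurableE R)).
move=> _ [_ [a ->] <-]; rewrite setTI.
set O := f @^-1` _.
have oO : open O by apply: open_comp; [by move=> x _; exact: cf|exact: interval_open].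
pose box (t : rat * rat * nat) : set (R * R) :=
  `]ratr t.1.1 - t.2.+1%:R^-1, ratr t.1.1 + t.2.+1%:R^-1[ `*`
  `]ratr t.1.2 - t.2.+1%:R^-1, ratr t.1.2 + t.2.+1%:R^-1[.
pose G (t : rat * rat * nat) := if `[< box t `<=` O >] then box t else set0.
have -> : O = \bigcup_t G t.
  apply/seteqP; split=> [x Ox|x [t _]]; last first.
    by rewrite /G; case: asboolP => // + bx; apply.
  have /nbhs_ballP[r /= r0 rO] : nbhs x O by move: oO; rewrite openE; exact.
  have [n nr] : exists n : nat, n.+1%:R^-1 < r / 2.
    exists (Num.truncn (r / 2)^-1); rewrite -ltf_pV2 ?posrE ?invr_gt0 ?divr_gt0//.
    by rewrite invrK truncnS_gt.
  set d := n.+1%:R^-1 in nr; have d0 : 0 < d by rewrite invr_gt0 ltr0n.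
  have [p] := @rat_in_itvoo R (x.1 - d) (x.1 + d) ltac:(lra).
  rewrite in_itv/= => /andP[p1 p2].
  have [p'] := @rat_in_itvoo R (x.2 - d) (x.2 + d) ltac:(lra).
  rewrite in_itv/= => /andP[p1' p2'].
  have bO : box (p, p', n) `<=` O.
    move=> y [/=]; rewrite !in_itv/= -/d => /andP[y1 y2] /andP[y1' y2'].
    apply: rO; split; rewrite /ball /= ltr_norml ltrBrDr ltrBlDr; apply/andP; split; lra.
  exists (p, p', n) => //; rewrite /G asboolT//.
  by split; rewrite /= in_itv/= -/d; apply/andP; split; lra.
apply: countable_bigcupT_measurable; first exact: countableP.
move=> t; rewrite /G.
by case: asboolP => // _; apply: measurableX; exact: measurable_itv.
Qed.

End plane_measurability.

(** * The divergence theorem on a disc *)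

Section line_integrals.
Context {R : realType}.
Notation mu := (@lebesgue_measure R).
Implicit Types (f g G K : R -> R).

Lemma continuous_intg_itv f (a b : R) : continuous f ->
  mu.-integrable `[a, b] (EFin \o f).
Proof.
move=> cf; apply: continuous_compact_integrable; first exact: segment_compact.
exact: continuous_subspaceT.
Qed.

Lemma is_derive_continuous f df : (forall x, is_derive x (1 : R) f (df x)) ->
  continuous f.
Proof.
move=> fd x; apply: differentiable_continuous; apply/derivable1_diffP.
by have [] := fd x.
Qed.

Lemma Rint_split f (a m b : R) : continuous f -> a <= m -> m <= b ->
  \int[mu]_(t in `[a, b]) f t =
  \int[mu]_(t in `[a, m]) f t + \int[mu]_(t in `[m, b]) f t.
Proof.
move=> cf am mb.
have fab := continuous_intg_itv a b cf.
apply/eqP; rewrite addrC -subr_eq; apply/eqP.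
rewrite (@Rintegral_itvB _ f (BLeft a) (BRight b) m)//.
rewrite Rintegral_itv_obnd_cbnd//.
apply: integrableS fab => //; apply: subset_itvr; rewrite bnd_simp//.
Qed.

Lemma FTC2 f F (a b : R) : a <= b -> continuous f ->
  (forall x, a <= x <= b -> is_derive x 1 F (f x)) ->
  \int[mu]_(t in `[a, b]) f t = F b - F a.
Proof.
move=> + cf Fd; rewrite le_eqVlt => /predU1P[<-|ab].
  by rewrite set_itv1 Rintegral_set1 subrr.
have cF x : a <= x <= b -> {for x, continuous F}.
  move=> xab; apply: differentiable_continuous; apply/derivable1_diffP.
  by have [] := Fd x xab.
rewrite /Rintegral (@continuous_FTC2 _ f F a b ab).
- by rewrite -EFinB.
- exact: continuous_subspaceT.
- split.
  + move=> x; rewrite in_itv/= => /andP[ax xb].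
    by have [] := Fd x; rewrite ?(ltW ax) ?(ltW xb).
  + by apply: cvg_at_right_filter; apply: cF; rewrite lexx (ltW ab).
  + by apply: cvg_at_left_filter; apply: cF; rewrite lexx (ltW ab).
- move=> x; rewrite in_itv/= => /andP[ax xb]; rewrite derive1E.
  by have [] := Fd x; rewrite ?(ltW ax) ?(ltW xb).
Qed.

Lemma antiderivative f (a : R) : continuous f ->
  exists F, forall x, a < x -> is_derive x 1 F (f x).
Proof.
move=> cf; exists (fun x => \int[mu]_(t in `[a, x]) f t) => x ax.
have xx1 : x < x + 1 by rewrite ltrDl.
have [D1 D2] := continuous_FTC1_closed xx1 (continuous_intg_itv _ _ cf) ax (cf x).
by apply: DeriveDef; [exact: D1|rewrite -derive1E; exact: D2].
Qed.

End line_integrals.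

Section arcs.
Context {R : realType}.

Lemma continuous_comp2 {T : topologicalType} (H : R * R -> R) (f g : T -> R) :
  continuous H -> continuous f -> continuous g ->
  continuous (fun u => H (f u, g u)).
Proof.
move=> cH cf cg u.
apply: (@continuous2_cvg _ _ _ _ _ _ f g (fun a b => H (a, b)) (f u) (g u)).
- by rewrite (_ : (fun z => _) = H); [exact: cH|apply/funext => -[]].
- exact: cf.
- exact: cg.
Qed.

Notation mu := (@lebesgue_measure R).
Implicit Types (H : R -> R -> R).

Definition half_chord (a r u : R) : R := Num.sqrt (r ^+ 2 - (u - a) ^+ 2).

Lemma half_chord_continuous a r : continuous (half_chord a r).
Proof.
move=> u; apply: (@continuous_comp _ _ _ (fun u => r ^+ 2 - (u - a) ^+ 2) Num.sqrt);
  last exact: sqrt_continuous.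
apply: cvgB; first exact: cvg_cst.
by apply: cvgM; apply: cvgB; (exact: cvg_id || exact: cvg_cst).
Qed.

Let pi0 : 0 <= pi :> R := ltW (pi_gt0 R).

(** Substitution along an arc on which the transversal coordinate keeps its
    sign, so that g is the pull-back of a single boundary value G. *)
Lemma arc_integral (G K phi dphi g : R -> R) (a0 alpha beta : R) :
  alpha <= beta -> continuous g ->
  (forall x : R, a0 < x -> is_derive x (1 : R) K (G x)) ->
  (forall t, a0 < phi t) ->
  (forall t : R, is_derive t (1 : R) phi (dphi t)) ->
  (forall t, alpha <= t <= beta -> g t = G (phi t) * dphi t) ->
  \int[mu]_(t in `[alpha, beta]) g t = K (phi beta) - K (phi alpha).
Proof.
move=> ab cg KG ap pd gE; have H t : alpha <= t <= beta ->
    is_derive t (1 : R) (K \o phi) (g t).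
  by move=> tab; rewrite gE//; apply: is_derive1_comp => //; exact: KG.
exact: (FTC2 ab cg H).
Qed.

(** The upper and the lower half of the circle are the graphs of half_chord and
    of its opposite; they are traversed on [0, pi] and [pi, 2 pi]. *)
Lemma circle_projection_sin (H : R * R -> R) (a r : R) : continuous H -> 0 < r ->
  \int[mu]_(u in `[a - r, a + r]) (H (u, half_chord a r u) - H (u, - half_chord a r u))
  = \int[mu]_(t in `[0, 2 * pi]) (H (a + r * cos t, r * sin t) * (r * sin t)).
Proof.
move=> cH r0.
pose G1 u := H (u, half_chord a r u). pose G2 u := H (u, - half_chord a r u).
have cid : continuous (@idfun R) by move=> u; exact: cvg_id.
have cG1 : continuous G1.
  exact: (continuous_comp2 cH cid (@half_chord_continuous a r)).
have cG2 : continuous G2.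
  apply: (continuous_comp2 cH cid) => u; apply: cvgN; exact: half_chord_continuous.
(* a - r - 1 is a base point to the left of the projection of the circle. *)
have [K1 K1E] := antiderivative (a - r - 1) cG1.
have [K2 K2E] := antiderivative (a - r - 1) cG2.
pose g t := H (a + r * cos t, r * sin t) * (r * sin t).
pose phi t := a + r * cos t.
have dphi (t : R) : is_derive t 1 phi (- (r * sin t)).
  have := is_deriveD (is_derive_cst a t 1) (is_deriveZ r (is_derive_cos t)).
  by rewrite add0r scalerN; apply.
have csin : continuous (fun t : R => r * sin t).
  by move=> t; apply: cvgMr; exact: continuous_sin.
have cg : continuous g.
  move=> t; apply: cvgM; last exact: csin.
  exact: (continuous_comp2 cH (is_derive_continuous dphi) csin).
have phi_gt t : a - r - 1 < phi t.
  rewrite /phi; have := cos_geN1 t; nra.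
have rng (u : R) : a - r <= u <= a + r -> a - r - 1 < u by move=> /andP[? _]; lra.
have hc (t : R) : half_chord a r (phi t) = `|r * sin t|.
  rewrite /half_chord /phi -sqrtr_sqr addrAC subrr add0r.
  by congr Num.sqrt; rewrite !exprMn -[X in X - _]mulr1 -(cos2Dsin2 t); ring.
rewrite RintegralB//; last 2 first.
- exact: continuous_intg_itv.
- exact: continuous_intg_itv.
have ar : a - r <= a + r by lra.
rewrite (FTC2 ar cG1 (fun u h => K1E u (rng u h))).
rewrite (FTC2 ar cG2 (fun u h => K2E u (rng u h))).
rewrite (Rint_split cg (m := pi)) ?pi0//; last by have := pi0; lra.
have phi0 : phi 0 = a + r by rewrite /phi cos0 mulr1.
have phipi : phi pi = a - r by rewrite /phi cospi mulrN1.
have phi2pi : phi (2 * pi) = a + r.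
  by rewrite /phi mulr_natl cos2pi mulr1.
have gN : continuous (fun t => - g t) by move=> t; apply: cvgN; exact: cg.
have eN (alpha beta : R) : \int[mu]_(t in `[alpha, beta]) g t =
    - \int[mu]_(t in `[alpha, beta]) (- g t).
  rewrite -[RHS]mulN1r -RintegralZl//; last exact: continuous_intg_itv.
  by under [RHS]eq_Rintegral do rewrite mulN1r opprK.
rewrite eN (@arc_integral G1 K1 phi (fun t => - (r * sin t)) _ (a - r - 1) 0 pi)//; last first.
  move=> t /sin_ge0_pi s0; rewrite /G1 hc ger0_norm /g ?mulr_ge0 ?(ltW r0)//; ring.
rewrite phi0 phipi eN (@arc_integral G2 K2 phi (fun t => - (r * sin t)) _ (a - r - 1) pi (2 * pi))//.
- by rewrite phi2pi phipi; ring.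
- by have := pi0; lra.
- move=> t /andP[t1 t2]; have s0 : sin t <= 0.
    rewrite -(subrK pi t) sinDpi oppr_le0; apply: sin_ge0_pi.
    by apply/andP; split; lra.
  rewrite /G2 hc ler0_norm /g ?opprK ?mulr_ge0_le0 ?(ltW r0)//; ring.
Qed.

(** Here the two graphs meet at pi / 2 and 3 pi / 2, so that one of them is
    traversed in two pieces, at the beginning and at the end of [0, 2 pi]. *)
Lemma circle_projection_cos (H : R * R -> R) (a r : R) : continuous H -> 0 < r ->
  \int[mu]_(u in `[a - r, a + r]) (H (u, half_chord a r u) - H (u, - half_chord a r u))
  = \int[mu]_(t in `[0, 2 * pi]) (H (a + r * sin t, r * cos t) * (r * cos t)).
Proof.
move=> cH r0.
pose G1 u := H (u, half_chord a r u). pose G2 u := H (u, - half_chord a r u).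
have cid : continuous (@idfun R) by move=> u; exact: cvg_id.
have cG1 : continuous G1.
  exact: (continuous_comp2 cH cid (@half_chord_continuous a r)).
have cG2 : continuous G2.
  apply: (continuous_comp2 cH cid) => u; apply: cvgN; exact: half_chord_continuous.
(* a - r - 1 is a base point to the left of the projection of the circle. *)
have [K1 K1E] := antiderivative (a - r - 1) cG1.
have [K2 K2E] := antiderivative (a - r - 1) cG2.
pose g t := H (a + r * sin t, r * cos t) * (r * cos t).
pose phi t := a + r * sin t.
have dphi (t : R) : is_derive t 1 phi (r * cos t).
  have := is_deriveD (is_derive_cst a t 1) (is_deriveZ r (is_derive_sin t)).
  by rewrite add0r; apply.
have ccos : continuous (fun t : R => r * cos t).
  by move=> t; apply: cvgMr; exact: continuous_cos.
have cg : continuous g.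
  move=> t; apply: cvgM; last exact: ccos.
  exact: (continuous_comp2 cH (is_derive_continuous dphi) ccos).
have phi_gt t : a - r - 1 < phi t.
  rewrite /phi; have := sin_geN1 t; nra.
have rng (u : R) : a - r <= u <= a + r -> a - r - 1 < u by move=> /andP[? _]; lra.
have hc (t : R) : half_chord a r (phi t) = `|r * cos t|.
  rewrite /half_chord /phi -sqrtr_sqr addrAC subrr add0r.
  by congr Num.sqrt; rewrite !exprMn -[X in X - _]mulr1 -(cos2Dsin2 t); ring.
rewrite RintegralB//; last 2 first.
- exact: continuous_intg_itv.
- exact: continuous_intg_itv.
have ar : a - r <= a + r by lra.
rewrite (FTC2 ar cG1 (fun u h => K1E u (rng u h))).
rewrite (FTC2 ar cG2 (fun u h => K2E u (rng u h))).
have hp0 := pi0.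
rewrite (Rint_split cg (m := pi / 2)); [|lra|lra].
rewrite (Rint_split cg (m := pi + pi / 2) (a := pi / 2)); [|lra|lra].
have phi0 : phi 0 = a by rewrite /phi sin0 mulr0 addr0.
have phi1 : phi (pi / 2) = a + r by rewrite /phi sin_pihalf mulr1.
have phi3 : phi (pi + pi / 2) = a - r.
  by rewrite /phi (addrC pi) sinDpi sin_pihalf mulrN1.
have phi4 : phi (2 * pi) = a.
  by rewrite /phi mulr_natl sin2pi mulr0 addr0.
have arc1 := @arc_integral G1 K1 phi (fun t => r * cos t) g (a - r - 1).
have arc2 := @arc_integral G2 K2 phi (fun t => r * cos t) g (a - r - 1).
rewrite arc1//; [|lra|]; last first.
  move=> t /andP[t1 t2]; rewrite /G1 hc ger0_norm // mulr_ge0 ?(ltW r0)// cos_ge0_pihalf//.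
  by apply/andP; split; lra.
rewrite arc2//; [|lra|]; last first.
  move=> t /andP[t1 t2]; have s0 : cos t <= 0.
    rewrite -(subrK pi t) cosDpi oppr_le0; apply: cos_ge0_pihalf.
    by apply/andP; split; lra.
  by rewrite /G2 hc ler0_norm ?opprK ?mulr_ge0_le0 ?(ltW r0).
rewrite arc1//; [|lra|]; last first.
  move=> t /andP[t1 t2]; have s0 : 0 <= cos t.
    have -> : t = t - pi *+ 2 + pi *+ 2 by rewrite subrK.
    rewrite cosD2pi; apply: cos_ge0_pihalf; rewrite -mulr_natl.
    by apply/andP; split; lra.
  by rewrite /G1 hc ger0_norm // mulr_ge0 ?(ltW r0).
by rewrite phi0 phi1 phi3 phi4; ring.
Qed.

End arcs.

Section disc.
Context {R : realType}.
Notation mu := (@lebesgue_measure R).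
Notation mu2 := (lebesgue2 R).
Notation e j := (@basis_vec R j).
Implicit Types (c : R * R) (r : R).

Definition disc c r : set (R * R) :=
  [set x | (x.1 - c.1) ^+ 2 + (x.2 - c.2) ^+ 2 <= r ^+ 2].

Lemma measurable_sqdist c :
  measurable_fun setT (fun x : R * R => (x.1 - c.1) ^+ 2 + (x.2 - c.2) ^+ 2).
Proof.
by apply: measurable_funD; apply: measurable_funX; apply: measurable_funB => //;
  (exact: measurable_fst || exact: measurable_snd).
Qed.

Lemma measurable_disc c r : measurable (disc c r).
Proof. by apply: measurable_sublevel; exact: measurable_sqdist. Qed.

Lemma disc_box c r : 0 < r ->
  disc c r `<=` `[c.1 - r, c.1 + r] `*` `[c.2 - r, c.2 + r].
Proof.
move=> r0 x /= H; rewrite !in_itv/=.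
have [h1 h2] : `|x.1 - c.1| <= r /\ `|x.2 - c.2| <= r.
  by split; rewrite -(ler_pXn2r (n := 2))// ?nnegrE ?(ltW r0)//
    real_normK ?num_real// (le_trans _ H)// ?lerDl ?lerDr sqr_ge0.
by move: h1 h2; rewrite !ler_norml => /andP[? ?] /andP[? ?];
  split; apply/andP; split; lra.
Qed.

Lemma continuous_intg_disc (f : R * R -> R) c r : 0 < r -> continuous f ->
  intg mu2 (fun x => f x * \1_(disc c r) x).
Proof.
move=> r0 cf.
pose B := `[c.1 - r, c.1 + r]%classic `*` `[c.2 - r, c.2 + r]%classic : set (R * R).
have cB : compact B by apply: compact_setX; exact: segment_compact.
have [M Mf] : exists M : R, forall x, B x -> `|f x| <= M.
  have /compact_bounded[M [_ MH]] : compact (f @` B).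
    by apply: continuous_compact => //; exact: continuous_subspaceT.
  by exists (M + 1) => x Bx; apply: (MH (M + 1)); [rewrite ltrDl|exists x].
have mB : measurable B by apply: measurableX; exact: measurable_itv.
have muB : (mu2 B < +oo)%E.
  have l (a b : R) : (mu `[a, b]%classic < +oo)%E.
    by rewrite lebesgue_measure_itv/= lte_fin; case: ifP => _; rewrite -?EFinB ltry.
  rewrite product_measure1E ?measurable_itv//; apply: lte_mul_pinfty => //.
  by rewrite ge0_fin_numE//; exact: l.
  exact: l.
have iB : intg mu2 (fun x => M * \1_B x).
  apply: intgZl; apply/integrableP; split; first exact/measurable_EFinP.
  have E : (fun x => `|(EFin \o (\1_B : R * R -> R)) x|%E) = (fun x => (\1_B x)%:E).
    by apply/funext => x; rewrite /= ger0_norm// indicE.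
  by rewrite E integral_indic// setIT.
apply: le_intg iB => [|x].
  apply: measurable_funM; first exact: continuous_measurable2.
  by apply: measurable_indic; exact: measurable_disc.
rewrite !indicE; case: (boolP (x \in disc c r)) => [/set_mem xd|_]; last first.
  by rewrite mulr0 normr0.
have Bx := disc_box r0 xd.
by rewrite mem_set// !mulr1 (le_trans (Mf _ Bx))// ler_norm.
Qed.

Lemma Rfubini1 (f : R * R -> R) : intg mu2 f ->
  (forall a, intg mu (fun y => f (a, y))) ->
  \int[mu2]_x f x = \int[mu]_a \int[mu]_y f (a, y).
Proof.
move=> fi fs; rewrite /Rintegral -integral12_prod_meas1//; congr fine.
by apply: eq_integral => a _; rewrite /fubini_F fineK //; apply: integrable_fin_num; [exact: measurableT|exact: fs].
Qed.

Lemma Rfubini2 (f : R * R -> R) : intg mu2 f ->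
  (forall b, intg mu (fun x => f (x, b))) ->
  \int[mu2]_x f x = \int[mu]_b \int[mu]_x f (x, b).
Proof.
move=> fi fs; rewrite /Rintegral -integral21_prod_meas1//; congr fine.
by apply: eq_integral => a _; rewrite /fubini_G fineK //; apply: integrable_fin_num; [exact: measurableT|exact: fs].
Qed.

Lemma intg_itv_indic (f : R -> R) (a b : R) : continuous f ->
  intg mu (fun x => f x * \1_(`[a, b]%classic) x) /\
  \int[mu]_x (f x * \1_(`[a, b]%classic) x) = \int[mu]_(x in `[a, b]) f x.
Proof.
move=> cf.
have E : (fun x => f x * \1_(`[a, b]%classic) x) = f \_ `[a, b]%classic.
  apply/funext => x; rewrite patchE indicE.
  by case: (_ \in _); rewrite ?mulr1 ?mulr0.
split; last by rewrite [RHS]Rintegral_mkcond E.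
rewrite E -restrict_EFin; apply/integrable_restrict => //.
by rewrite setTI; exact: continuous_intg_itv.
Qed.

Lemma disc_slice (a0 b0 r u v : R) : 0 < r ->
  ((u - a0) ^+ 2 + (v - b0) ^+ 2 <= r ^+ 2) =
  (u \in `[a0 - r, a0 + r]) &&
  (v \in `[b0 - half_chord a0 r u, b0 + half_chord a0 r u]).
Proof.
move=> r0; rewrite !in_itv/=.
have uE : (a0 - r <= u <= a0 + r) = ((u - a0) ^+ 2 <= r ^+ 2).
  rewrite -(real_normK (num_real (u - a0))) ler_pXn2r ?nnegrE ?(ltW r0)// ler_distl.
  by [].
have hE := real_normK (num_real (v - b0)).
have -> : (b0 - half_chord a0 r u <= v <= b0 + half_chord a0 r u) =
    (`|v - b0| <= half_chord a0 r u) by rewrite ler_distl.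
rewrite uE; have [ua|ua] := leP ((u - a0) ^+ 2) (r ^+ 2) => /=; last first.
  by apply/negP; apply/negP; rewrite -ltNge; have := sqr_ge0 (v - b0); lra.
rewrite -[RHS](ler_pXn2r (n := 2)) ?nnegrE ?sqrtr_ge0//.
by rewrite hE sqr_sqrtr ?subr_ge0// lerBrDl.
Qed.

(** Integration along the chords parallel to the direction of differentiation
    leaves the difference of W at their two ends. *)
Lemma disc_divergence2 (W dW : R * R -> R) c r : 0 < r ->
  continuous W -> continuous dW ->
  (forall x : R * R, is_derive x (0 : R, 1 : R) W (dW x)) ->
  \int[mu2]_x (dW x * \1_(disc c r) x) =
  \int[mu]_(t in `[0, 2 * pi]) (W (circle_param c r t) * (r * sin t)).
Proof.
move=> r0 cW cdW dWE.
rewrite -(@circle_projection_sin _ (fun z => W (z.1, c.2 + z.2)) c.1 r)//; last first.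
  apply: (@continuous_comp2 _ _ _ fst (fun z => c.2 + z.2)) => // z; first exact: cvg_fst.
  by apply: cvgD; [exact: cvg_cst|exact: cvg_snd].
have E (a y : R) : dW (a, y) * \1_(disc c r) (a, y) =
    \1_(`[c.1 - r, c.1 + r]%classic) a * (dW (a, y) *
    \1_(`[c.2 - half_chord c.1 r a, c.2 + half_chord c.1 r a]%classic) y).
  have D : ((a, y) \in disc c r) = (a \in `[c.1 - r, c.1 + r]) &&
      (y \in `[c.2 - half_chord c.1 r a, c.2 + half_chord c.1 r a]).
    by rewrite -disc_slice//; apply/idP/idP => [/set_mem//|H]; exact: mem_set.
  by rewrite !indicE D !mem_setE -mulnb natrM; ring.
have cs a : continuous (fun y => dW (a, y)).
  apply: (@continuous_comp2 _ _ _ (cst a) idfun) => // u; [exact: cvg_cst|exact: cvg_id].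
rewrite Rfubini1; last 2 first.
- exact: continuous_intg_disc.
- move=> a; under eq_fun do rewrite E; apply: intgZl.
  exact: (intg_itv_indic _ _ (cs a)).1.
rewrite [RHS]Rintegral_mkcond; apply: eq_Rintegral => a _.
under eq_Rintegral do rewrite E.
rewrite RintegralZl//; last exact: (intg_itv_indic _ _ (cs a)).1.
rewrite (intg_itv_indic _ _ (cs a)).2 patchE indicE.
case: (_ \in _); rewrite ?mul0r// mul1r.
apply: (@FTC2 _ _ (fun y => W (a, y))) => //.
  by have := sqrtr_ge0 (r ^+ 2 - (a - c.1) ^+ 2); rewrite -/(half_chord _ _ _); lra.
by move=> y _; apply: is_derive_slice2.
Qed.

Lemma disc_divergence1 (W dW : R * R -> R) c r : 0 < r ->
  continuous W -> continuous dW ->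
  (forall x : R * R, is_derive x (1 : R, 0 : R) W (dW x)) ->
  \int[mu2]_x (dW x * \1_(disc c r) x) =
  \int[mu]_(t in `[0, 2 * pi]) (W (circle_param c r t) * (r * cos t)).
Proof.
move=> r0 cW cdW dWE.
rewrite -(@circle_projection_cos _ (fun z => W (c.1 + z.2, z.1)) c.2 r)//; last first.
  apply: (@continuous_comp2 _ _ _ (fun z => c.1 + z.2) fst) => // z; last exact: cvg_fst.
  by apply: cvgD; [exact: cvg_cst|exact: cvg_snd].
have E (b x : R) : dW (x, b) * \1_(disc c r) (x, b) =
    \1_(`[c.2 - r, c.2 + r]%classic) b * (dW (x, b) *
    \1_(`[c.1 - half_chord c.2 r b, c.1 + half_chord c.2 r b]%classic) x).
  have D : ((x, b) \in disc c r) = (b \in `[c.2 - r, c.2 + r]) &&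
      (x \in `[c.1 - half_chord c.2 r b, c.1 + half_chord c.2 r b]).
    rewrite -disc_slice// addrC.
    by apply/idP/idP => [/set_mem//|H]; exact: mem_set.
  by rewrite !indicE D !mem_setE -mulnb natrM; ring.
have cs b : continuous (fun x => dW (x, b)).
  by apply: (@continuous_comp2 _ _ _ idfun (cst b)) => // u; [exact: cvg_id|exact: cvg_cst].
rewrite Rfubini2; last 2 first.
- exact: continuous_intg_disc.
- move=> b; under eq_fun do rewrite E; apply: intgZl.
  exact: (intg_itv_indic _ _ (cs b)).1.
rewrite [RHS]Rintegral_mkcond; apply: eq_Rintegral => b _.
under eq_Rintegral do rewrite E.
rewrite RintegralZl//; last exact: (intg_itv_indic _ _ (cs b)).1.
rewrite (intg_itv_indic _ _ (cs b)).2 patchE indicE.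
case: (_ \in _); rewrite ?mul0r// mul1r.
apply: (@FTC2 _ _ (fun x => W (x, b))) => //.
  by have := sqrtr_ge0 (r ^+ 2 - (b - c.2) ^+ 2); rewrite -/(half_chord _ _ _); lra.
by move=> x _; apply: is_derive_slice1.
Qed.

Definition normal_dir (j : 'I_2) (t : R) : R := if j == ord0 then cos t else sin t.

Lemma disc_divergence (j : 'I_2) (W dW : R * R -> R) c r : 0 < r ->
  continuous W -> continuous dW ->
  (forall x : R * R, is_derive x (e j) W (dW x)) ->
  \int[mu2]_x (dW x * \1_(disc c r) x) =
  \int[mu]_(t in `[0, 2 * pi]) (W (circle_param c r t) * (r * normal_dir j t)).
Proof.
move=> r0 cW cdW; rewrite /basis_vec /normal_dir; case: ifP => _ dWE.
  exact: disc_divergence1.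
exact: disc_divergence2.
Qed.

End disc.

(** * Complex square-integrable functions *)

Local Open Scope complex_scope.

Notation Rep := complex.Re.
Notation Imp := complex.Im.

Section complex_algebra.
Context {R : realType}.
Implicit Types (x y z : R[i]) (a : R).

Lemma complex_ext x y : Rep x = Rep y -> Imp x = Imp y -> x = y.
Proof. by case: x => a b; case: y => c d /= -> ->. Qed.

Lemma ReD x y : Rep (x + y) = Rep x + Rep y.
Proof. by case: x => a b; case: y. Qed.
Lemma ImD x y : Imp (x + y) = Imp x + Imp y.
Proof. by case: x => a b; case: y. Qed.
Lemma ReN x : Rep (- x) = - Rep x. Proof. by case: x. Qed.
Lemma ImN x : Imp (- x) = - Imp x. Proof. by case: x. Qed.
Lemma ReM x y : Rep (x * y) = Rep x * Rep y - Imp x * Imp y.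
Proof. by case: x => a b; case: y. Qed.
Lemma ImM x y : Imp (x * y) = Rep x * Imp y + Imp x * Rep y.
Proof. by case: x => a b; case: y. Qed.
Lemma ReJ x : Rep (x^*%C) = Rep x. Proof. by case: x. Qed.
Lemma ImJ x : Imp (x^*%C) = - Imp x. Proof. by case: x. Qed.
Lemma Rec a : Rep a%:C = a. Proof. by []. Qed.
Lemma Imc a : Imp a%:C = 0. Proof. by []. Qed.
Lemma Rei : Rep ('i%C : R[i]) = 0. Proof. by []. Qed.
Lemma Imi : Imp ('i%C : R[i]) = 1. Proof. by []. Qed.

Definition reim := (ReD, ImD, ReN, ImN, ReM, ImM, ReJ, ImJ, Rec, Imc, Rei, Imi).

Lemma abs2E x : (abs2 x)%:C = x * x^*%C.
Proof. by apply: complex_ext; rewrite !reim /abs2; ring. Qed.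

Lemma conjcMr a x : (a%:C * x)^*%C = a%:C * x^*%C.
Proof. by case: x => x1 x2; apply: complex_ext => /=; ring. Qed.

Lemma Re_cM a x : Rep (a%:C * x) = a * Rep x.
Proof. by case: x => x1 x2 /=; ring. Qed.

Lemma Im_cM a x : Imp (a%:C * x) = a * Imp x.
Proof. by case: x => x1 x2 /=; ring. Qed.

Lemma realcM a (a' : R) : (a * a')%:C = a%:C * a'%:C.
Proof. by apply: complex_ext => /=; ring. Qed.

Lemma realcX a n : (a ^+ n)%:C = a%:C ^+ n.
Proof. by elim: n => [//|n IH]; rewrite !exprS realcM IH. Qed.

Lemma abs2_ge0 x : 0 <= abs2 x.
Proof. by rewrite addr_ge0// sqr_ge0. Qed.

Lemma abs2M x y : abs2 (x * y) = abs2 x * abs2 y.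
Proof. by rewrite /abs2 !reim; ring. Qed.

Lemma abs2J x : abs2 (x^*%C) = abs2 x.
Proof. by rewrite /abs2 !reim; ring. Qed.

Lemma abs2N x : abs2 (- x) = abs2 x.
Proof. by rewrite /abs2 !reim; ring. Qed.

Lemma abs2c a : abs2 a%:C = a ^+ 2.
Proof. by rewrite /abs2 !reim; ring. Qed.

Lemma abs2X x n : abs2 (x ^+ n) = abs2 x ^+ n.
Proof.
elim: n => [|n IH]; first by rewrite !expr0 /abs2 /=; ring.
by rewrite !exprS abs2M IH.
Qed.

Lemma abs2D x y : abs2 (x + y) <= 2 * abs2 x + 2 * abs2 y.
Proof.
rewrite /abs2 !reim -subr_ge0.
rewrite (_ : _ - _ = (Rep x - Rep y) ^+ 2 + (Imp x - Imp y) ^+ 2); last by ring.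
by rewrite addr_ge0// sqr_ge0.
Qed.

(** Young's inequality with a parameter, which replaces the Cauchy-Schwarz
    inequality in all limits of inner products. *)
Lemma Re_mulJ_le (t : R) x y : 0 < t ->
  `|Rep (x * y^*%C)| <= t * abs2 x + t^-1 * abs2 y.
Proof.
move=> t0; rewrite !reim /abs2.
have q (u v : R) : 2 * `|u * v| <= t * u ^+ 2 + t^-1 * v ^+ 2.
  have H (s : R) : s ^+ 2 = 1 -> 2 * s * (u * v) <= t * u ^+ 2 + t^-1 * v ^+ 2.
    move=> s1; rewrite -subr_ge0.
    have -> : t * u ^+ 2 + t^-1 * v ^+ 2 - 2 * s * (u * v) = t^-1 * (t * u - s * v) ^+ 2.
      have tt : t != 0 by rewrite gt_eqF.
      by rewrite sqrrB !exprMn s1; field.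
    by rewrite mulr_ge0 ?sqr_ge0// invr_ge0 ltW.
  have := H 1 (expr1n _ _); have := H (-1) (etrans (sqrrN 1) (expr1n _ _)).
  rewrite mulr1 mulrN1 => h1 h2.
  by have [_|_] := ger0P (u * v); rewrite ?mulrN -?mulNr.
apply: (le_trans (ler_normB _ _)).
have := q (Rep x) (Rep y); have := q (Imp x) (Imp y).
have := normr_ge0 (Imp x * Imp y); have := normr_ge0 (Rep x * Rep y).
have -> : Imp x * - Imp y = - (Imp x * Imp y) by ring.
rewrite ?normrN; lra.
Qed.

Lemma Im_mulJ_le (t : R) x y : 0 < t ->
  `|Imp (x * y^*%C)| <= t * abs2 x + t^-1 * abs2 y.
Proof.
move=> t0; have := @Re_mulJ_le t x ('i%C * y) t0.
rewrite abs2M (_ : abs2 'i%C = 1) ?mul1r; last by rewrite /abs2 /=; ring.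
have -> : Rep (x * ('i%C * y)^*%C) = Imp (x * y^*%C).
  by case: x => a b; case: y => a' b' /=; ring.
by [].
Qed.

End complex_algebra.

Section complex_integrals.
Context {d : measure_display} {T : measurableType d} {R : realType}.
Variables (mu : {measure set T -> \bar R}) (D : set T).
Hypothesis mD : measurable D.
Implicit Types (f g : T -> R[i]).

Definition cintegrable f :=
  mu.-integrable D (EFin \o (fun x => Rep (f x))) /\
  mu.-integrable D (EFin \o (fun x => Imp (f x))).

Lemma cintegrableZ (k : R[i]) f : cintegrable f -> cintegrable (fun x => k * f x).
Proof.
move=> [f1 f2]; split.
  have := integrableB mD (integrableZl mD (Rep k) f1) (integrableZl mD (Imp k) f2).
  by apply: eq_integrable => // x _ /=; rewrite ReM EFinB !EFinM.
have := integrableD mD (integrableZl mD (Rep k) f2) (integrableZl mD (Imp k) f1).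
by apply: eq_integrable => // x _ /=; rewrite ImM EFinD !EFinM.
Qed.

Lemma cintegralD f g : cintegrable f -> cintegrable g ->
  cintegral mu D (fun x => f x + g x) = cintegral mu D f + cintegral mu D g.
Proof.
move=> [f1 f2] [g1 g2]; apply: complex_ext; rewrite !reim /=.
  by rewrite -RintegralD//; apply: eq_Rintegral => x _; rewrite ReD.
by rewrite -RintegralD//; apply: eq_Rintegral => x _; rewrite ImD.
Qed.

Lemma cintegralZ (k : R[i]) f : cintegrable f ->
  cintegral mu D (fun x => k * f x) = k * cintegral mu D f.
Proof.
move=> [f1 f2]; apply: complex_ext; rewrite !reim /=.
  rewrite -2?RintegralZl// -RintegralB//; last 2 first.
  - exact: (integrableZl mD (Rep k) f1).
  - exact: (integrableZl mD (Imp k) f2).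
  by apply: eq_Rintegral => x _; rewrite ReM.
rewrite -2?RintegralZl// -RintegralD//; last 2 first.
- exact: (integrableZl mD (Rep k) f2).
- exact: (integrableZl mD (Imp k) f1).
by apply: eq_Rintegral => x _; rewrite ImM.
Qed.

Lemma cintegrableN f : cintegrable f -> cintegrable (fun x => - f x).
Proof.
move=> /(cintegrableZ (-1)); congr cintegrable.
by apply/funext => x; rewrite mulN1r.
Qed.

Lemma cintegralN f : cintegrable f ->
  cintegral mu D (fun x => - f x) = - cintegral mu D f.
Proof.
move=> fi; rewrite -[RHS]mulN1r -cintegralZ//; congr cintegral.
by apply/funext => x; rewrite mulN1r.
Qed.

Lemma cintegralB f g : cintegrable f -> cintegrable g ->
  cintegral mu D (fun x => f x - g x) = cintegral mu D f - cintegral mu D g.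
Proof.
by move=> fi gi; rewrite cintegralD ?cintegralN//; exact: cintegrableN.
Qed.

Lemma cintegralJ f : cintegrable f ->
  cintegral mu D (fun x => (f x)^*%C) = (cintegral mu D f)^*%C.
Proof.
move=> [f1 f2]; apply: complex_ext; rewrite !reim /=.
  by apply: eq_Rintegral => x _; rewrite ReJ.
rewrite -[RHS]mulN1r -RintegralZl//; apply: eq_Rintegral => x _.
by rewrite ImJ mulN1r.
Qed.

Lemma eq_cintegral f g : {in D, f =1 g} -> cintegral mu D f = cintegral mu D g.
Proof.
move=> fg; apply: complex_ext => /=; apply: eq_Rintegral => x xD; by rewrite fg.
Qed.

Lemma cintegral0 : cintegral mu D (fun=> 0 : R[i]) = 0.
Proof. by apply: complex_ext; rewrite /= /Rintegral integral0. Qed.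

End complex_integrals.

Definition ccvg {R : realType} (u : nat -> R[i]) (l : R[i]) : Prop :=
  (Rep (u n) @[n --> \oo] --> Rep l) /\ (Imp (u n) @[n --> \oo] --> Imp l).

Section ccvg.
Context {R : realType}.
Implicit Types (u v : nat -> R[i]).

Lemma ccvg_unique u l l' : ccvg u l -> ccvg u l' -> l = l'.
Proof.
move=> [u1 u2] [v1 v2]; apply: complex_ext; last exact: (cvg_unique _ u2 v2).
exact: (cvg_unique _ u1 v1).
Qed.

Lemma ccvg_cst (l : R[i]) : ccvg (fun=> l) l.
Proof. by split; exact: cvg_cst. Qed.

Lemma ccvgD u v l l' : ccvg u l -> ccvg v l' -> ccvg (fun n => u n + v n) (l + l').
Proof.
move=> [u1 u2] [v1 v2]; split.
  by rewrite ReD; under eq_fun do rewrite ReD; exact: cvgD.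
by rewrite ImD; under eq_fun do rewrite ImD; exact: cvgD.
Qed.

Lemma ccvgZ (k : R[i]) u l : ccvg u l -> ccvg (fun n => k * u n) (k * l).
Proof.
move=> [u1 u2]; split.
  rewrite ReM; under eq_fun do rewrite ReM.
  by apply: cvgB; exact: cvgMr.
rewrite ImM; under eq_fun do rewrite ImM.
by apply: cvgD; exact: cvgMr.
Qed.

Lemma ccvgN u l : ccvg u l -> ccvg (fun n => - u n) (- l).
Proof.
move=> /(ccvgZ (-1)); rewrite mulN1r; congr ccvg.
by apply/funext => n; rewrite mulN1r.
Qed.

Lemma ccvgB u v l l' : ccvg u l -> ccvg v l' -> ccvg (fun n => u n - v n) (l - l').
Proof. by move=> ul /ccvgN; exact: ccvgD. Qed.

Lemma ccvg_sum2 (u : 'I_2 -> nat -> R[i]) (l : 'I_2 -> R[i]) :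
  (forall j, ccvg (u j) (l j)) ->
  ccvg (fun n => \sum_(j < 2) u j n) (\sum_(j < 2) l j).
Proof.
move=> ul; rewrite 2!big_ord_recl big_ord0 addr0.
under eq_fun do rewrite 2!big_ord_recl big_ord0 addr0.
exact: ccvgD.
Qed.

(** The parameter t is fixed first, so that t K is at most half of the given
    tolerance, and n afterwards. *)
Lemma young_cvg0 (a e : nat -> R) (K : R) : 0 <= K ->
  (forall t n, 0 < t -> `|a n| <= t * K + t^-1 * e n) ->
  e n @[n --> \oo] --> 0 -> a n @[n --> \oo] --> 0.
Proof.
move=> K0 H e0; apply/cvgrPdist_le => /= eps eps0.
pose t := eps / 2 / (K + 1).
have t0 : 0 < t by rewrite !divr_gt0// ltr_wpDl.
have /cvgrPdist_le /(_ (t * (eps / 2))) := e0.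
move=> /(_ (mulr_gt0 t0 (divr_gt0 eps0 (ltr0Sn _ _)))).
apply: filterS => n /=; rewrite !sub0r !normrN => en.
apply: (le_trans (H t n t0)).
have h1 : t * K <= eps / 2.
  rewrite /t -mulrA ler_piMr ?divr_ge0 ?(ltW eps0)//.
  by rewrite mulrC ler_pdivrMr ?ltr_wpDl// mul1r lerDl.
have h2 : t^-1 * e n <= eps / 2.
  rewrite mulrC ler_pdivrMr// mulrC.
  by apply: le_trans en; exact: ler_norm.
lra.
Qed.

End ccvg.

Section square_integrable.
Context {d : measure_display} {T : measurableType d} {R : realType}.
Variables (mu : {measure set T -> \bar R}) (D : set T).
Hypothesis mD : measurable D.
Implicit Types (u v : T -> R[i]).
Notation sqintg u := (mu.-integrable D (EFin \o (fun x => abs2 (u x)))).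

Lemma sq_cintegrable u v : cmeasurable D u -> cmeasurable D v ->
  sqintg u -> sqintg v -> cintegrable mu D (fun x => u x * (v x)^*%C).
Proof.
move=> [u1 u2] [v1 v2] iu iv; split; apply: le_integrable (integrableD mD iu iv) => //.
- apply/measurable_EFinP.
  under eq_fun do rewrite ReM ReJ ImJ.
  by apply: measurable_funB; apply: measurable_funM => //; exact: measurableT_comp.
- move=> x _; rewrite /= lee_fin; apply: le_trans (ler_norm _).
  by have := Re_mulJ_le (u x) (v x) ltr01; rewrite invr1 !mul1r.
- apply/measurable_EFinP.
  under eq_fun do rewrite ImM ReJ ImJ.
  by apply: measurable_funD; apply: measurable_funM => //; exact: measurableT_comp.
- move=> x _; rewrite /= lee_fin; apply: le_trans (ler_norm _).
  by have := Im_mulJ_le (u x) (v x) ltr01; rewrite invr1 !mul1r.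
Qed.

(** By Young's inequality, whose parameter tends to zero after n tends to infinity. *)
Lemma pairing_cvg0 (w : nat -> T -> R[i]) v : (forall n, cmeasurable D (w n)) ->
  cmeasurable D v -> (forall n, sqintg (w n)) -> sqintg v ->
  \int[mu]_(x in D) abs2 (w n x) @[n --> \oo] --> 0 ->
  ccvg (fun n => cintegral mu D (fun x => w n x * (v x)^*%C)) 0.
Proof.
move=> mw mv iw iv e0.
have bd (P : R[i] -> R) : (forall x y t, 0 < t -> `|P (x * y^*%C)| <= t * abs2 x + t^-1 * abs2 y) ->
    (forall n, mu.-integrable D (EFin \o (fun x => P (w n x * (v x)^*%C)))) ->
    (\int[mu]_(x in D) P (w n x * (v x)^*%C)) @[n --> \oo] --> 0.
  move=> HP iP; apply: young_cvg0 e0 => [|t n t0].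
    by apply: (@Rintegral_ge0 _ _ _ mu D (fun x => abs2 (v x))) => x _; exact: abs2_ge0.
  apply: (le_trans (le_normr_Rintegral _ (iP n))) => //.
  rewrite -2?RintegralZl// addrC -RintegralD//; last 2 first.
  - exact: (integrableZl mD _ (iw n)).
  - exact: (integrableZl mD _ iv).
  apply: le_Rintegral => //.
  - exact: integrable_norm.
  - exact: (integrableD mD (integrableZl mD _ (iw n)) (integrableZl mD _ iv)).
  - move=> x _ /=; have := HP (w n x) (v x) t^-1.
    by rewrite invr_gt0 invrK; exact.
have ic n := sq_cintegrable (mw n) mv (iw n) iv.
split.
  apply: bd => [x y t|n]; [exact: Re_mulJ_le|exact: (ic n).1].
apply: bd => [x y t|n]; [exact: Im_mulJ_le|exact: (ic n).2].
Qed.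

End square_integrable.

Section almost_everywhere.
Context {d : measure_display} {T : measurableType d} {R : realType}.
Variable mu : {measure set T -> \bar R}.

Lemma ae_mono (P Q : T -> Prop) : (forall x, P x -> Q x) ->
  {ae mu, forall x, P x} -> {ae mu, forall x, Q x}.
Proof. by move=> PQ; apply: filterS. Qed.

Lemma ae_mono2 (P Q S : T -> Prop) : (forall x, P x -> Q x -> S x) ->
  {ae mu, forall x, P x} -> {ae mu, forall x, Q x} -> {ae mu, forall x, S x}.
Proof. by move=> PQ; apply: filterS2. Qed.

End almost_everywhere.

Section L2_space.
Context {R : realType}.
Notation mu2 := (lebesgue2 R).
Notation C := R[i].
Notation cint f := (cintegral mu2 setT f).
Notation cintg f := (cintegrable mu2 setT f).
Implicit Types (u v f g : R * R -> C).

Lemma cmeasurable_abs2 u : cmeasurable setT u ->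
  measurable_fun setT (fun x => abs2 (u x)).
Proof. by move=> [m1 m2]; apply: measurable_funD; exact: measurable_funX. Qed.

Lemma cmeasurableM u v : cmeasurable setT u -> cmeasurable setT v ->
  cmeasurable setT (fun x => u x * v x).
Proof.
move=> [u1 u2] [v1 v2]; split.
  by under eq_fun do rewrite ReM; apply: measurable_funB; exact: measurable_funM.
by under eq_fun do rewrite ImM; apply: measurable_funD; exact: measurable_funM.
Qed.

Lemma cmeasurableD u v : cmeasurable setT u -> cmeasurable setT v ->
  cmeasurable setT (fun x => u x + v x).
Proof.
move=> [u1 u2] [v1 v2]; split.
  by under eq_fun do rewrite ReD; exact: measurable_funD.
by under eq_fun do rewrite ImD; exact: measurable_funD.
Qed.

Lemma cmeasurableJ u : cmeasurable setT u -> cmeasurable setT (fun x => (u x)^*%C).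
Proof.
move=> [u1 u2]; split; first by under eq_fun do rewrite ReJ.
by under eq_fun do rewrite ImJ; exact: measurableT_comp.
Qed.

Lemma cmeasurable_cst (k : C) : cmeasurable setT (fun _ : R * R => k).
Proof. by split; exact: measurable_cst. Qed.

Lemma cmeasurable_real (h : R * R -> R) : measurable_fun setT h ->
  cmeasurable setT (fun x => (h x)%:C).
Proof. by move=> mh; split => //; exact: measurable_cst. Qed.

Lemma L2_abs2_intg u : L2 u -> intg mu2 (fun x => abs2 (u x)).
Proof.
move=> [mu0 ui]; apply/integrableP; split.
  by apply/measurable_EFinP; exact: cmeasurable_abs2.
by under eq_integral do rewrite /= ger0_norm ?abs2_ge0//.
Qed.

Lemma L2_dom u (F : R * R -> R) : cmeasurable setT u -> intg mu2 F ->
  (forall x, abs2 (u x) <= F x) -> L2 u.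
Proof.
move=> mu0 iF uF; split => //.
have /integrableP[_] : intg mu2 (fun x => abs2 (u x)).
  apply: le_intg iF; first exact: cmeasurable_abs2.
  by move=> x; rewrite ger0_norm ?abs2_ge0// (le_trans (uF x))// ler_norm.
by under eq_integral do rewrite /= ger0_norm ?abs2_ge0//.
Qed.

Lemma L2D u v : L2 u -> L2 v -> L2 (fun x => u x + v x).
Proof.
move=> Lu Lv; have iu := L2_abs2_intg Lu; have iv := L2_abs2_intg Lv.
apply: (@L2_dom _ (fun x => 2 * abs2 (u x) + 2 * abs2 (v x))).
- by apply: cmeasurableD; [exact: Lu.1|exact: Lv.1].
- by apply: intgD; exact: intgZl.
- by move=> x; exact: abs2D.
Qed.

Lemma L2Z (k : C) u : L2 u -> L2 (fun x => k * u x).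
Proof.
move=> Lu; apply: (@L2_dom _ (fun x => abs2 k * abs2 (u x))).
- by apply: cmeasurableM; [exact: cmeasurable_cst|exact: Lu.1].
- exact: intgZl (L2_abs2_intg Lu).
- by move=> x; rewrite abs2M.
Qed.

Lemma L2B u v : L2 u -> L2 v -> L2 (fun x => u x - v x).
Proof.
move=> Lu /(L2Z (-1)) /(L2D Lu); congr L2; apply/funext => x.
by rewrite mulN1r.
Qed.

Lemma L2_indic u (A : set (R * R)) : measurable A -> L2 u ->
  L2 (fun x => (\1_A x)%:C * u x).
Proof.
move=> mA Lu; apply: (@L2_dom _ (fun x => abs2 (u x))).
- apply: cmeasurableM; last exact: Lu.1.
  by apply: cmeasurable_real; exact: measurable_indic.
- exact: L2_abs2_intg Lu.
- by move=> x; rewrite abs2M abs2c ler_piMl ?abs2_ge0.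
Qed.

Lemma L2_0 : L2 (fun _ : R * R => 0 : C).
Proof.
apply: (@L2_dom _ (fun=> 0)).
- exact: cmeasurable_cst.
- exact: integrable0.
- by move=> x; rewrite /abs2 /= expr0n addr0.
Qed.

Lemma L2_cintg u v : L2 u -> L2 v -> cintg (fun x => u x * (v x)^*%C).
Proof.
move=> Lu Lv; apply: sq_cintegrable => //; [exact: Lu.1|exact: Lv.1|..];
  exact: L2_abs2_intg.
Qed.

Lemma innerDl u v w : L2 u -> L2 v -> L2 w ->
  L2inner (fun x => u x + v x) w = L2inner u w + L2inner v w.
Proof.
move=> Lu Lv Lw; rewrite /L2inner -cintegralD//; [|exact: L2_cintg..].
by congr cintegral; apply/funext => x; rewrite mulrDl.
Qed.

Lemma innerZl (k : C) u w : L2 u -> L2 w ->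
  L2inner (fun x => k * u x) w = k * L2inner u w.
Proof.
move=> Lu Lw; rewrite /L2inner -cintegralZ//; last exact: L2_cintg.
by congr cintegral; apply/funext => x; rewrite mulrA.
Qed.

Lemma innerJ u w : L2 u -> L2 w -> L2inner w u = (L2inner u w)^*%C.
Proof.
move=> Lu Lw; rewrite /L2inner -cintegralJ//; last exact: L2_cintg.
by congr cintegral; apply/funext => x; rewrite rmorphM /= conjcK mulrC.
Qed.

Lemma innerDr u v w : L2 u -> L2 v -> L2 w ->
  L2inner w (fun x => u x + v x) = L2inner w u + L2inner w v.
Proof.
move=> Lu Lv Lw; rewrite (innerJ (L2D Lu Lv) Lw) innerDl//.
by rewrite (innerJ Lu Lw) (innerJ Lv Lw) -rmorphD.
Qed.

Lemma innerZr (k : C) u w : L2 u -> L2 w ->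
  L2inner w (fun x => k * u x) = k^*%C * L2inner w u.
Proof.
move=> Lu Lw; rewrite (innerJ (L2Z k Lu) Lw) innerZl//.
by rewrite (innerJ Lu Lw) rmorphM.
Qed.

Lemma innerBl u v w : L2 u -> L2 v -> L2 w ->
  L2inner (fun x => u x - v x) w = L2inner u w - L2inner v w.
Proof.
move=> Lu Lv Lw; have := innerDl Lu (L2Z (-1) Lv) Lw.
rewrite innerZl// mulN1r => <-; congr L2inner.
by apply/funext => x; rewrite mulN1r.
Qed.

Lemma innerBr u v w : L2 u -> L2 v -> L2 w ->
  L2inner w (fun x => u x - v x) = L2inner w u - L2inner w v.
Proof.
move=> Lu Lv Lw; rewrite (innerJ (L2B Lu Lv) Lw) innerBl//.
by rewrite (innerJ Lu Lw) (innerJ Lv Lw) -rmorphB.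
Qed.

Lemma inner0l w : L2inner (fun _ : R * R => 0 : C) w = 0.
Proof.
rewrite /L2inner -[RHS](cintegral0 mu2 setT); congr cintegral.
by apply/funext => x; rewrite mul0r.
Qed.

Lemma cintegral_ae f g : cmeasurable setT f -> cmeasurable setT g ->
  {ae mu2, forall x, f x = g x} -> cint f = cint g.
Proof.
move=> [f1 f2] [g1 g2] fg.
apply: complex_ext; rewrite /= /Rintegral; congr fine; apply: ae_eq_integral => //.
- exact/measurable_EFinP.
- exact/measurable_EFinP.
- by apply: ae_mono fg => x /= -> _.
- exact/measurable_EFinP.
- exact/measurable_EFinP.
- by apply: ae_mono fg => x /= -> _.
Qed.

Lemma inner_ae u v w : L2 u -> L2 v -> L2 w ->
  {ae mu2, forall x, u x = v x} -> L2inner u w = L2inner v w.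
Proof.
move=> [mu0 _] [mv _] [mw _] uv; apply: cintegral_ae.
- by apply: cmeasurableM => //; exact: cmeasurableJ.
- by apply: cmeasurableM => //; exact: cmeasurableJ.
- by apply: ae_mono uv => x /= ->.
Qed.

Lemma L2normsqE u : L2 u -> L2normsq u = (\int[mu2]_x abs2 (u x))%:E.
Proof.
move=> /L2_abs2_intg iu; rewrite /Rintegral fineK//.
by apply: integrable_fin_num.
Qed.

Lemma inner_cvg (un : nat -> R * R -> C) u v : (forall n, L2 (un n)) -> L2 u ->
  L2 v -> L2normsq (fun x => un n x - u x) @[n --> \oo] --> 0%E ->
  ccvg (fun n => L2inner (un n) v) (L2inner u v).
Proof.
move=> Lun Lu Lv cv.
have Ld n : L2 (fun x => un n x - u x) by exact: L2B.
pose e n := \int[mu2]_x abs2 (un n x - u x).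
have e0 : e n @[n --> \oo] --> 0.
  apply: (fine_cvg (f := fun n => (e n)%:E)).
  by under eq_fun do rewrite -L2normsqE//.
have E n : L2inner (un n) v = L2inner (fun x => un n x - u x) v + L2inner u v.
  by rewrite innerBl// subrK.
rewrite -[X in ccvg _ X]add0r; under eq_fun do rewrite E.
apply: ccvgD; last exact: ccvg_cst.
apply: pairing_cvg0 => // [n||n|]; [exact: (Ld n).1|exact: Lv.1| |];
  exact: L2_abs2_intg.
Qed.

Lemma inner_dct (fn : nat -> R * R -> C) f v (F : R * R -> R) : L2 v ->
  (forall n, cmeasurable setT (fn n)) ->
  (forall x, ccvg (fun n => fn n x) (f x)) ->
  intg mu2 F -> (forall n x, abs2 (fn n x) <= F x) ->
  ccvg (fun n => L2inner v (fn n)) (L2inner v f).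
Proof.
move=> Lv mfn cf iF fF.
have iG : intg mu2 (fun x => abs2 (v x) + F x).
  by apply: intgD => //; exact: L2_abs2_intg.
have mv n := cmeasurableM Lv.1 (cmeasurableJ (mfn n)).
have cv x : ccvg (fun n => v x * (fn n x)^*%C) (v x * (f x)^*%C).
  apply: ccvgZ; have [c1 c2] := cf x; split.
    by rewrite ReJ; under eq_fun do rewrite ReJ.
  by rewrite ImJ; under eq_fun do rewrite ImJ; exact: cvgN.
split.
  have [|||_] := @dct _ _ _ mu2 (fun n x => Rep (v x * (fn n x)^*%C))
      (fun x => Rep (v x * (f x)^*%C)) _ _ _ iG; last by [].
  - by move=> n; exact: (mv n).1.
  - by move=> x; exact: (cv x).1.
  - move=> n x; have := Re_mulJ_le (v x) (fn n x) ltr01.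
    by rewrite invr1 !mul1r => /le_trans; apply; rewrite lerD2l fF.
have [|||_] := @dct _ _ _ mu2 (fun n x => Imp (v x * (fn n x)^*%C))
    (fun x => Imp (v x * (f x)^*%C)) _ _ _ iG; last by [].
- by move=> n; exact: (mv n).2.
- by move=> x; exact: (cv x).2.
- move=> n x; have := Im_mulJ_le (v x) (fn n x) ltr01.
  by rewrite invr1 !mul1r => /le_trans; apply; rewrite lerD2l fF.
Qed.

End L2_space.

Section gaussian_weights.
Context {R : realType}.
Notation mu := (@lebesgue_measure R).
Notation mu2 := (lebesgue2 R).

Definition sqdist (c x : R * R) : R := (x.1 - c.1) ^+ 2 + (x.2 - c.2) ^+ 2.

Lemma sqdist_ge0 c x : 0 <= sqdist c x.
Proof. by rewrite addr_ge0// sqr_ge0. Qed.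

(** Up to a factor, the density of the normal law of variance 1 / (2 s). *)
Lemma intg_gauss1 (s a : R) : 0 < s -> intg mu (fun t => expR (- (s * (t - a) ^+ 2))).
Proof.
move=> s0; pose sg := Num.sqrt (2 * s)^-1.
have sgp : 0 < (2 * s)^-1 by rewrite invr_gt0 mulr_gt0.
have sg0 : sg != 0 by rewrite gt_eqF// sqrtr_gt0.
have := intgZl (normal_peak sg)^-1 (integrable_normal_pdf a sg).
congr (integrable _ _ _); apply/funext => t /=; congr EFin.
rewrite normal_pdfE// mulKf ?gt_eqF ?normal_peak_gt0// /normal_fun; congr expR.
rewrite /sg sqr_sqrtr ?(ltW sgp)//; field.
by rewrite gt_eqF.
Qed.

Lemma intg_gauss (s : R) (c : R * R) : 0 < s ->
  intg mu2 (fun x => expR (- (s * sqdist c x))).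
Proof.
move=> s0.
have i1 := intg_gauss1 c.1 s0; have i2 := intg_gauss1 c.2 s0.
have mf : measurable_fun setT (fun x : R * R => expR (- (s * sqdist c x))).
  apply: measurableT_comp => //; apply: measurableT_comp => //.
  by apply: measurable_funM => //; exact: measurable_sqdist.
apply/integrable12ltyP; first exact/measurable_EFinP.
pose K := \int[mu]_y expR (- (s * (y - c.2) ^+ 2)).
have inner (a : R) : (\int[mu]_y (`|(EFin \o (fun x => expR (- (s * sqdist c x)))) (a, y)|)%E)%E =
    (K * expR (- (s * (a - c.1) ^+ 2)))%:E.
  transitivity (\int[mu]_y ((expR (- (s * (a - c.1) ^+ 2)))%:E *
      (expR (- (s * (y - c.2) ^+ 2)))%:E))%E.
    apply: eq_integral => y _; rewrite /= ger0_norm ?expR_ge0// -EFinM -expRD.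
    by congr (expR _)%:E; rewrite /sqdist /=; ring.
  rewrite integralZl// EFinM muleC; congr (_ * _)%E.
  by rewrite /K /Rintegral fineK//; apply: integrable_fin_num.
apply: (@le_lt_trans _ _ (\int[mu]_a (K * expR (- (s * (a - c.1) ^+ 2)))%:E)%E).
  rewrite le_eqVlt; apply/orP; left; apply/eqP; apply: eq_integral => a _.
  exact: inner.
by have := integrable_fin_num measurableT (intgZl K i1); rewrite fin_numElt => /andP[].
Qed.

Lemma intg_poly_gauss (s : R) (c : R * R) N : 0 < s ->
  intg mu2 (fun x => sqdist c x ^+ N * expR (- (s * sqdist c x))).
Proof.
move=> s0; have s2 : 0 < s / 2 by rewrite divr_gt0.
apply: le_intg (intgZl (N`!%:R / (s / 2) ^+ N) (intg_gauss c s2)) => [|x].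
  apply: measurable_funM; first by apply: measurable_funX; exact: measurable_sqdist.
  apply: measurableT_comp => //; apply: measurableT_comp => //.
  by apply: measurable_funM => //; exact: measurable_sqdist.
have := sqdist_ge0 c x; move: (sqdist c x) => y y0.
rewrite !ger0_norm ?mulr_ge0 ?expR_ge0 ?exprn_ge0 ?invr_ge0 ?exprn_ge0 ?(ltW s2)//.
rewrite (_ : - (s / 2 * y) = s / 2 * y + - (s * y)); last by field.
rewrite expRD mulrA ler_wpM2r ?expR_ge0//; exact: expr_le_expR.
Qed.

End gaussian_weights.

(** * Magnetic momenta of Gaussian states *)

Section complex_calculus.
Context {R : realType}.
Notation C := R[i].
Notation e j := (@basis_vec R j).
Implicit Types (f g df dg : R * R -> C) (j : 'I_2).

Definition is_cderiv j f df : Prop := forall x,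
  is_derive x (e j) (fun y => Rep (f y)) (Rep (df x)) /\
  is_derive x (e j) (fun y => Imp (f y)) (Imp (df x)).

Lemma cpartialE j f df : is_cderiv j f df -> cpartial j f = df.
Proof.
move=> fd; apply/funext => x; have [[_ d1] [_ d2]] := fd x.
by apply: complex_ext; rewrite /cpartial /= ?d1 ?d2.
Qed.

Lemma is_derive_cast (h : R * R -> R) (x v : R * R) (a b : R) : a = b ->
  is_derive x v h a -> is_derive x v h b.
Proof. by move=> ->. Qed.

Lemma is_derive_ext (h h' : R * R -> R) (x v : R * R) (a a' : R) :
  h =1 h' -> a = a' -> is_derive x v h a -> is_derive x v h' a'.
Proof. by move=> /funext -> ->. Qed.

Lemma is_cderivD j f g df dg : is_cderiv j f df -> is_cderiv j g dg ->
  is_cderiv j (fun x => f x + g x) (fun x => df x + dg x).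
Proof.
move=> fd gd x; have [f1 f2] := fd x; have [g1 g2] := gd x; split.
  by rewrite ReD; under eq_fun do rewrite ReD; exact: is_deriveD.
by rewrite ImD; under eq_fun do rewrite ImD; exact: is_deriveD.
Qed.

Lemma is_cderivM j f g df dg : is_cderiv j f df -> is_cderiv j g dg ->
  is_cderiv j (fun x => f x * g x) (fun x => f x * dg x + g x * df x).
Proof.
move=> fd gd x; have [f1 f2] := fd x; have [g1 g2] := gd x; split.
  under eq_fun do rewrite ReM.
  apply: is_derive_cast (is_deriveB (is_deriveM f1 g1) (is_deriveM f2 g2)).
  by rewrite /GRing.scale /= !reim; ring.
under eq_fun do rewrite ImM.
apply: is_derive_cast (is_deriveD (is_deriveM f1 g2) (is_deriveM f2 g1)).
by rewrite /GRing.scale /= !reim; ring.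
Qed.

Lemma is_cderivJ j f df : is_cderiv j f df ->
  is_cderiv j (fun x => (f x)^*%C) (fun x => (df x)^*%C).
Proof.
move=> fd x; have [f1 f2] := fd x; split.
  by rewrite ReJ; under eq_fun do rewrite ReJ.
by rewrite ImJ; under eq_fun do rewrite ImJ; exact: is_deriveN.
Qed.

Lemma is_cderiv_cst j (k : C) : is_cderiv j (fun=> k) (fun=> 0).
Proof. by move=> x; split; exact: is_derive_cst. Qed.

Lemma is_cderivZ j (k : C) f df : is_cderiv j f df ->
  is_cderiv j (fun x => k * f x) (fun x => k * df x).
Proof.
move=> /(is_cderivM (is_cderiv_cst j k)); congr is_cderiv.
by apply/funext => x; rewrite mulr0 addr0.
Qed.

Lemma is_cderivX j f df n : is_cderiv j f df ->
  is_cderiv j (fun x => f x ^+ n) (fun x => n%:R * f x ^+ n.-1 * df x).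
Proof.
move=> fd; elim: n => [|n IH].
  have := is_cderiv_cst j 1; congr is_cderiv.
  by apply/funext => x; rewrite !mul0r.
have := is_cderivM fd IH; congr is_cderiv; apply/funext => x.
  by rewrite exprS.
rewrite /= -natr1; case: n {IH} => [|n]; first by rewrite expr0; ring.
by rewrite /= exprS; ring.
Qed.

Lemma is_cderiv_real j (h dh : R * R -> R) :
  (forall x, is_derive x (e j) h (dh x)) ->
  is_cderiv j (fun x => (h x)%:C) (fun x => (dh x)%:C).
Proof. by move=> hd x; split; [exact: hd|exact: is_derive_cst]. Qed.

Definition csmooth f := forall k,
  Ckc k (fun x => Rep (f x)) /\ Ckc k (fun x => Imp (f x)).

Lemma Ckc_derive (h : R * R -> R) j : (forall k, Ckc k h) ->
  (forall x, is_derive x (e j) h ('D_(e j) h x)) /\ forall k, Ckc k ('D_(e j) h).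
Proof.
move=> hs; split=> [x|k].
  have [_ /(_ j)[dh dhE _]] := hs 1%N; have [D1 _] := dhE x.
  exact: derivableP.
have [_ /(_ j)[dh dhE Cdh]] := hs k.+1.
by rewrite (_ : 'D_(e j) h = dh)//; apply/funext => x; have [] := dhE x.
Qed.

Lemma csmooth_partial f j : csmooth f ->
  is_cderiv j f (cpartial j f) /\ csmooth (cpartial j f).
Proof.
move=> fs; have [d1 s1] := @Ckc_derive _ j (fun k => (fs k).1).
by have [d2 s2] := @Ckc_derive _ j (fun k => (fs k).2); split.
Qed.

Lemma csmoothD f g : csmooth f -> csmooth g -> csmooth (fun x => f x + g x).
Proof.
move=> fs gs k; have [f1 f2] := fs k; have [g1 g2] := gs k; split.
  by under eq_fun do rewrite ReD; exact: CkcD.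
by under eq_fun do rewrite ImD; exact: CkcD.
Qed.

Lemma CkcN k (h : R * R -> R) : Ckc k h -> Ckc k (fun x => - h x).
Proof.
move=> hk; have := CkcM (Ckc_cst k (-1)) hk; congr Ckc.
by apply/funext => x; rewrite mulN1r.
Qed.

Lemma csmoothM f g : csmooth f -> csmooth g -> csmooth (fun x => f x * g x).
Proof.
move=> fs gs k; have [f1 f2] := fs k; have [g1 g2] := gs k; split.
  under eq_fun do rewrite ReM.
  by apply: CkcD; [exact: CkcM|apply: CkcN; exact: CkcM].
by under eq_fun do rewrite ImM; apply: CkcD; exact: CkcM.
Qed.

Lemma csmoothJ f : csmooth f -> csmooth (fun x => (f x)^*%C).
Proof.
move=> fs k; have [f1 f2] := fs k; split; first by under eq_fun do rewrite ReJ.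
by under eq_fun do rewrite ImJ; exact: CkcN.
Qed.

Lemma csmooth_cst (k : C) : csmooth (fun=> k).
Proof. by move=> n; split; exact: Ckc_cst. Qed.

Lemma csmoothX f n : csmooth f -> csmooth (fun x => f x ^+ n).
Proof.
move=> fs; elim: n => [|n IH]; first exact: csmooth_cst.
by under eq_fun do rewrite exprS; exact: csmoothM.
Qed.

Lemma csmooth_real (h : R * R -> R) : (forall k, Ckc k h) ->
  csmooth (fun x => (h x)%:C).
Proof. by move=> hs k; split; [exact: hs|exact: Ckc_cst]. Qed.

Lemma csmooth_continuous f : csmooth f ->
  continuous (fun x => Rep (f x)) /\ continuous (fun x => Imp (f x)).
Proof. by move=> /(_ 0%N)[/Ckc_continuous ? /Ckc_continuous ?]. Qed.

Lemma csmooth_measurable f : csmooth f -> cmeasurable setT f.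
Proof.
by move=> /csmooth_continuous[c1 c2]; split; exact: continuous_measurable2.
Qed.

Lemma test_csmooth f : test_function f -> csmooth f.
Proof. by move=> [s1 s2 _] k; split; exact: smooth_Ckc. Qed.

Variable b : R.
Notation Pi := (Pi_classical b).

Lemma csmooth_coord j : csmooth (fun x => (vector_potential b j x)%:C).
Proof.
apply: csmooth_real => k; rewrite /vector_potential; case: (j == ord0).
  exact: (CkcM (Ckc_cst k (b / 2)) (CkcN (Ckc_snd k))).
exact: (CkcM (Ckc_cst k (b / 2)) (Ckc_fst k)).
Qed.

Lemma csmooth_Pi j f : csmooth f -> csmooth (Pi j f).
Proof.
move=> fs; have [_ ds] := csmooth_partial j fs.
have h1 := csmoothM (csmooth_cst (- 'i%C)) ds.
have h2 := csmoothM (csmooth_cst (-1)) (csmoothM (csmooth_coord j) fs).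
have := csmoothD h1 h2; congr csmooth; apply/funext => x.
by rewrite /Pi_classical mulN1r.
Qed.

Lemma PiE j f df : is_cderiv j f df ->
  Pi j f = fun x => - 'i%C * df x - (vector_potential b j x)%:C * f x.
Proof. by move=> /cpartialE fd; rewrite /Pi_classical fd. Qed.

Lemma PiD j f g : csmooth f -> csmooth g ->
  Pi j (fun x => f x + g x) = fun x => Pi j f x + Pi j g x.
Proof.
move=> /(csmooth_partial j)[fd _] /(csmooth_partial j)[gd _].
rewrite (PiE (is_cderivD fd gd)); apply/funext => x.
by rewrite /Pi_classical; ring.
Qed.

Lemma PiZ j (k : C) f : csmooth f -> Pi j (fun x => k * f x) = fun x => k * Pi j f x.
Proof.
move=> /(csmooth_partial j)[fd _].
rewrite (PiE (is_cderivZ k fd)); apply/funext => x.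
by rewrite /Pi_classical; ring.
Qed.

Lemma PiM j f (h : R * R -> R) (dh : R * R -> R) : csmooth f ->
  (forall x, is_derive x (e j) h (dh x)) ->
  Pi j (fun x => (h x)%:C * f x) =
  fun x => (h x)%:C * Pi j f x - 'i%C * (dh x)%:C * f x.
Proof.
move=> /(csmooth_partial j)[fd _] hd.
rewrite (PiE (is_cderivM (is_cderiv_real hd) fd)); apply/funext => x.
by rewrite /Pi_classical; ring.
Qed.

(** The magnetic momenta are symmetric up to a divergence. *)
Lemma Pi_symm j f g : csmooth f -> csmooth g -> forall x,
  Pi j f x * (g x)^*%C - f x * (Pi j g x)^*%C =
  - 'i%C * cpartial j (fun y => f y * (g y)^*%C) x.
Proof.
move=> /(csmooth_partial j)[fd _] /(csmooth_partial j)[gd _] x.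
rewrite (cpartialE (is_cderivM fd (is_cderivJ gd))) /Pi_classical.
have JE (p q : C) (a : R) : (- 'i%C * p - a%:C * q)^*%C = 'i%C * p^*%C - a%:C * q^*%C.
  by case: p => p1 p2; case: q => q1 q2; apply: complex_ext => /=; ring.
by rewrite JE; ring.
Qed.

End complex_calculus.

Section gaussian_states.
Context {R : realType}.
Variables (b : R) (c : R * R).
Hypothesis b0 : 0 < b.
Notation C := R[i].
Notation e j := (@basis_vec R j).
Notation Pi := (Pi_classical b).

Definition zc (x : R * R) : C := (x.1 - c.1) +i* (x.2 - c.2).

Definition phase_angle (x : R * R) : R := b / 2 * (c.1 * x.2 - c.2 * x.1).

(** The phase of the magnetic translation by c. *)
Definition phase (x : R * R) : C := cos (phase_angle x) +i* sin (phase_angle x).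

Definition weight (x : R * R) : R := expR (- (b / 4 * sqdist c x)).

(** The magnetic translate to c of z^a zbar^k exp(- b |z|^2 / 4): the exponent k
    bounds the Landau levels involved and a - k is the angular momentum. *)
Definition gauss_state (a k : nat) (x : R * R) : C :=
  phase x * zc x ^+ a * (zc x)^*%C ^+ k * (weight x)%:C.

(** The partial derivatives of z. *)
Definition dz (j : 'I_2) : C := if j == ord0 then 1 else 'i%C.

Definition coord (j : 'I_2) (x : R * R) : R := if j == ord0 then x.1 - c.1 else x.2 - c.2.

Lemma is_derive_coord j (i : 'I_2) x :
  is_derive x (e j) (coord i) ((i == j)%:R).
Proof.
have [i0|i1] : i = ord0 \/ i = ord_max.
  by case: i => -[|[|//]] ?; [left|right]; exact: val_inj.
- have -> : coord i = fun x => fst x - cst c.1 x by apply/funext => y; rewrite /coord i0.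
  apply: is_derive_cast (is_deriveB (is_derive_fst x (e j)) (is_derive_cst c.1 x (e j))).
  by rewrite subr0 i0 /basis_vec eq_sym; case: (_ == _).
- have -> : coord i = fun x => snd x - cst c.2 x by apply/funext => y; rewrite /coord i1.
  apply: is_derive_cast (is_deriveB (is_derive_snd x (e j)) (is_derive_cst c.2 x (e j))).
  rewrite subr0 i1 /basis_vec.
  by case: j => -[|[|//]] ?.
Qed.

Lemma is_cderiv_zc j : is_cderiv j zc (fun=> dz j).
Proof.
move=> x; split; [have := is_derive_coord j ord0 x|have := is_derive_coord j ord_max x];
  rewrite /coord /= /dz; apply: is_derive_cast; by case: j => -[|[|//]] ?.
Qed.

Lemma is_derive_sqdist j x : is_derive x (e j) (sqdist c) (2 * coord j x).
Proof.
have h1 := is_derive_coord j ord0 x; have h2 := is_derive_coord j ord_max x.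
apply: is_derive_cast (is_deriveD (is_deriveM h1 h1) (is_deriveM h2 h2)).
rewrite /GRing.scale /= /coord /=.
by case: j {h1 h2} => -[|[|//]] ? /=; ring.
Qed.

Lemma is_derive_weight j x :
  is_derive x (e j) weight (- (b / 2 * coord j x * weight x)).
Proof.
have h := is_deriveZ (- (b / 4)) (is_derive_sqdist j x).
have := is_derive_chain (is_derive_expR ((- (b / 4) \*: sqdist c) x)) h.
rewrite (_ : expR \o _ = weight); last first.
  by apply/funext => y; rewrite /weight /= /GRing.scale /= mulNr.
apply: is_derive_cast.
have -> : expR ((- (b / 4) \*: sqdist c) x) = weight x.
  by rewrite /weight /= /GRing.scale /= mulNr.
by rewrite /GRing.scale /=; field.
Qed.

Lemma Re_iM (a : R) (z : C) : Rep ('i%C * a%:C * z) = - (a * Imp z).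
Proof. by case: z => z1 z2 /=; ring. Qed.

Lemma Im_iM (a : R) (z : C) : Imp ('i%C * a%:C * z) = a * Rep z.
Proof. by case: z => z1 z2 /=; ring. Qed.

Lemma is_cderiv_phase j : is_cderiv j phase
  (fun x => 'i%C * (vector_potential b j c)%:C * phase x).
Proof.
move=> x.
have h : is_derive x (e j) phase_angle (vector_potential b j c).
  have h1 := is_deriveZ (b / 2 * c.1) (is_derive_snd x (e j)).
  have h2 := is_deriveZ (b / 2 * c.2) (is_derive_fst x (e j)).
  apply: is_derive_ext (is_deriveB h1 h2).
    move=> y; change (b / 2 * c.1 * y.2 - b / 2 * c.2 * y.1 = phase_angle y).
    by rewrite /phase_angle; ring.
  rewrite /vector_potential /basis_vec /GRing.scale /=.
  by case: (j == ord0) => /=; ring.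
split.
  apply: is_derive_cast (is_derive_chain (is_derive_cos (phase_angle x)) h).
  by rewrite Re_iM mulNr mulrC.
apply: is_derive_cast (is_derive_chain (is_derive_sin (phase_angle x)) h).
by rewrite Im_iM mulrC.
Qed.

Lemma csmooth_zc : csmooth zc.
Proof.
move=> k; split.
  exact: (CkcD (Ckc_fst k) (Ckc_cst k (- c.1))).
exact: (CkcD (Ckc_snd k) (Ckc_cst k (- c.2))).
Qed.

Lemma Ckc_sqdist k : Ckc k (sqdist c).
Proof.
have [z1 z2] := csmooth_zc k.
by apply: CkcD; exact: CkcM.
Qed.

Lemma csmooth_weight : csmooth (fun x => (weight x)%:C).
Proof.
apply: csmooth_real => k.
apply: (@Ckc_chain R k (fun x => - (b / 4 * sqdist c x)) (fun=> expR)).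
exact: (CkcN (CkcM (Ckc_cst k (b / 4)) (Ckc_sqdist k))).
Qed.

Lemma csmooth_phase : csmooth phase.
Proof.
have s k : Ckc k phase_angle.
  exact: (CkcM (Ckc_cst k (b / 2)) (CkcD (CkcM (Ckc_cst k c.1) (Ckc_snd k))
    (CkcN (CkcM (Ckc_cst k c.2) (Ckc_fst k))))).
pose F (i : nat) (t : R) := Rep (('i%C : C) ^+ i * (cos t +i* sin t)).
have FE (i : nat) (t : R) : is_derive t (1 : R) (F i) (F i.+1 t).
  have h := is_deriveB (is_deriveZ (Rep (('i%C : C) ^+ i)) (is_derive_cos t))
    (is_deriveZ (Imp (('i%C : C) ^+ i)) (is_derive_sin t)).
  have -> : F i = (Rep (('i%C : C) ^+ i) \*: cos) \- (Imp (('i%C : C) ^+ i) \*: sin).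
    by apply/funext => y; rewrite /F !reim.
  have -> // : F i.+1 t = Rep (('i%C : C) ^+ i) *: - sin t - Imp (('i%C : C) ^+ i) *: cos t.
  by rewrite /F exprS !reim /= /GRing.scale /=; ring.
move=> k; split.
  have := @Ckc_chain R k phase_angle F (fun i x => FE i _) (s k).
  congr Ckc; apply/funext => x; change (F 0%N (phase_angle x) = Rep (phase x)).
  by rewrite /F expr0 mul1r.
have := @Ckc_chain R k phase_angle (fun i => F (i + 3)%N) (fun i x => FE _ _) (s k).
congr Ckc; apply/funext => x; change (F 3 (phase_angle x) = sin (phase_angle x)).
rewrite /F 2!exprS expr1; move: (cos _) (sin _) => u v /=; ring.
Qed.

Lemma csmooth_gE a k : csmooth (gauss_state a k).
Proof.
apply: csmoothM; last exact: csmooth_weight.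
apply: csmoothM; last by apply: csmoothX; apply: csmoothJ; exact: csmooth_zc.
by apply: csmoothM; [exact: csmooth_phase|apply: csmoothX; exact: csmooth_zc].
Qed.

(** The phase turns the vector potential at x into its increment from c, which
    combines with the derivative of the weight into a multiple of zbar. *)
Lemma coord_dz j x : (vector_potential b j c)%:C - (vector_potential b j x)%:C +
  'i%C * (b / 2 * coord j x)%:C = 'i%C * (b / 2)%:C * dz j * (zc x)^*%C :> C.
Proof.
rewrite /vector_potential /coord /dz /zc.
by case: (j == ord0); apply: complex_ext => /=; field.
Qed.

Lemma Pi_gE j a k : Pi j (gauss_state a k) = fun x => 'i%C * ((b / 2)%:C * dz j * gauss_state a k.+1 x
  - a%:R * dz j * gauss_state a.-1 k x - k%:R * (dz j)^*%C * gauss_state a k.-1 x).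
Proof.
have d := is_cderivM (is_cderivM (is_cderivM (is_cderiv_phase j) (is_cderivX a (is_cderiv_zc j)))
  (is_cderivX k (is_cderivJ (is_cderiv_zc j)))) (is_cderiv_real (is_derive_weight j)).
rewrite (PiE _ d); apply/funext => x; rewrite /gauss_state exprS.
set P := phase x; set W := (weight x)%:C; set Z := zc x ^+ a; set Z' := _ ^+ k.
have WE : (- (b / 2 * coord j x * weight x))%:C = - ((b / 2 * coord j x)%:C * W).
  by rewrite /W; apply: complex_ext; rewrite !reim /=; ring.
rewrite WE.
have := coord_dz j x; set A := (vector_potential b j c)%:C.
set B := (vector_potential b j x)%:C; set X := (b / 2 * coord j x)%:C => H.
have H2 : - B = 'i%C * (b / 2)%:C * dz j * (zc x)^*%C - A - 'i%C * X by rewrite -H; ring.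
rewrite -[X in _ + X]mulNr H2.
have i2 : ('i%C : C) * 'i%C = -1 by rewrite -expr2 sqr_i.
have i3 : - ('i%C : C) * 'i%C = 1 by rewrite mulNr i2 opprK.
set Za := zc x ^+ a.-1; set Zk := _ ^+ k.-1.
have -> : - 'i%C * (P * Z * Z' * - (X * W) + W * (P * Z * (k%:R * Zk * (dz j)^*%C) +
   Z' * (P * (a%:R * Za * dz j) + Z * ('i%C * A * P)))) =
  'i%C * (P * Z * Z' * (X * W)) - 'i%C * (W * (P * Z * (k%:R * Zk * (dz j)^*%C)))
  - 'i%C * (W * Z' * (P * (a%:R * Za * dz j))) + (- 'i%C * 'i%C) * (W * Z' * Z * A * P) by ring.
by rewrite i3; ring.
Qed.

Lemma sum_dz : \sum_(j < 2) dz j ^+ 2 = 0.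
Proof. by rewrite 2!big_ord_recl big_ord0 addr0 /dz /= expr1n sqr_i subrr. Qed.

Lemma sum_dzJ : \sum_(j < 2) dz j * (dz j)^*%C = 2.
Proof.
rewrite 2!big_ord_recl big_ord0 addr0 /dz /=.
by apply: complex_ext => /=; ring.
Qed.

End gaussian_states.

(** * Completeness of the Gaussian states *)

Section gaussian_states2.
Context {R : realType}.
Variables (b : R) (c : R * R).
Hypothesis b0 : 0 < b.
Notation C := R[i].
Notation mu2 := (lebesgue2 R).
Notation Pi := (Pi_classical b).
Notation gE := (gauss_state b c).
Notation rho := (sqdist c).

Lemma abs2_zc x : abs2 (zc c x) = rho x. Proof. by []. Qed.

Lemma zc_mulJ x : zc c x * (zc c x)^*%C = (rho x)%:C.
Proof. by rewrite -abs2E. Qed.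

Lemma abs2_phase x : abs2 (phase b c x) = 1.
Proof. by rewrite /abs2 /= cos2Dsin2. Qed.

Lemma weight_sq x : weight b c x ^+ 2 = expR (- (b / 2 * rho x)).
Proof. by rewrite /weight expr2 -expRD; congr expR; field. Qed.

Lemma abs2_gE a k x : abs2 (gE a k x) = rho x ^+ (a + k) * expR (- (b / 2 * rho x)).
Proof.
by rewrite /gauss_state !abs2M abs2_phase mul1r !abs2X abs2J abs2_zc abs2c weight_sq exprD.
Qed.

Lemma gauss_L2 (f : R * R -> C) N : cmeasurable setT f ->
  (forall x, abs2 (f x) <= rho x ^+ N * expR (- (b / 4 * rho x))) -> L2 f.
Proof.
move=> mf fN; apply: (L2_dom mf _ fN); apply: intg_poly_gauss.
by rewrite divr_gt0.
Qed.

(** A space of functions that is stable under the momenta and on which all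
    computations are algebraic. *)
Inductive gauss_span : (R * R -> C) -> Prop :=
| gs_gE a k : gauss_span (gE a k)
| gsD f g : gauss_span f -> gauss_span g -> gauss_span (fun x => f x + g x)
| gsZ (k : C) f : gauss_span f -> gauss_span (fun x => k * f x).

Lemma gs_csmooth f : gauss_span f -> csmooth f.
Proof.
elim=> [a k|{}f g _ IH1 _ IH2|k {}f _ IH]; first exact: csmooth_gE.
  exact: csmoothD.
exact: (csmoothM (csmooth_cst k) IH).
Qed.

(** The factor 1 + rho is what dominates the derivatives of the cut-offs. *)
Lemma gs_int f : gauss_span f -> intg mu2 (fun x => (1 + rho x) * abs2 (f x)).
Proof.
have mr : measurable_fun setT rho by exact: measurable_sqdist.
move=> gf; elim: gf => [a k|{}f g gf IH1 gg IH2|k {}f gf IH].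
- have b2 : 0 < b / 2 by rewrite divr_gt0.
  have := intgD (intg_poly_gauss c (a + k) b2) (intg_poly_gauss c (a + k).+1 b2).
  congr (integrable _ _ _); apply/funext => x /=; rewrite abs2_gE exprS; congr EFin; ring.
- apply: le_intg (intgD (intgZl 2 IH1) (intgZl 2 IH2)) => [|x].
    apply: measurable_funM; first exact: measurable_funD.
    by apply: cmeasurable_abs2; apply: csmooth_measurable; apply: csmoothD; exact: gs_csmooth.
  have r0 := sqdist_ge0 c x; have := abs2D (f x) (g x).
  rewrite !ger0_norm; last 2 first.
  + by rewrite !addr_ge0// !mulr_ge0 ?abs2_ge0// addr_ge0.
  + by rewrite mulr_ge0 ?abs2_ge0// addr_ge0.
  move=> H; have := ler_wpM2l (addr_ge0 ler01 r0) H; lra.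
- have := intgZl (abs2 k) IH; congr (integrable _ _ _).
  by apply/funext => x /=; rewrite abs2M mulrCA.
Qed.

Lemma gs_L2 f : gauss_span f -> L2 f.
Proof.
move=> gf; apply: (L2_dom (csmooth_measurable (gs_csmooth gf)) (gs_int gf)) => x.
by rewrite mulrDl mul1r lerDl mulr_ge0 ?abs2_ge0 ?sqdist_ge0.
Qed.

Lemma Pi_gE_lin j a k : Pi j (gE a k) = fun x =>
  ('i%C * (b / 2)%:C * dz j) * gE a k.+1 x +
  ((- 'i%C * a%:R * dz j) * gE a.-1 k x + (- 'i%C * k%:R * (dz j)^*%C) * gE a k.-1 x).
Proof. by rewrite Pi_gE; apply/funext => x; ring. Qed.

Lemma gs_Pi j f : gauss_span f -> gauss_span (Pi j f).
Proof.
elim=> [a k|{}f g gf IH1 gg IH2|k {}f gf IH].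
- rewrite Pi_gE_lin; apply: gsD; first by apply: gsZ; exact: gs_gE.
  by apply: gsD; apply: gsZ; exact: gs_gE.
- by rewrite PiD; [exact: gsD|exact: gs_csmooth..].
- by rewrite PiZ; [exact: gsZ|exact: gs_csmooth].
Qed.

(** The differential expression of the Landau Hamiltonian. *)
Definition magH (f : R * R -> C) (x : R * R) : C := \sum_(j < 2) Pi j (Pi j f) x.

Lemma magHD f g : gauss_span f -> gauss_span g ->
  magH (fun x => f x + g x) = fun x => magH f x + magH g x.
Proof.
move=> gf gg; apply/funext => x; rewrite /magH -big_split; apply: eq_bigr => j _ /=.
rewrite PiD; [|exact: gs_csmooth..].
by rewrite PiD//; apply: gs_csmooth; exact: gs_Pi.
Qed.

Lemma magHZ (k : C) f : gauss_span f -> magH (fun x => k * f x) = fun x => k * magH f x.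
Proof.
move=> gf; apply/funext => x; rewrite /magH mulr_sumr; apply: eq_bigr => j _ /=.
rewrite PiZ; last exact: gs_csmooth.
by rewrite PiZ//; apply: gs_csmooth; exact: gs_Pi.
Qed.

(** The sum over j of dz^2 vanishes, which leaves the mixed terms in dz and its
    conjugate: they shift a and k together. *)
Lemma magH_gE a k : magH (gE a k) = fun x =>
  (b * (2 * k%:R + 1))%:C * gE a k x - (4 * a%:R * k%:R) * gE a.-1 k.-1 x.
Proof.
apply/funext => x; rewrite /magH.
have cs a' k' := csmooth_gE b c a' k'.
have kE : k%:R * gE a k.-1.+1 x = k%:R * gE a k x :> C.
  by case: (k) => [|n]; rewrite ?mul0r.
pose B : C := (b / 2)%:C.
pose Q := - B * k.+1%:R * gE a k x - B * k%:R * gE a k x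
  + 2 * a%:R * k%:R * gE a.-1 k.-1 x.
pose P := B * (B * gE a k.+2 x - a%:R * gE a.-1 k.+1 x)
  - a%:R * (B * gE a.-1 k.+1 x - a.-1%:R * gE a.-1.-1 k x).
pose S := k%:R * k.-1%:R * gE a k.-1.-1 x.
have E j : Pi j (Pi j (gE a k)) x =
    - (dz j ^+ 2 * P + (dz j * (dz j)^*%C) * Q + ((dz j) ^+ 2)^*%C * S).
  rewrite Pi_gE_lin PiD; last 2 first.
  - exact: (csmoothM (csmooth_cst _) (cs _ _)).
  - exact: (csmoothD (csmoothM (csmooth_cst _) (cs _ _)) (csmoothM (csmooth_cst _) (cs _ _))).
  rewrite PiD; last 2 first.
  - exact: (csmoothM (csmooth_cst _) (cs _ _)).
  - exact: (csmoothM (csmooth_cst _) (cs _ _)).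
  rewrite !PiZ// !Pi_gE_lin /= expr2 (rmorphM conjc).
  set d := dz j; set d' := (dz j)^*%C.
  rewrite -/B.
  have ii : ('i%C : C) * 'i%C = -1 by rewrite -expr2 sqr_i.
  have -> : - (d * d * P + d * d' * Q + d' * d' * S) =
     ('i%C * 'i%C) * (d * d * P + d * d' * Q + d' * d' * S) by rewrite ii mulN1r.
  have kE2 : B * k%:R * gE a k x = B * (k%:R * gE a k.-1.+1 x) by rewrite kE; ring.
  by rewrite /P /Q /S kE2; ring.
rewrite (eq_bigr (fun j => - (dz j ^+ 2 * P + (dz j * (dz j)^*%C) * Q + ((dz j) ^+ 2)^*%C * S))) //.
rewrite sumrN !big_split /= -!mulr_suml sum_dz sum_dzJ.
have -> : \sum_(i < 2) (dz i ^+ 2)^*%C = 0 :> C.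
  by rewrite -(rmorph_sum conjc) sum_dz rmorph0.
have BE : 2 * B = b%:C by rewrite /B; apply: complex_ext => /=; field.
have -> : (b * (2 * k%:R + 1))%:C = 2 * B * (2 * k%:R + 1) :> C.
  by rewrite BE; rewrite (rmorphM (real_complex R)) rmorphD rmorphM !rmorph_nat rmorph1.
by rewrite !mul0r add0r addr0 /Q -natr1; ring.
Qed.

(** By z = x + i y, powers of the real coordinates map Gaussian states to
    combinations of Gaussian states. *)
Definition gEx (i j a k : nat) (x : R * R) : C :=
  (coord c ord0 x)%:C ^+ i * (coord c ord_max x)%:C ^+ j * gE a k x.

Lemma coord_sq_le (i : 'I_2) x : coord c i x ^+ 2 <= rho x.
Proof.
rewrite /coord /sqdist; case: ifP => _; first by rewrite lerDl sqr_ge0.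
by rewrite lerDr sqr_ge0.
Qed.

Lemma gEx_measurable i j a k : cmeasurable setT (gEx i j a k).
Proof.
have mc (l : 'I_2) n : cmeasurable setT (fun x : R * R => (coord c l x)%:C ^+ n).
  elim: n => [|n IH]; first exact: cmeasurable_cst.
  under eq_fun do rewrite exprS; apply: cmeasurableM => //.
  apply: cmeasurable_real; rewrite /coord; case: (l == ord0);
    by apply: measurable_funB => //; (exact: measurable_fst || exact: measurable_snd).
apply: cmeasurableM; first exact: cmeasurableM.
by apply: csmooth_measurable; exact: csmooth_gE.
Qed.

Lemma gEx_grow_L2 i j a k :
  L2 (fun x => (expR (b / 8 * rho x))%:C * gEx i j a k x).
Proof.
apply: (@gauss_L2 _ (i + j + (a + k))%N).
  apply: cmeasurableM; last exact: gEx_measurable.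
  apply: cmeasurable_real; apply: measurableT_comp => //.
  by apply: measurable_funM => //; exact: measurable_sqdist.
move=> x; rewrite abs2M /gEx 2!abs2M !abs2X !abs2c abs2_gE.
have -> : expR (b / 8 * rho x) ^+ 2 = expR (b / 4 * rho x).
  by rewrite expr2 -expRD; congr expR; field.
have -> : expR (- (b / 4 * rho x)) = expR (b / 4 * rho x) * expR (- (b / 2 * rho x)).
  by rewrite -expRD; congr expR; field.
rewrite [leRHS]mulrCA ler_wpM2l ?expR_ge0// !mulrA ler_wpM2r ?expR_ge0//.
rewrite [in leRHS]exprD ler_wpM2r ?exprn_ge0 ?sqdist_ge0// exprD.
have cX (l : 'I_2) n : (coord c l x ^+ 2) ^+ n <= rho x ^+ n.
  by apply: lerXn2r; rewrite ?nnegrE ?sqr_ge0 ?sqdist_ge0 ?coord_sq_le.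
by apply: ler_pM => //; apply: exprn_ge0; exact: sqr_ge0.
Qed.

Lemma gEx_L2 i j a k : L2 (gEx i j a k).
Proof.
apply: (L2_dom (gEx_measurable i j a k) (L2_abs2_intg (gEx_grow_L2 i j a k))) => x.
rewrite abs2M ler_peMl ?abs2_ge0// abs2c expr_ge1 ?expR_ge0//.
by rewrite -expR0 ler_expR mulr_ge0 ?sqdist_ge0// divr_ge0// ltW.
Qed.

Lemma gEx00 a k : gEx 0 0 a k = gE a k.
Proof. by apply/funext => x; rewrite /gEx !expr0 !mul1r. Qed.

Lemma gExS1 i j a k : gEx i.+1 j a k = fun x => 2^-1 * (gEx i j a.+1 k x + gEx i j a k.+1 x).
Proof.
apply/funext => x; rewrite /gEx /gauss_state !exprS.
have -> : (coord c ord0 x)%:C = 2^-1 * (zc c x + (zc c x)^*%C).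
  by rewrite /coord /zc /=; apply: complex_ext => /=; field.
ring.
Qed.

Lemma gExS2 i j a k : gEx i j.+1 a k = fun x =>
  (- 'i%C / 2) * (gEx i j a.+1 k x - gEx i j a k.+1 x).
Proof.
apply/funext => x; rewrite /gEx /gauss_state !exprS.
have -> : (coord c ord_max x)%:C = (- 'i%C / 2) * (zc c x - (zc c x)^*%C).
  by rewrite /coord /zc /=; apply: complex_ext => /=; field.
ring.
Qed.

Lemma gEx_orth v : L2 v -> (forall a k, L2inner v (gE a k) = 0) ->
  forall i j a k, L2inner v (gEx i j a k) = 0.
Proof.
move=> Lv v0; elim=> [|i IHi]; last first.
  have L := gEx_L2; move=> j a k; rewrite gExS1 (innerZr _ (L2D (L _ _ _ _) (L _ _ _ _)) Lv).
  by rewrite (innerDr (L _ _ _ _) (L _ _ _ _) Lv) !IHi addr0 mulr0.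
elim=> [|j IHj] a k; first by rewrite gEx00.
have L := gEx_L2; rewrite gExS2 (innerZr _ (L2B (L _ _ _ _) (L _ _ _ _)) Lv).
by rewrite (innerBr (L _ _ _ _) (L _ _ _ _) Lv) !IHj subr0 mulr0.
Qed.

(** The product V of v and the conjugate of the ground state has vanishing
    moments in the real coordinates, and it stays integrable after
    multiplication by a growing Gaussian. *)
Lemma gE_complete v : L2 v -> (forall a k, L2inner v (gE a k) = 0) ->
  {ae mu2, forall x, v x = 0}.
Proof.
move=> Lv v0; have H := gEx_orth Lv v0.
pose V x := v x * (gE 0 0 x)^*%C.
have VE i j x : v x * (gEx i j 0 0 x)^*%C =
    (coord c ord0 x ^+ i * coord c ord_max x ^+ j)%:C * V x.
  by rewrite /gEx /V -!realcX -realcM conjcMr mulrCA.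
have VG x : v x * ((expR (b / 8 * rho x))%:C * gEx 0 0 0 0 x)^*%C =
    (expR (b / 8 * rho x))%:C * V x.
  by rewrite gEx00 conjcMr mulrCA.
have [g1 g2] := L2_cintg Lv (gEx_grow_L2 0 0 0 0).
have mV : cmeasurable setT V.
  by apply: cmeasurableM; [exact: Lv.1|apply: cmeasurableJ; apply: csmooth_measurable; exact: csmooth_gE].
have b8 : 0 < b / 8 by rewrite divr_gt0.
have part (h : R * R -> R) : measurable_fun setT h ->
    intg mu2 (fun x => expR (b / 8 * rho x) * h x) ->
    (forall i j, \int[mu2]_x (coord c ord0 x ^+ i * coord c ord_max x ^+ j * h x) = 0) ->
    {ae mu2, forall x, h x = 0}.
  move=> mh ih h0.
  have [|i j|N [mN N0 sN]] := @gaussian_moment2 R mu2 h c (b / 8) b8 mh.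
  - by move: ih; congr (integrable _ _ _); apply/funext => x /=; rewrite mulrC.
  - rewrite -[RHS](h0 i j); apply: eq_Rintegral => x _; rewrite /coord /=; ring.
  - by exists N.
have V1 : {ae mu2, forall x, Rep (V x) = 0}.
  apply: part; first exact: mV.1.
    by move: g1; congr (integrable _ _ _); apply/funext => x /=; rewrite VG Re_cM.
  move=> i j; have := congr1 (@complex.Re R) (H i j 0%N 0%N); rewrite /L2inner /=.
  by move=> <-; apply: eq_Rintegral => x _; rewrite VE Re_cM.
have V2 : {ae mu2, forall x, Imp (V x) = 0}.
  apply: part; first exact: mV.2.
    by move: g2; congr (integrable _ _ _); apply/funext => x /=; rewrite VG Im_cM.
  move=> i j; have := congr1 (@complex.Im R) (H i j 0%N 0%N); rewrite /L2inner /=.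
  by move=> <-; apply: eq_Rintegral => x _; rewrite VE Im_cM.
apply: ae_mono2 V1 V2 => x h1 h2.
have : V x = 0 by exact: complex_ext.
move=> /eqP; rewrite mulf_eq0 => /orP[/eqP//|].
rewrite conjc_eq0 => /eqP E0; have := abs2_gE 0 0 x; rewrite E0 expr0 mul1r.
by rewrite /abs2 /= expr0n addr0 => /eqP; rewrite eq_sym gt_eqF// expR_gt0.
Qed.

Lemma gE_shift a k j x : gE (a + j) (k + j) x = (rho x ^+ j)%:C * gE a k x.
Proof.
rewrite realcX -zc_mulJ /gauss_state !exprD exprMn; ring.
Qed.

(** Orthogonality to one angular sector passes to radial cut-offs, because the
    states of the sector are powers of rho times a single one of them. *)
Lemma gE_radial v a k r : L2 v -> 0 < r ->
  (forall j, L2inner v (gE (a + j) (k + j)) = 0) ->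
  L2inner v (fun x => (\1_(disc c r) x)%:C * gE a k x) = 0.
Proof.
move=> Lv r0 H.
pose V x := v x * (gE a k x)^*%C.
have VE j x : v x * (gE (a + j) (k + j) x)^*%C = (rho x ^+ j)%:C * V x.
  by rewrite gE_shift conjcMr mulrCA.
have VG x : v x * ((expR (b / 8 * rho x))%:C * gEx 0 0 a k x)^*%C =
    (expR (b / 8 * rho x))%:C * V x.
  by rewrite gEx00 conjcMr mulrCA.
have VD x : v x * ((\1_(disc c r) x)%:C * gE a k x)^*%C = (rho x <= r ^+ 2)%R%:R%:C * V x.
  rewrite conjcMr mulrCA indicE; congr (_%:R%:C * _).
  congr (nat_of_bool _).
  by apply/idP/idP => [/set_mem//|h]; exact: mem_set.
have [g1 g2] := L2_cintg Lv (gEx_grow_L2 0 0 a k).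
have mV : cmeasurable setT V.
  by apply: cmeasurableM; [exact: Lv.1|apply: cmeasurableJ; apply: csmooth_measurable; exact: csmooth_gE].
have b8 : 0 < b / 8 by rewrite divr_gt0.
have r2 : 0 < r ^+ 2 by rewrite exprn_gt0.
apply: complex_ext; rewrite /L2inner /=.
- rewrite -[RHS](@sublevel_moment _ _ _ mu2 (fun x => Rep (V x)) rho (b / 8) (r ^+ 2))//.
  + by apply: eq_Rintegral => x _; rewrite VD Re_cM mulrC.
  + exact: mV.1.
  + exact: measurable_sqdist.
  + by move=> x; exact: sqdist_ge0.
  + move: g1; congr (integrable _ _ _); apply/funext => x /=; rewrite VG Re_cM.
    by rewrite mulrC.
  + move=> j; have := congr1 (@complex.Re R) (H j); rewrite /L2inner /= => <-.
    by apply: eq_Rintegral => x _; rewrite VE Re_cM mulrC.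
- rewrite -[RHS](@sublevel_moment _ _ _ mu2 (fun x => Imp (V x)) rho (b / 8) (r ^+ 2))//.
  + by apply: eq_Rintegral => x _; rewrite VD Im_cM mulrC.
  + exact: mV.2.
  + exact: measurable_sqdist.
  + by move=> x; exact: sqdist_ge0.
  + move: g2; congr (integrable _ _ _); apply/funext => x /=; rewrite VG Im_cM.
    by rewrite mulrC.
  + move=> j; have := congr1 (@complex.Im R) (H j); rewrite /L2inner /= => <-.
    by apply: eq_Rintegral => x _; rewrite VE Im_cM mulrC.
Qed.

End gaussian_states2.

(** * Smooth cut-offs *)

Section flat_function.
Context {R : realType}.
Implicit Types (p : {poly R}) (t : R).

(** The functions p(1/t) exp(-1/t), extended by 0 to t <= 0, which are stable
    under differentiation. *)
Definition flat p t : R := if 0 < t then p.[t^-1] * expR (- t^-1) else 0.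

Definition flat_der p : {poly R} := 'X^2 * (p - p^`()).

(** With quadratic_is_derive0, this settles differentiability at 0 for all p at
    once. *)
Lemma flat_quadratic p : exists K : R, forall t, `|flat p t| <= K * t ^+ 2.
Proof.
pose K := \sum_(i < size p) `|p`_i| * (i.+2)`!%:R.
have K0 : 0 <= K by apply: sumr_ge0 => i _; rewrite mulr_ge0.
exists K => t; rewrite /flat; case: ifP => [t0|_]; last first.
  by rewrite normr0 mulr_ge0// sqr_ge0.
have s0 : 0 < t^-1 by rewrite invr_gt0.
rewrite -[t in leRHS]invrK; move: t^-1 s0 => s s0.
rewrite exprVn ler_pdivlMr ?exprn_gt0// normrM (ger0_norm (expR_ge0 _)).
rewrite expRN mulrAC ler_pdivrMr ?expR_gt0//.
rewrite horner_coef /K mulr_suml.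
apply: (@le_trans _ _ ((\sum_(i < size p) `|p`_i| * s ^+ i) * s ^+ 2)).
  rewrite ler_wpM2r ?sqr_ge0//; apply: (le_trans (ler_norm_sum _ _ _)).
  by apply: ler_sum => i _; rewrite normrM (ger0_norm (exprn_ge0 _ (ltW s0))).
rewrite mulr_suml; apply: ler_sum => i _.
rewrite -mulrA -exprD -mulrA ler_wpM2l//.
have := @expr_le_expR R 1 s (i + 2) ltr01 (ltW s0).
by rewrite expr1n divr1 mul1r addn2.
Qed.

Lemma quadratic_is_derive0 (f : R -> R) (K : R) :
  (forall t, `|f t| <= K * t ^+ 2) -> is_derive (0 : R) (1 : R) f 0.
Proof.
move=> fK.
have f0 : f 0 = 0.
  by apply/eqP; rewrite -normr_le0; have := fK 0; rewrite expr0n mulr0.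
have K0 : 0 <= K by have := fK 1; rewrite expr1n mulr1; apply: le_trans.
have H : (fun h : R => h^-1 *: ((f \o shift 0) (h *: (1 : R)) - f 0)) @ 0^' --> (0 : R).
  apply/cvgrPdist_le => e e0.
  have K1 : 0 < K + 1 by rewrite ltr_wpDl.
  near=> h.
  have h0 : h != 0 by near: h; exact: nbhs_dnbhs_neq.
  have he : `|h| <= e / (K + 1).
    near: h; apply: dnbhs0_le; exact: divr_gt0.
  rewrite /= addr0 f0 subr0 sub0r normrN [h *: 1]mulr1 normrM normfV.
  rewrite ler_pdivrMl ?normr_gt0//; apply: (le_trans (fK h)).
  rewrite -(real_normK (num_real h)) expr2 mulrCA ler_wpM2l//.
  apply: (@le_trans _ _ ((K + 1) * `|h|)); first by rewrite ler_wpM2r// lerDl.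
  by rewrite mulrC -ler_pdivlMr.
by apply: DeriveDef; [apply/cvg_ex; exists 0|exact: (cvg_lim _ H)].
Unshelve. all: by end_near. Qed.

Lemma is_derive_flat p t : is_derive t (1 : R) (flat p) (flat (flat_der p) t).
Proof.
have [t0|t0|<-] := ltgtP 0 t.
- apply: (@near_eq_is_derive _ _ _ (fun t => p.[t^-1] * expR (- t^-1))).
    near=> s; rewrite /flat ifT//; near: s; exact: lt_nbhsr.
  have tn : t != 0 by rewrite gt_eqF.
  have hi : is_derive t (1 : R) (fun t : R => t^-1) (- t ^- 2).
    apply: DeriveDef; first exact: derivableV.
    by rewrite deriveV// derive_id [_ *: _]mulr1.
  have hN : is_derive t (1 : R) (fun t : R => - t^-1) (t ^- 2).
    by have := is_deriveN hi; rewrite opprK.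
  have h1 := is_derive1_comp (is_derive_poly p t^-1) hi.
  have h2 := @is_derive1_comp _ expR (fun t : R => - t^-1) t _ _ (is_derive_expR (- t^-1)) hN.
  have := is_deriveM h1 h2.
  rewrite /flat t0; congr is_derive.
  rewrite /flat_der !hornerE /= /GRing.scale /= -exprVn; ring.
- apply: (@near_eq_is_derive _ _ _ (cst 0)).
    near=> s; rewrite /flat ifF//; apply/negP/negP; rewrite -leNgt; near: s.
    exact: lt_le_nbhsl.
  rewrite /flat ifF; first exact: is_derive_cst.
  by apply/negP/negP; rewrite -leNgt ltW.
- have [K HK] := flat_quadratic p.
  rewrite [X in is_derive _ _ _ X]/flat ltxx; exact: quadratic_is_derive0 HK.
Unshelve. all: by end_near. Qed.

Lemma flat1_le1 t : 0 <= flat 1 t <= 1.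
Proof.
rewrite /flat; case: ifP => [t0|_]; last by rewrite lexx ler01.
rewrite hornerC mul1r expR_ge0/= -expR0 ler_expR oppr_le0 invr_ge0 ltW//.
Qed.

Lemma flat1_cvg t : 0 < t -> `|1 - flat 1 t| <= t^-1.
Proof.
move=> t0; have /andP[h0 h1] := flat1_le1 t; rewrite ger0_norm ?subr_ge0//.
rewrite /flat t0 hornerC mul1r; have := expR_ge1Dx (- t^-1); lra.
Qed.

Lemma flat1_der t : `|flat (flat_der 1) t| <= 2.
Proof.
rewrite /flat; case: ifP => [t0|_]; last by rewrite normr0.
have s0 : 0 <= t^-1 by rewrite invr_ge0 ltW.
rewrite /flat_der derivC subr0 mulr1 hornerXn; move: t^-1 s0 => s s0.
rewrite ger0_norm ?mulr_ge0 ?expR_ge0 ?sqr_ge0// expRN ler_pdivrMr ?expR_gt0//.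
by have := @expr_le_expR R 1 s 2 ltr01 s0; rewrite expr1n divr1 mul1r.
Qed.

Lemma flat1_der_cvg t : 1 <= t -> `|flat (flat_der 1) t| <= t^-1.
Proof.
move=> t1; have t0 : 0 < t by apply: lt_le_trans t1.
rewrite /flat t0 /flat_der derivC subr0 mulr1 hornerXn.
have s0 : 0 <= t^-1 by rewrite invr_ge0 ltW.
have s1 : t^-1 <= 1 by rewrite invf_le1.
move: t^-1 s0 s1 => s s0 s1.
rewrite ger0_norm ?mulr_ge0 ?expR_ge0 ?sqr_ge0//.
have e1 : expR (- s) <= 1 by rewrite -expR0 ler_expR oppr_le0.
have e0 := expR_ge0 (- s).
apply: (@le_trans _ _ (s ^+ 2 * 1)); first by rewrite ler_wpM2l ?sqr_ge0.
by rewrite mulr1 expr2 ler_piMr.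
Qed.

Lemma far_cvg0 (F : R -> R) (a : R) : 0 <= a ->
  (forall t, 1 <= t -> `|F t| <= t^-1) -> F (n%:R - a) @[n --> \oo] --> 0.
Proof.
move=> a0 HF.
have H : 4 * @harmonic R n @[n --> \oo] --> 0.
  by rewrite -[X in _ --> X](mulr0 4); apply: cvgMr; exact: cvg_harmonic.
apply/cvgrPdist_le => e e0.
have /cvgrPdist_le /(_ e e0) [N1 _ HN] := H.
exists (maxn N1 (Num.truncn (2 * a + 2)).+1) => // n /=.
rewrite geq_max => /andP[n1 n2]; rewrite sub0r normrN.
have na : 2 * a + 2 <= n%:R.
  by apply: (le_trans (ltW (truncnS_gt _))); rewrite ler_nat.
apply: (le_trans (HF _ _)); first by lra.
have /= := HN n n1; rewrite sub0r normrN; apply: le_trans.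
rewrite ger0_norm; last by rewrite mulr_ge0// invr_ge0.
rewrite /harmonic -[leLHS]div1r ler_pdivrMr; last by lra.
rewrite mulrAC ler_pdivlMr ?ltr0n// mul1r -natr1; lra.
Qed.

End flat_function.

Section cutoff.
Context {R : realType}.
Variable c : R * R.
Notation C := R[i].
Notation e j := (@basis_vec R j).
Notation rho := (sqdist c).

(** Supported in rho <= n, and equal to exp(- 1 / (n - rho)) there. *)
Definition cutoff (n : nat) (x : R * R) : R := flat 1 (n%:R - rho x).

Definition dcutoff (n : nat) (j : 'I_2) (x : R * R) : R :=
  - (2 * coord c j x * flat (flat_der 1) (n%:R - rho x)).

Lemma is_derive_cutoff n j x : is_derive x (e j) (cutoff n) (dcutoff n j x).
Proof.
have h := is_deriveB (is_derive_cst (n%:R : R) x (e j)) (is_derive_sqdist c j x).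
apply: is_derive_ext (is_derive_chain (is_derive_flat 1 _) h) => //.
by rewrite /dcutoff sub0r /=; ring.
Qed.

Lemma Ckc_cutoff n k : Ckc k (cutoff n).
Proof.
have h : Ckc k (fun x => n%:R - rho x).
  exact: (CkcD (Ckc_cst k n%:R) (CkcN (Ckc_sqdist c k))).
have := @Ckc_chain R k (fun x => n%:R - rho x) (fun i => flat (iter i flat_der 1)) _ h.
by apply => i x; exact: is_derive_flat.
Qed.

Lemma cutoff_le1 n x : 0 <= cutoff n x <= 1. Proof. exact: flat1_le1. Qed.

Lemma cutoff_cvg x : cutoff n x @[n --> \oo] --> (1 : R).
Proof.
have H : 1 - cutoff n x @[n --> \oo] --> (0 : R).
  apply: (@far_cvg0 R (fun t => 1 - flat 1 t)); first exact: sqdist_ge0.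
  by move=> t t1; apply: flat1_cvg; apply: lt_le_trans t1.
rewrite -[X in _ --> X]subr0.
have -> : (fun n => cutoff n x) = (fun n => 1 - (1 - cutoff n x)).
  by apply/funext => n; rewrite subKr.
by apply: cvgB => //; exact: cvg_cst.
Qed.

Lemma dcutoff_cvg j x : dcutoff n j x @[n --> \oo] --> (0 : R).
Proof.
rewrite -[X in _ --> X]oppr0 -(mulr0 (2 * coord c j x)); apply: cvgN; apply: cvgMr.
apply: far_cvg0; first exact: sqdist_ge0.
exact: flat1_der_cvg.
Qed.

(** Linear growth of the derivative is absorbed by the decay of the states. *)
Lemma dcutoff_sq_le n j x : dcutoff n j x ^+ 2 <= 16 * rho x.
Proof.
rewrite /dcutoff sqrrN !exprMn.
have := coord_sq_le c j x; have := flat1_der (n%:R - rho x).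
move: (flat _ _) => u; rewrite ler_norml => /andP[u1 u2].
have u4 : u ^+ 2 <= 4 by nra.
have r0 := sqdist_ge0 c x; have c0 := sqr_ge0 (coord c j x) => cr.
apply: (@le_trans _ _ (2 ^+ 2 * rho x * 4)); last by lra.
have := ler_pM c0 (sqr_ge0 u) cr u4; lra.
Qed.

Definition bsupp (f : R * R -> C) := exists2 r, 0 < r & forall x, ~ disc c r x -> f x = 0.

Lemma test_bsupp f : test_function f -> bsupp f.
Proof.
move=> [_ _ /compact_bounded[M [_ HM]]].
pose r := `|M| + 1 + `|c.1| + `|c.2| + 1.
have M1 : M < `|M| + 1 by have := ler_norm M; lra.
have n1 := normr_ge0 c.1; have n2 := normr_ge0 c.2; have nM := normr_ge0 M.
exists (2 * r); first by rewrite /r; lra.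
move=> x xd; apply/eqP; apply/negP => /negP fx; apply: xd.
have : `|x| <= `|M| + 1 by apply: (HM _ M1); apply: subset_closure.
have xE : `|x| = Num.max `|x.1| `|x.2| by [].
rewrite xE ge_max => /andP[x1 x2].
have h (u a : R) : `|u| <= `|M| + 1 -> `|a| <= r - `|M| - 1 -> (u - a) ^+ 2 <= r ^+ 2.
  move=> h1 h2; rewrite -(real_normK (num_real (u - a))) lerXn2r ?nnegrE//.
    by rewrite /r; lra.
  by apply: (le_trans (ler_normB _ _)); lra.
rewrite /disc /=.
have H1 : (x.1 - c.1) ^+ 2 <= r ^+ 2 by apply: (h _ _ x1); rewrite /r; lra.
have H2 : (x.2 - c.2) ^+ 2 <= r ^+ 2 by apply: (h _ _ x2); rewrite /r; lra.
have := sqr_ge0 r; rewrite exprMn; lra.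
Qed.

Lemma bsupp_test f : csmooth f -> bsupp f -> test_function f.
Proof.
move=> fs [r r0 fr]; split.
- by move=> k; apply: Ckc_Ck; exact: (fs k).1.
- by move=> k; apply: Ckc_Ck; exact: (fs k).2.
- pose B := `[c.1 - r, c.1 + r]%classic `*` `[c.2 - r, c.2 + r]%classic : set (R * R).
  have cB : compact B by apply: compact_setX; exact: segment_compact.
  apply: (subclosed_compact _ cB); first exact: closed_closure.
  have clB : closed B by apply: compact_closed cB; exact: norm_hausdorff.
  apply: (subset_trans (closure_subset _) (B := closure B)); last first.
    by rewrite -(closure_id B).1.
  move=> x /= fx; apply: disc_box => //.
  by apply: contrapT => xd; move: fx; rewrite (fr x xd) eqxx.
Qed.

Lemma cutoff_test n f : csmooth f -> test_function (fun x => (cutoff n x)%:C * f x).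
Proof.
move=> fs; apply: bsupp_test.
  by apply: csmoothM => //; apply: csmooth_real => k; exact: Ckc_cutoff.
exists n.+1%:R; first by rewrite ltr0n.
move=> x xd; rewrite (_ : cutoff n x = 0) ?mul0r//.
rewrite /cutoff /flat ifF//; apply/negP => h; apply: xd.
rewrite /disc /= -/(sqdist c x).
have : n%:R <= n.+1%:R ^+ 2 :> R by rewrite -natrX ler_nat expnS expn1 mulSn mulnS addSn; lia.
lra.
Qed.

End cutoff.

(** * Green's formula and weak magnetic gradients *)

Section green.
Context {R : realType}.
Variables (b : R) (c : R * R).
Hypothesis b0 : 0 < b.
Notation C := R[i].
Notation mu2 := (lebesgue2 R).
Notation mu := (@lebesgue_measure R).
Notation e j := (@basis_vec R j).
Notation Pi := (Pi_classical b).
Notation rho := (sqdist c).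
Notation gs := (gauss_span b c).
Implicit Types (f g u : R * R -> C) (p : 'I_2 -> R * R -> C).

Definition disc_cut (r : R) (f : R * R -> C) (x : R * R) : C := (\1_(disc c r) x)%:C * f x.

Lemma cut_L2 r f : L2 f -> L2 (disc_cut r f).
Proof. by apply: L2_indic; exact: measurable_disc. Qed.

Lemma indic_disc r x : \1_(disc c r) x = (rho x <= r ^+ 2)%R%:R :> R.
Proof.
rewrite indicE; congr (_%:R); congr (nat_of_bool _).
by apply/idP/idP => [/set_mem//|h]; exact: mem_set.
Qed.

Lemma cdisc_divergence j (h : R * R -> C) r : 0 < r -> csmooth h ->
  cintegrable mu2 setT (disc_cut r (cpartial j h)) /\
  cintegral mu2 setT (disc_cut r (cpartial j h)) =
  cintegral mu `[0, 2 * pi] (fun t => (r * normal_dir j t)%:C * h (circle_param c r t)).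
Proof.
move=> r0 hs; have [hd ds] := csmooth_partial j hs.
have [h1 h2] := csmooth_continuous hs; have [d1 d2] := csmooth_continuous ds.
split; first split.
- have := @continuous_intg_disc R _ c r r0 d1; congr (integrable _ _ _).
  by apply/funext => x; rewrite /comp /disc_cut Re_cM mulrC.
- have := @continuous_intg_disc R _ c r r0 d2; congr (integrable _ _ _).
  by apply/funext => x; rewrite /comp /disc_cut Im_cM mulrC.
apply: complex_ext; rewrite /cintegral; cbn [Rep Imp].
- transitivity (\int[mu2]_x (Rep (cpartial j h x) * \1_(disc c r) x)).
    by apply: eq_Rintegral => x _; rewrite /disc_cut Re_cM mulrC.
  rewrite (@disc_divergence R j (fun x => Rep (h x)) _ c r r0 h1 d1 (fun x => (hd x).1)).
  by apply: eq_Rintegral => t _; rewrite Re_cM mulrC.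
- transitivity (\int[mu2]_x (Imp (cpartial j h x) * \1_(disc c r) x)).
    by apply: eq_Rintegral => x _; rewrite /disc_cut Im_cM mulrC.
  rewrite (@disc_divergence R j (fun x => Imp (h x)) _ c r r0 h2 d2 (fun x => (hd x).2)).
  by apply: eq_Rintegral => t _; rewrite Im_cM mulrC.
Qed.

(** Integration by parts leaves the flux of f gbar through the circle. *)
Lemma disc_green j f g r : 0 < r -> csmooth f -> csmooth g ->
  L2 f -> L2 g -> L2 (Pi j f) -> L2 (Pi j g) ->
  L2inner (Pi j f) (disc_cut r g) - L2inner f (disc_cut r (Pi j g)) =
  - 'i%C * cintegral mu `[0, 2 * pi] (fun t => (r * normal_dir j t)%:C *
    (f (circle_param c r t) * (g (circle_param c r t))^*%C)).
Proof.
move=> r0 fs gs Lf Lg Lpf Lpg.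
have hs : csmooth (fun y => f y * (g y)^*%C) by apply: csmoothM => //; exact: csmoothJ.
have [hi hE] := cdisc_divergence j r0 hs.
rewrite -hE -cintegralZ// /L2inner -cintegralB//; last 2 first.
- exact: L2_cintg Lpf (cut_L2 r Lg).
- exact: L2_cintg Lf (cut_L2 r Lpg).
congr cintegral; apply/funext => x; rewrite /disc_cut !conjcMr.
rewrite [RHS]mulrCA -(Pi_symm b j fs gs x); ring.
Qed.

Lemma near_zero_cpartial j (f : R * R -> C) x : (\forall y \near x, f y = 0) ->
  cpartial j f x = 0.
Proof.
move=> f0; have H (F : C -> R) : F 0 = 0 -> 'D_(e j) (fun y => F (f y)) x = 0.
  move=> F0; have h : is_derive x (e j) (fun y => F (f y)) 0.
    apply: (@near_eq_is_derive _ _ _ (cst (0 : R))).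
    by apply: filterS f0 => y ->.
  by have [] := h.
by apply: complex_ext; rewrite /cpartial /=; exact: H.
Qed.

Lemma bsupp_cut f r0 : (forall x, ~ disc c r0 x -> f x = 0) -> forall r, 0 <= r0 -> r0 <= r ->
  disc_cut r f = f.
Proof.
move=> f0 r r00 rr; apply/funext => x; rewrite /disc_cut indic_disc.
case: (boolP (rho x <= r ^+ 2)) => [_|h]; first by rewrite mul1r.
rewrite mul0r f0// => xd; move/negP: h; apply; apply: le_trans xd _.
by rewrite lerXn2r// nnegrE// (le_trans r00).
Qed.

Lemma bsupp_Pi f r0 j : (forall x, ~ disc c r0 x -> f x = 0) ->
  (forall x, ~ disc c r0 x -> Pi j f x = 0).
Proof.
move=> f0 x xd; rewrite /Pi_classical near_zero_cpartial.
  by rewrite f0// !mulr0 subrr.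
have xr : r0 ^+ 2 < rho x by rewrite ltNge; exact/negP.
have := (csmooth_continuous (csmooth_real (Ckc_sqdist c))).1 x.
move=> /cvgr_gt /(_ _ xr); apply: filterS => y yr; apply: f0 => yd.
by move: yr; rewrite ltNge yd.
Qed.

Lemma bsupp_L2 f : csmooth f -> bsupp c f -> L2 f.
Proof.
move=> fs [r r0 fr]; rewrite -(bsupp_cut fr (ltW r0) (lexx r)).
have [c1 c2] := csmooth_continuous fs.
have ca : continuous (fun x => abs2 (f x)).
  move=> x; rewrite /abs2; apply: cvgD; apply: cvgM; (exact: c1 || exact: c2).
apply: (L2_dom _ (continuous_intg_disc c r0 ca)).
  apply: cmeasurableM; last exact: csmooth_measurable.
  by apply: cmeasurable_real; apply: measurable_indic; exact: measurable_disc.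
move=> x; rewrite /disc_cut abs2M abs2c indic_disc mulrC.
by case: (rho x <= r ^+ 2); rewrite ?expr1n// expr0n.
Qed.

Lemma test_L2 f : test_function f -> L2 f.
Proof. by move=> ft; apply: bsupp_L2; [exact: test_csmooth|exact: test_bsupp]. Qed.

Lemma test_Pi_L2 j f : test_function f -> L2 (Pi j f).
Proof.
move=> ft; apply: bsupp_L2; first by apply: csmooth_Pi; exact: test_csmooth.
have [r r0 fr] := test_bsupp c ft; exists r => //; exact: bsupp_Pi.
Qed.

Lemma sqdist_circle (r t : R) : rho (circle_param c r t) = r ^+ 2.
Proof.
rewrite /sqdist /=; have := cos2Dsin2 t; move: (cos t) (sin t) => u v uv.
by rewrite -[RHS]mulr1 -uv; ring.
Qed.

(** There is no flux through a circle that encloses the support of g. *)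
Lemma plane_ibp j f g : csmooth f -> L2 f -> L2 (Pi j f) -> test_function g ->
  L2inner (Pi j f) g = L2inner f (Pi j g).
Proof.
move=> fs Lf Lpf gt; have [r r0 gr] := test_bsupp c gt.
have r1 : 0 < r + 1 by rewrite addr_gt0.
have rr : r <= r + 1 by rewrite lerDl.
have := disc_green r1 fs (test_csmooth gt) Lf (test_L2 gt) Lpf (test_Pi_L2 j gt).
rewrite (bsupp_cut gr (ltW r0) rr) (bsupp_cut (bsupp_Pi j gr) (ltW r0) rr).
rewrite (_ : cintegral _ _ _ = 0) ?mulr0; first by move/eqP; rewrite subr_eq0 => /eqP.
rewrite -[RHS](cintegral0 mu `[0, 2 * pi]%classic); apply: eq_cintegral => t _.
rewrite gr ?conjc0 ?mulr0// => h.
have : rho (circle_param c (r + 1) t) <= r ^+ 2 by [].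
rewrite sqdist_circle => {}h; have : r ^+ 2 < (r + 1) ^+ 2 by nra.
by rewrite ltNge h.
Qed.

Lemma Pi_cutoff j f n : csmooth f -> Pi j (fun x => (cutoff c n x)%:C * f x) = fun x =>
  (cutoff c n x)%:C * Pi j f x - 'i%C * (dcutoff c n j x)%:C * f x.
Proof. by move=> fs; apply: PiM => // x; exact: is_derive_cutoff. Qed.

Lemma ccvg_realM (w : nat -> R) (l : R) (z : C) : w n @[n --> \oo] --> l ->
  ccvg (fun n => (w n)%:C * z) (l%:C * z).
Proof.
move=> wl; split; first by rewrite Re_cM; under eq_fun do rewrite Re_cM; exact: cvgMl.
by rewrite Im_cM; under eq_fun do rewrite Im_cM; exact: cvgMl.
Qed.

Lemma cutoff_ccvg f x : ccvg (fun n => (cutoff c n x)%:C * f x) (f x).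
Proof. by have := ccvg_realM (f x) (@cutoff_cvg R c x); rewrite mul1r. Qed.

Lemma cutoff_abs2_le n x (z : C) : abs2 ((cutoff c n x)%:C * z) <= abs2 z.
Proof.
rewrite abs2M abs2c ler_piMl ?abs2_ge0//.
by have /andP[h0 h1] := cutoff_le1 c n x; rewrite expr_le1.
Qed.

Lemma Pi_cutoff_ccvg j f x : csmooth f ->
  ccvg (fun n => Pi j (fun y => (cutoff c n y)%:C * f y) x) (Pi j f x).
Proof.
move=> fs; under eq_fun do rewrite Pi_cutoff//.
have := ccvgB (cutoff_ccvg (Pi j f) x)
  (ccvgZ 'i%C (ccvg_realM (f x) (@dcutoff_cvg R c j x))).
rewrite mul0r mulr0 subr0; congr ccvg; apply/funext => n.
by rewrite mulrA.
Qed.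

Lemma Pi_cutoff_abs2_le j f n x : csmooth f ->
  abs2 (Pi j (fun y => (cutoff c n y)%:C * f y) x) <=
  2 * abs2 (Pi j f x) + 32 * ((1 + rho x) * abs2 (f x)).
Proof.
move=> fs; rewrite Pi_cutoff//.
have := abs2D ((cutoff c n x)%:C * Pi j f x) (- ('i%C * (dcutoff c n j x)%:C * f x)).
rewrite abs2N !abs2M (_ : abs2 'i%C = 1); last by rewrite /abs2 /= expr0n expr1n add0r.
rewrite mul1r -abs2M !abs2c.
have h1 := cutoff_abs2_le n x (Pi j f x).
have h2 := ler_wpM2r (abs2_ge0 (f x)) (dcutoff_sq_le c n j x).
have h3 := abs2_ge0 (f x).
have h4 : 16 * rho x * abs2 (f x) <= 16 * ((1 + rho x) * abs2 (f x)) by lra.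
lra.
Qed.

Lemma Pi_cutoff_dom j f : gs f ->
  intg mu2 (fun x => 2 * abs2 (Pi j f x) + 32 * ((1 + rho x) * abs2 (f x))).
Proof.
move=> gf; have Lp := gs_L2 b0 (gs_Pi j gf).
exact: (intgD (intgZl 2 (L2_abs2_intg Lp)) (intgZl 32 (gs_int b0 gf))).
Qed.

(** Weak gradients are tested with compactly supported functions only; the
    cut-offs extend them to Gaussian states. *)
Lemma weak_gs u p f j : magnetic_gradient b u p -> gs f ->
  L2inner (p j) f = L2inner u (Pi j f).
Proof.
move=> [Lu /(_ j)[Lp H]] gf; have fs := gs_csmooth gf.
have ct n := cutoff_test c n fs; have Lf := gs_L2 b0 gf.
have l1 : ccvg (fun n => L2inner (p j) (fun x => (cutoff c n x)%:C * f x)) (L2inner (p j) f).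
  apply: (inner_dct Lp) (L2_abs2_intg Lf) _ => [n|x|n x].
  - exact: (test_L2 (ct n)).1.
  - exact: cutoff_ccvg.
  - exact: cutoff_abs2_le.
have l2 : ccvg (fun n => L2inner u (Pi j (fun x => (cutoff c n x)%:C * f x)))
    (L2inner u (Pi j f)).
  apply: (inner_dct Lu) (Pi_cutoff_dom j gf) _ => [n|x|n x].
  - exact: (test_Pi_L2 j (ct n)).1.
  - exact: Pi_cutoff_ccvg.
  - exact: Pi_cutoff_abs2_le.
apply: (ccvg_unique l1); move: l2; congr ccvg; apply/funext => n.
by rewrite H.
Qed.

Lemma sum_two (F : 'I_2 -> C) : \sum_(j < 2) F j = F ord0 + F (lift ord0 ord0).
Proof. by rewrite 2!big_ord_recl big_ord0 addr0. Qed.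

Lemma weak_gs_form u p f : magnetic_gradient b u p -> gs f ->
  \sum_(j < 2) L2inner (p j) (Pi j f) = L2inner u (magH b f).
Proof.
move=> up gf; rewrite (eq_bigr (fun j => L2inner u (Pi j (Pi j f)))); last first.
  by move=> j _; apply: weak_gs => //; exact: gs_Pi.
have L j : L2 (Pi j (Pi j f)) := gs_L2 b0 (gs_Pi j (gs_Pi j gf)).
rewrite sum_two -(innerDr (L _) (L _) up.1); congr L2inner.
by apply/funext => x; rewrite /magH sum_two.
Qed.

(** A weak gradient is determined by its inner products with the complete
    family of Gaussian states. *)
Lemma weak_unique u p p' j : magnetic_gradient b u p -> magnetic_gradient b u p' ->
  {ae mu2, forall x, p j x = p' j x}.
Proof.
move=> up up'; have [Lp _] := up.2 j; have [Lp' _] := up'.2 j.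
have : {ae mu2, forall x, p j x - p' j x = 0}.
  apply: (@gE_complete R b c b0 _ (L2B Lp Lp')) => a k.
  have gg := gs_gE b c a k; rewrite (innerBl Lp Lp' (gs_L2 b0 gg)).
  by rewrite (weak_gs j up gg) (weak_gs j up' gg) subrr.
by apply: ae_mono => x /eqP; rewrite subr_eq0 => /eqP.
Qed.

Lemma gs_gradient f : gs f -> magnetic_gradient b f (fun j => Pi j f).
Proof.
move=> gf; have Lf := gs_L2 b0 gf; split=> // j.
have Lp := gs_L2 b0 (gs_Pi j gf); split=> // phi ht.
exact: (plane_ibp (gs_csmooth gf) Lf Lp ht).
Qed.

(** Cutting a function along a circle on which it vanishes does not create
    a jump in the weak gradient. *)
Lemma cut_gradient r f : 0 < r -> gs f -> (forall t, f (circle_param c r t) = 0) ->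
  magnetic_gradient b (disc_cut r f) (fun j => disc_cut r (Pi j f)).
Proof.
move=> r0 gf f0; have Lf := gs_L2 b0 gf; split; first exact: cut_L2.
move=> j; have Lp := gs_L2 b0 (gs_Pi j gf); split=> [|phi ht]; first exact: cut_L2.
have := disc_green r0 (test_csmooth ht) (gs_csmooth gf) (test_L2 ht) Lf (test_Pi_L2 j ht) Lp.
rewrite (_ : cintegral _ _ _ = 0) ?mulr0; last first.
  rewrite -[RHS](cintegral0 mu `[0, 2 * pi]%classic); apply: eq_cintegral => t _.
  by rewrite f0 conjc0 !mulr0.
move/eqP; rewrite subr_eq0 => /eqP E.
have Lphi := test_L2 ht; have Lpphi := test_Pi_L2 j ht.
by rewrite (innerJ Lphi (cut_L2 r Lp)) (innerJ Lpphi (cut_L2 r Lf)) E.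
Qed.

End green.

(** * Eigenfunctions of the Landau Hamiltonian *)

Section eigenfunctions.
Context {R : realType}.
Variables (b : R) (c : R * R).
Hypothesis b0 : 0 < b.
Notation C := R[i].
Notation mu2 := (lebesgue2 R).
Notation Pi := (Pi_classical b).
Notation gs := (gauss_span b c).
Notation gE := (gauss_state b c).
Notation eig q := (landau_eigenspace b q).
Notation moment u a k := (L2inner u (gE a k)).
Implicit Types (f g u v : R * R -> C) (p : 'I_2 -> R * R -> C).

Lemma conjc_nat (n : nat) : (n%:R : C)^*%C = n%:R.
Proof. exact: (rmorph_nat conjc). Qed.

Lemma eigen_weak q u : eig q u -> exists2 p, magnetic_gradient b u p &
  forall v p', magnetic_gradient b v p' ->
    \sum_(j < 2) L2inner (p j) (p' j) = (landau_level b q)%:C * L2inner u v.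
Proof.
move=> [_ [p up H]]; exists p => // v p' vp'; rewrite (H v p' vp').
by rewrite innerZl//; [exact: up.1|exact: vp'.1].
Qed.

Lemma eigen_L2 q u : eig q u -> L2 u.
Proof. by move=> /eigen_weak[p [Lu _] _]. Qed.

Lemma eigen_gs q u f : eig q u -> gs f ->
  L2inner u (magH b f) = (landau_level b q)%:C * L2inner u f.
Proof.
move=> /eigen_weak[p up H] gf.
by rewrite -(H _ _ (gs_gradient b0 gf)) -(weak_gs_form b0 up gf).
Qed.

(** The eigenvalue equation tested against the triangular action of the
    Hamiltonian on Gaussian states. *)
Lemma eigen_moment q u a k : eig q u ->
  (2 * b)%:C * (k%:R - q%:R) * moment u a k = (4 * a%:R * k%:R) * moment u a.-1 k.-1.
Proof.
move=> eu; have Lu := eigen_L2 eu.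
have Lg a' k' : L2 (gE a' k') := gs_L2 b0 (gs_gE b c a' k').
have := eigen_gs eu (gs_gE b c a k).
rewrite magH_gE (innerBr (L2Z _ (Lg _ _)) (L2Z _ (Lg _ _)) Lu).
rewrite !innerZr// => E.
have -> : (2 * b)%:C * (k%:R - q%:R) = ((b * (2 * k%:R + 1))%:C)^*%C - (landau_level b q)%:C :> C.
  have nC (n : nat) : (n%:R : C) = (n%:R : R)%:C by rewrite (rmorph_nat (real_complex R)).
  by rewrite !nC /landau_level; apply: complex_ext; rewrite !reim /=; ring.
rewrite mulrBl -E; set A := _^*%C; set B := (_ * _)^*%C.
have -> : B = 4 * a%:R * k%:R 
  by rewrite /B 2!(rmorphM conjc); congr (_ * _ * _); exact: conjc_nat.
ring.
Qed.

Lemma level_neq0 q k : k != q -> (2 * b)%:C * (k%:R - q%:R) != 0 :> C.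
Proof.
move=> kq; rewrite mulf_neq0//.
  by rewrite eq_complex /= eqxx andbT mulf_neq0 ?gt_eqF.
by rewrite subr_eq0 eqr_nat.
Qed.

Lemma eigen_moment_step q u a k : eig q u -> k != q ->
  ((0 < a)%N -> (0 < k)%N -> moment u a.-1 k.-1 = 0) -> moment u a k = 0.
Proof.
move=> eu kq H; have := eigen_moment a k eu.
rewrite [RHS](_ : _ = 0).
  by move/eqP; rewrite mulf_eq0 (negPf (level_neq0 kq)) => /eqP.
case: a k H {kq} => [|a] [|k] H; rewrite ?mulr0 ?mul0r ?mulr0 ?mul0r//.
by rewrite H// mulr0.
Qed.

(** The recursion lowers a and k together: it ends at k = q, or at a right-hand
    side that vanishes because a = 0 or k = 0. *)
Lemma eigen_moment_all q u (P : nat -> nat -> Prop) : eig q u ->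
  (forall a k, P a.+1 k.+1 -> P a k) ->
  (forall a, P a q -> moment u a q = 0) ->
  forall a k, P a k -> moment u a k = 0.
Proof.
move=> eu Pdown Pq a k; elim: k a => [|k IH] a Pak.
  have [q0|q0] := eqVneq 0%N q; first by rewrite q0; apply: Pq; rewrite -q0.
  exact: (eigen_moment_step eu).
have [kq|kq] := eqVneq k.+1 q; first by rewrite kq; apply: Pq; rewrite -kq.
apply: (eigen_moment_step eu) => //= a0 _; apply: IH; apply: Pdown.
by rewrite prednK.
Qed.

Lemma eigen_moment_sector q u n a k : eig q u -> moment u n q = 0 ->
  (a + q = n + k)%N -> moment u a k = 0.
Proof.
move=> eu u0; apply: (eigen_moment_all (P := fun a k => (a + q = n + k)%N) eu).
  by move=> a' k'; rewrite addSn addnS => -[].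
by move=> a' /addIn ->.
Qed.

Lemma eigen_zero q u : eig q u -> (forall n, moment u n q = 0) ->
  {ae mu2, forall x, u x = 0}.
Proof.
move=> eu u0; apply: (@gE_complete R b c b0 _ (eigen_L2 eu)) => a k.
exact: (eigen_moment_all (P := fun _ _ => True) eu).
Qed.

Lemma gs_sum m (k : nat -> C) (f : nat -> R * R -> C) : (forall i, gs (f i)) ->
  gs (fun x => \sum_(i < m) k i * f i x) /\
  magH b (fun x => \sum_(i < m) k i * f i x) = fun x => \sum_(i < m) k i * magH b (f i) x.
Proof.
move=> gf; elim: m => [|m [IH1 IH2]].
  have E : (fun x => \sum_(i < 0) k i * f i x) = (fun x => 0 * f 0%N x).
    by apply/funext => x; rewrite big_ord0 mul0r.
  rewrite E; split; first exact: gsZ.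
  by rewrite (magHZ _ (gf 0%N)); apply/funext => x; rewrite mul0r big_ord0.
have E : (fun x => \sum_(i < m.+1) k i * f i x) =
    (fun x => \sum_(i < m) k i * f i x + k m * f m x).
  by apply/funext => x; rewrite big_ord_recr.
have gk := gsZ (k m) (gf m).
rewrite E; split; first exact: gsD.
rewrite (magHD IH1 gk) IH2 (magHZ _ (gf m)).
by apply/funext => x; rewrite big_ord_recr.
Qed.

(** The coefficients that solve the two-term recursion ecoefS.  They vanish for
    i > n, so that the truncated difference n - i never matters. *)
Definition ecoef (q n i : nat) : R := ('C(q, i) * n ^_ i)%:R * (- (2 / b)) ^+ i.

(** The eigenfunction of level q and angular momentum n - q about c. *)
Definition eigenstate (q n : nat) (x : R * R) : C :=
  \sum_(i < q.+1) (ecoef q n i)%:C * gE (n - i) (q - i) x.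

Lemma ecoefS q n i : (i < q)%N ->
  - (2 * b) * i.+1%:R * ecoef q n i.+1 = 4 * (n - i)%:R * (q - i)%:R * ecoef q n i.
Proof.
move=> iq; rewrite /ecoef exprS.
rewrite [in LHS]natrM [in RHS]natrM ffactnSr natrM.
have H : i.+1%:R * 'C(q, i.+1)%:R = (q - i)%:R * 'C(q, i)%:R :> R.
  by rewrite -!natrM mul_bin_left.
have -> : - (2 * b) * i.+1%:R * ('C(q, i.+1)%:R * ((n ^_ i)%:R * (n - i)%:R) *
    (- (2 / b) * (- (2 / b)) ^+ i)) = - (2 * b) * - (2 / b) *
    (i.+1%:R * 'C(q, i.+1)%:R) * ((n ^_ i)%:R * (n - i)%:R) * (- (2 / b)) ^+ i by ring.
rewrite H (_ : - (2 * b) * - (2 / b) = 4); first by ring.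
by field; rewrite gt_eqF.
Qed.

Lemma gs_estate q n : gs (eigenstate q n).
Proof.
exact: (@gs_sum q.+1 (fun i => (ecoef q n i)%:C) (fun i => gE (n - i) (q - i))
  (fun i => gs_gE b c _ _)).1.
Qed.

(** The lower order term of each summand is the defect of the next one. *)
Lemma magH_estate q n : magH b (eigenstate q n) =
  fun x => (landau_level b q)%:C * eigenstate q n x.
Proof.
have := (@gs_sum q.+1 (fun i => (ecoef q n i)%:C) (fun i => gE (n - i) (q - i))
  (fun i => gs_gE b c _ _)).2.
rewrite -/(eigenstate q n) => ->; apply/funext => x; apply/eqP; rewrite -subr_eq0.
rewrite mulr_sumr -sumrB.
pose S i : C := (- (2 * b) * i%:R * ecoef q n i)%:C * gE (n - i) (q - i) x.
rewrite (eq_bigr (fun i : 'I_q.+1 => S i - S i.+1)).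
  rewrite -(big_mkord xpredT (fun i => S i - S i.+1)).
  under eq_bigr do rewrite -opprB.
  rewrite sumrN telescope_sumr// /S /ecoef bin_small// mul0n mul0r !mulr0 !mul0r.
  by rewrite subrr oppr0.
move=> [i iq] _ /=; rewrite magH_gE.
have -> : S i.+1 = (4 * (n - i)%:R * (q - i)%:R * ecoef q n i)%:C * gE (n - i).-1 (q - i).-1 x.
  rewrite /S !subnS; move: iq; rewrite ltnS leq_eqVlt => /predU1P[->|iq].
    by rewrite subnn mulr0 mul0r /ecoef bin_small// mul0n mul0r mulr0 !mul0r.
  by rewrite ecoefS.
rewrite /S; have iq' : (i <= q)%N by rewrite -ltnS.
move: (gE _ _ x) (gE _ _ x) (ecoef q n i) => G G' s.
have nC (m : nat) : (m%:R : C) = (m%:R : R)%:C by rewrite (rmorph_nat (real_complex R)).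
have -> : (- (2 * b) * i%:R * s)%:C =
    s%:C * ((b * (2 * (q - i)%:R + 1))%:C - (landau_level b q)%:C).
  rewrite /landau_level natrB//; apply: complex_ext; rewrite !reim; ring.
have -> : (4 * (n - i)%:R * (q - i)%:R * s)%:C = s%:C * (4 * (n - i)%:R * (q - i)%:R).
  by rewrite !nC; apply: complex_ext; rewrite !reim; ring.
ring.
Qed.

Lemma estate_eigen q n : eig q (eigenstate q n).
Proof.
have ge := gs_estate q n; have Le := gs_L2 b0 ge; split; first exact: L2Z.
exists (fun j => Pi j (eigenstate q n)); first exact: (gs_gradient b0 ge).
move=> v p vp; have := weak_gs_form b0 vp ge; rewrite magH_estate innerZr//; last exact: vp.1.
move=> E; rewrite (innerZl _ Le vp.1) (innerJ vp.1 Le).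
transitivity ((\sum_(j < 2) L2inner (p j) (Pi j (eigenstate q n)))^*%C).
  rewrite (rmorph_sum conjc); apply: eq_bigr => j _.
  exact: (innerJ (vp.2 j).1 (gs_L2 b0 (gs_Pi j ge))).
by rewrite E (rmorphM conjc); congr (_ * _); exact: conjcK.
Qed.

Lemma eigenD q u v : eig q u -> eig q v -> eig q (fun x => u x + v x).
Proof.
move=> [Lu [p up Hu]] [Lv [p' vp Hv]].
have Lu0 := up.1; have Lv0 := vp.1.
split; first by apply: L2Z; exact: L2D.
exists (fun j x => p j x + p' j x).
  split=> [|j]; first exact: L2D.
  have [Lp Hp] := up.2 j; have [Lp' Hp'] := vp.2 j; split=> [|phi ht]; first exact: L2D.
  have Lt := test_L2 (0, 0) ht; have Lpt := test_Pi_L2 b (0, 0) j ht.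
  by rewrite !innerDl// Hp// Hp'.
move=> w s ws; rewrite (eq_bigr (fun j => L2inner (p j) (s j) + L2inner (p' j) (s j))).
  rewrite big_split /= (Hu _ _ ws) (Hv _ _ ws) -(innerDl Lu Lv ws.1).
  by congr (L2inner _ w); apply/funext => x; rewrite mulrDr.
by move=> j _; rewrite (innerDl (up.2 j).1 (vp.2 j).1 (ws.2 j).1).
Qed.

Lemma eigenZ q (k : C) u : eig q u -> eig q (fun x => k * u x).
Proof.
move=> [Lu [p up Hu]]; have Lu0 := up.1; split; first by do 2 apply: L2Z.
exists (fun j x => k * p j x).
  split=> [|j]; first exact: L2Z.
  have [Lp Hp] := up.2 j; split=> [|phi ht]; first exact: L2Z.
  have Lt := test_L2 (0, 0) ht; have Lpt := test_Pi_L2 b (0, 0) j ht.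
  by rewrite !innerZl// Hp.
move=> w s ws; rewrite (eq_bigr (fun j => k * L2inner (p j) (s j))).
  rewrite -mulr_sumr (Hu _ _ ws) -(innerZl k Lu ws.1).
  by congr (L2inner _ w); apply/funext => x; rewrite mulrCA.
by move=> j _; rewrite (innerZl k (up.2 j).1 (ws.2 j).1).
Qed.

End eigenfunctions.

(** * Square-integrable functions on a circle *)

Section circle.
Context {R : realType}.
Variables (c : R * R) (r : R).
Hypothesis r0 : 0 < r.
Notation C := R[i].
Notation mu := (@lebesgue_measure R).
Notation circ := `[0, 2 * pi]%classic.
Notation cp := (circle_param c r).
Implicit Types (f g h : R * R -> C).
Notation csq f := (mu.-integrable circ (EFin \o (fun t => abs2 (f (cp t))))).

Lemma circle_continuous (F : R * R -> R) : continuous F -> continuous (fun t => F (cp t)).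
Proof.
move=> cF; apply: continuous_comp2 => // t; apply: cvgD; (try exact: cvg_cst);
  apply: cvgMr; [exact: continuous_cos|exact: continuous_sin].
Qed.

Lemma circle_cmeasurable f : csmooth f -> cmeasurable circ (fun t => f (cp t)).
Proof.
move=> /csmooth_continuous[c1 c2].
by split; apply: measurable_funTS; [exact: (continuous_measurable_fun (circle_continuous c1))|exact: (continuous_measurable_fun (circle_continuous c2))].
Qed.

Lemma circle_csq f : csmooth f -> csq f.
Proof.
move=> /csmooth_continuous[c1 c2].
apply: continuous_intg_itv; rewrite /abs2.
move=> t; apply: cvgD; apply: cvgM; by [exact: (circle_continuous c1)|exact: (circle_continuous c2)].
Qed.

Lemma circle_cintegrable (k : R -> R) f : continuous k -> csmooth f ->
  cintegrable mu circ (fun t => (k t)%:C * f (cp t)).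
Proof.
move=> ck /csmooth_continuous[c1 c2]; split.
  have h : continuous (fun t => k t * Rep (f (cp t))).
    by move=> t; apply: cvgM; [exact: ck|exact: (circle_continuous c1)].
  have := continuous_intg_itv 0 (2 * pi) h; congr (integrable _ _ _).
  by apply/funext => t; rewrite /comp Re_cM.
have h : continuous (fun t => k t * Imp (f (cp t))).
  by move=> t; apply: cvgM; [exact: ck|exact: (circle_continuous c2)].
have := continuous_intg_itv 0 (2 * pi) h; congr (integrable _ _ _).
by apply/funext => t; rewrite /comp Im_cM.
Qed.

(** The double integral in the H^{1/2} norm is nonnegative. *)
Lemma H12_ge f : (circle_integral c r (fun x => (abs2 (f x))%:E) <= H12normsq c r f)%E.
Proof.
have r0' : (0 <= r%:E)%E by rewrite lee_fin ltW.
rewrite /H12normsq leeDl//; apply: integral_ge0 => t _; apply: mule_ge0 => //.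
apply: integral_ge0 => s _; apply: mule_ge0 => //.
by rewrite lee_fin divr_ge0 ?abs2_ge0// addr_ge0// sqr_ge0.
Qed.

Lemma circle_integral_abs2 f : cmeasurable circ (fun t => f (cp t)) ->
  circle_integral c r (fun x => (abs2 (f x))%:E) =
  (r%:E * \int[mu]_(t in circ) (abs2 (f (cp t)))%:E)%E.
Proof.
move=> [m1 m2]; rewrite -ge0_integralZl//.
- by apply/measurable_EFinP; apply: measurable_funD; exact: measurable_funX.
- by move=> t _; rewrite lee_fin abs2_ge0.
- by rewrite lee_fin ltW.
Qed.

Lemma H12_csq f : H12 c r f -> csq f.
Proof.
move=> [mf Hf]; have mf' := mf; have [m1 m2] := mf; apply/integrableP; split.
  by apply/measurable_EFinP; apply: measurable_funD; exact: measurable_funX.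
have := le_lt_trans (H12_ge f) Hf; rewrite circle_integral_abs2//.
under [X in _ -> (X < _)%E]eq_integral do rewrite /= ger0_norm ?abs2_ge0//.
set I := integral _ _ _ => rI; rewrite ltNge leye_eq; apply/negP => /eqP I_y.
by move: rI; rewrite I_y gt0_muley ?lte_fin// ltxx.
Qed.

Lemma circle_innerE f h : circle_inner c r f h =
  cintegral mu circ (fun t => f (cp t) * (r%:C * h (cp t))^*%C).
Proof.
by apply: eq_cintegral => t _; rewrite conjcMr mulrCA.
Qed.

Lemma cmeasurableB_in f g : cmeasurable circ (fun t => f (cp t)) ->
  cmeasurable circ (fun t => g (cp t)) -> cmeasurable circ (fun t => f (cp t) - g (cp t)).
Proof.
move=> [f1 f2] [g1 g2]; split.
  have := measurable_funB f1 g1; congr measurable_fun; apply/funext => t.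
  by rewrite [RHS]ReD ReN.
have := measurable_funB f2 g2; congr measurable_fun; apply/funext => t.
by rewrite [RHS]ImD ImN.
Qed.

Lemma circle_csqB f g : cmeasurable circ (fun t => f (cp t)) ->
  cmeasurable circ (fun t => g (cp t)) -> csq f -> csq g -> csq (fun x => f x - g x).
Proof.
move=> mf mg sf sg; have [h1 h2] := cmeasurableB_in mf mg.
have mc : measurable (circ : set (measurableTypeR R)) by exact: measurable_itv.
have := integrableD mc (integrableZl mc 2 sf) (integrableZl mc 2 sg).
apply: le_integrable => //.
  apply/measurable_EFinP.
  by apply: measurable_funD; apply: measurable_funX; [exact: h1|exact: h2].
move=> t _; rewrite /= lee_fin ger0_norm ?abs2_ge0//; apply: le_trans (ler_norm _).
by have := abs2D (f (cp t)) (- g (cp t)); rewrite abs2N.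
Qed.

Lemma circle_integral_csq f : cmeasurable circ (fun t => f (cp t)) -> csq f ->
  circle_integral c r (fun x => (abs2 (f x))%:E) =
  (r * \int[mu]_(t in circ) abs2 (f (cp t)))%:E.
Proof.
move=> mf sf; rewrite circle_integral_abs2// EFinM; congr (_ * _)%E.
by rewrite /Rintegral fineK//; apply: integrable_fin_num.
Qed.

Lemma circle_inner_cvg (fn : nat -> R * R -> C) g h : csmooth h ->
  (forall n, csmooth (fn n)) -> H12 c r g ->
  H12normsq c r (fun x => fn n x - g x) @[n --> \oo] --> 0%E ->
  ccvg (fun n => circle_inner c r (fn n) h) (circle_inner c r g h).
Proof.
move=> hs fs Hg cv; have sg := H12_csq Hg; have mg := Hg.1.
have mf n := circle_cmeasurable (fs n); have sf n := circle_csq (fs n).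
have sw n := circle_csqB (mf n) mg (sf n) sg.
have mw n := cmeasurableB_in (mf n) mg.
have hs' : csmooth (fun x => r%:C * h x) := csmoothM (csmooth_cst _) hs.
have mh := circle_cmeasurable hs'; have sh := circle_csq hs'.
pose e n := \int[mu]_(t in circ) abs2 (fn n (cp t) - g (cp t)).
have e0 : e n @[n --> \oo] --> 0.
  have H : (r * e n)%:E @[n --> \oo] --> 0%E.
    apply: (squeeze_cvge _ (cvg_cst 0%E) cv).
    near=> n; apply/andP; split.
      rewrite lee_fin mulr_ge0 ?(ltW r0)//.
      by apply: Rintegral_ge0 => t _; exact: abs2_ge0.
    rewrite (_ : (r * e n)%:E = circle_integral c r (fun x => (abs2 (fn n x - g x))%:E)).
      exact: H12_ge.
    exact: esym (@circle_integral_csq (fun x => fn n x - g x) (mw n) (sw n)).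
  have {}H : r * e n @[n --> \oo] --> (0 : R) by exact: (fine_cvg H).
  have -> : e = fun n => r^-1 * (r * e n) by apply/funext => n; rewrite mulKf ?gt_eqF.
  by rewrite -(mulr0 r^-1); apply: cvgMr.
have H := @pairing_cvg0 _ _ _ mu circ (measurable_itv _)
  (fun n t => fn n (cp t) - g (cp t)) (fun t => r%:C * h (cp t)) mw mh sw sh e0.
rewrite -[X in ccvg _ X]add0r.
have E n : circle_inner c r (fn n) h =
    cintegral mu circ (fun t => (fn n (cp t) - g (cp t)) * (r%:C * h (cp t))^*%C) +
    circle_inner c r g h.
  rewrite !circle_innerE -cintegralD//; last 2 first.
  - exact: (@sq_cintegrable _ _ _ mu circ (measurable_itv _) (fun t => fn n (cp t) - g (cp t)) (fun t => r%:C * h (cp t)) (mw n) mh (sw n) sh).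
  - exact: (@sq_cintegrable _ _ _ mu circ (measurable_itv _) (fun t => g (cp t)) (fun t => r%:C * h (cp t)) mg mh sg sh).
  by apply: eq_cintegral => t _; ring.
under eq_fun do rewrite E.
by apply: ccvgD => //; exact: ccvg_cst.
Unshelve. all: by end_near. Qed.

Lemma circle_inner_null g h : csmooth h -> H12 c r g -> circle_inner c r g g = 0 ->
  circle_inner c r g h = 0.
Proof.
move=> hs Hg g0; have sg := H12_csq Hg; have mg := Hg.1.
have hs' : csmooth (fun x => r%:C * h x) := csmoothM (csmooth_cst _) hs.
have mh := circle_cmeasurable hs'; have sh := circle_csq hs'.
have e0 : \int[mu]_(t in circ) abs2 (g (cp t)) = 0.
  have : r * \int[mu]_(t in circ) abs2 (g (cp t)) = 0.
    rewrite -RintegralZl//; transitivity (Rep (circle_inner c r g g)); last by rewrite g0.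
    rewrite /circle_inner /cintegral; cbn [Rep]; apply: eq_Rintegral => t _.
    by rewrite -abs2E Re_cM.
  by move/eqP; rewrite mulf_eq0 gt_eqF//= => /eqP.
have H := @pairing_cvg0 _ _ _ mu circ (measurable_itv _) (fun _ t => g (cp t)) _
  (fun=> mg) mh (fun=> sg) sh.
rewrite circle_innerE; apply: (ccvg_unique (ccvg_cst _) (H _)).
by rewrite e0; exact: cvg_cst.
Qed.

End circle.

(** * Green's formula for eigenfunctions and their traces *)

Section trace_formula.
Context {R : realType}.
Variables (b : R) (c : R * R) (r : R).
Hypotheses (b0 : 0 < b) (r0 : 0 < r).
Variables (q n : nat).
Notation C := R[i].
Notation mu := (@lebesgue_measure R).
Notation circ := `[0, 2 * pi]%classic.
Notation cp := (circle_param c r).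
Notation Pi := (Pi_classical b).
Notation gs := (gauss_span b c).
Notation gE := (gauss_state b c).
Notation rho := (sqdist c).
Notation eig q := (landau_eigenspace b q).
Notation cut := (disc_cut c r).
Notation L := ((landau_level b q)%:C : C).
Notation estate := (eigenstate b c).
Implicit Types (f g u v : R * R -> C) (p : 'I_2 -> R * R -> C).

Lemma inner_cutD u f g : L2 u -> L2 f -> L2 g ->
  L2inner u (cut (fun x => f x + g x)) = L2inner u (cut f) + L2inner u (cut g).
Proof.
move=> Lu Lf Lg; rewrite -(innerDr (cut_L2 c r Lf) (cut_L2 c r Lg) Lu).
by congr L2inner; apply/funext => x; rewrite /disc_cut mulrDr.
Qed.

Lemma inner_cutZ u f (k : C) : L2 u -> L2 f ->
  L2inner u (cut (fun x => k * f x)) = k^*%C * L2inner u (cut f).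
Proof.
move=> Lu Lf; rewrite -(innerZr k (cut_L2 c r Lf) Lu).
by congr L2inner; apply/funext => x; rewrite /disc_cut mulrCA.
Qed.

(** A Gaussian state of the sector n - q that vanishes on the circle. *)
Definition psi x : C := (r ^+ 2)%:C * gE n q x + (-1) * gE n.+1 q.+1 x.

Lemma gs_psi : gs psi.
Proof. by apply: gsD; apply: gsZ; exact: gs_gE. Qed.

Lemma psiE : psi = fun x => (r ^+ 2 - rho x)%:C * gE n q x.
Proof.
apply/funext => x; rewrite /psi -(addn1 n) -(addn1 q) gE_shift expr1.
by move: (gE n q x) => G; apply: complex_ext; rewrite !reim; ring.
Qed.

Lemma psi_circle t : psi (cp t) = 0.
Proof. by rewrite psiE sqdist_circle subrr mul0r. Qed.

Lemma Pi_psi_circle j t :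
  Pi j psi (cp t) = 'i%C * (2 * r * normal_dir j t)%:C * gE n q (cp t).
Proof.
have d x : is_derive x (basis_vec j) (fun x => r ^+ 2 - rho x) (- (2 * coord c j x)).
  have := is_deriveB (is_derive_cst (r ^+ 2 : R) x (basis_vec j)) (is_derive_sqdist c j x).
  by apply: is_derive_ext => //; rewrite sub0r.
rewrite psiE (PiM b (csmooth_gE b c n q) d) sqdist_circle subrr mul0r sub0r.
have -> : (- (2 * coord c j (cp t)))%:C = - (2 * r * normal_dir j t)%:C :> C.
  rewrite /coord /normal_dir; apply: complex_ext; rewrite !reim ?oppr0//.
  by case: (j == ord0) => /=; ring.
ring.
Qed.

(** On the circle, the momenta of psi are the components of the normal vector
    times one Gaussian state, so that the boundary terms add up to a multiple of
    the pairing on the circle. *)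
Lemma green_psi f : csmooth f -> L2 f -> (forall j, L2 (Pi j f)) ->
  \sum_(j < 2) L2inner (Pi j f) (cut (Pi j psi)) - L2inner f (cut (magH b psi)) =
  - (2 * r)%:C * circle_inner c r f (gE n q).
Proof.
move=> fs Lf Lpf.
have gp j := gs_Pi j gs_psi; have Lp j := gs_L2 b0 (gp j).
have Lpp j := gs_L2 b0 (gs_Pi j (gp j)).
have magE : magH b psi = fun x => Pi ord0 (Pi ord0 psi) x +
    Pi (lift ord0 ord0) (Pi (lift ord0 ord0) psi) x.
  by apply/funext => x; rewrite /magH sum_two.
rewrite magE (inner_cutD Lf (Lpp _) (Lpp _)).
have G j := disc_green c r0 fs (gs_csmooth (gp j)) Lf (Lp j) (Lpf j) (Lpp j).
pose F x := f x * (gE n q x)^*%C.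
have Fs : csmooth F by apply: csmoothM => //; apply: csmoothJ; exact: csmooth_gE.
have cn j : continuous (fun t : R => r * normal_dir j t ^+ 2).
  move=> t; apply: cvgMr; rewrite /normal_dir; case: (j == ord0).
    by apply: cvgM; exact: continuous_cos.
  by apply: cvgM; exact: continuous_sin.
have IE j : - 'i%C * cintegral mu circ (fun t => (r * normal_dir j t)%:C *
    (f (cp t) * (Pi j psi (cp t))^*%C)) =
    - (2 * r)%:C * cintegral mu circ (fun t => (r * normal_dir j t ^+ 2)%:C * F (cp t)).
  have ii : ('i%C : C) * 'i%C = -1 by rewrite -expr2 sqr_i.
  have -> : - (2 * r)%:C = - 'i%C * (- 'i%C * (2 * r)%:C) :> C.
    by rewrite mulrA mulrNN ii mulN1r.
  rewrite -[RHS]mulrA; congr (_ * _).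
  rewrite -cintegralZ//; last exact: circle_cintegrable.
  apply: eq_cintegral => t _; rewrite Pi_psi_circle /F.
  have -> : ('i%C * (2 * r * normal_dir j t)%:C * gE n q (cp t))^*%C =
      - 'i%C * (2 * r * normal_dir j t)%:C * (gE n q (cp t))^*%C.
    by case: (gE n q (cp t)) => x y; apply: complex_ext; rewrite /=; ring.
  rewrite !realcM; ring.
rewrite sum_two; set j0 := ord0; set j1 := lift _ _.
have -> (x y z w : C) : x + y - (z + w) = (x - z) + (y - w) by ring.
transitivity (- (2 * r)%:C * cintegral mu circ (fun t => (r * normal_dir j0 t ^+ 2)%:C * F (cp t)) +
    - (2 * r)%:C * cintegral mu circ (fun t => (r * normal_dir j1 t ^+ 2)%:C * F (cp t))).
  by congr (_ + _); [exact: etrans (G j0) (IE j0)|exact: etrans (G j1) (IE j1)].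
rewrite -mulrDr; congr (_ * _).
rewrite -cintegralD//; [|exact: circle_cintegrable..].
apply: eq_cintegral => t _; rewrite /F -mulrDl; congr (_ * _).
rewrite -[in RHS](mulr1 r) -(cos2Dsin2 t) /normal_dir /=.
by apply: complex_ext; rewrite !reim; ring.
Qed.

(** The defect of psi as an eigenfunction of level q. *)
Definition theta x : C := L * psi x + (-1) * magH b psi x.

Lemma gs_mag f : gs f -> gs (magH b f).
Proof.
move=> gf; have -> : magH b f = fun x => Pi ord0 (Pi ord0 f) x +
    Pi (lift ord0 ord0) (Pi (lift ord0 ord0) f) x.
  by apply/funext => x; rewrite /magH sum_two.
by apply: gsD; do 2 apply: gs_Pi.
Qed.

Lemma inner_theta u : L2 u -> L2inner u (cut theta) =
  L * L2inner u (cut psi) - L2inner u (cut (magH b psi)).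
Proof.
move=> Lu; have Lpsi := gs_L2 b0 gs_psi; have Lm := gs_L2 b0 (gs_mag gs_psi).
rewrite (inner_cutD Lu (L2Z _ Lpsi) (L2Z _ Lm)) (inner_cutZ _ Lu Lpsi) (inner_cutZ _ Lu Lm).
congr (_ * _ + _); first by rewrite conjc_real.
by rewrite (_ : (-1)^*%C = -1 :> C) ?mulN1r//; apply: complex_ext => /=; ring.
Qed.

Lemma eigen_cut u p : eig q u -> magnetic_gradient b u p ->
  \sum_(j < 2) L2inner (p j) (cut (Pi j psi)) = L * L2inner u (cut psi).
Proof.
move=> /eigen_weak[p' up' H] up; rewrite -(H _ _ (cut_gradient b0 r0 gs_psi psi_circle)).
apply: eq_bigr => j _; apply: inner_ae; [exact: (up.2 j).1|exact: (up'.2 j).1| |].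
  by apply: cut_L2; exact: (gs_L2 b0 (gs_Pi j gs_psi)).
exact: (weak_unique c b0 j up up').
Qed.

(** Green's formula holds for the test functions that approximate u; its inner
    products converge with them in the form norm and its boundary term in L^2 of
    the circle. *)
Lemma eigen_trace u g : eig q u -> dirichlet_trace b c r u g ->
  L2inner u (cut theta) = - (2 * r)%:C * circle_inner c r g (gE n q).
Proof.
move=> eu [Hg [p [phi [up pt cv cg]]]]; have Lu := up.1.
rewrite (inner_theta Lu) -(eigen_cut eu up).
have Lp j := (up.2 j).1; have Lt k := test_L2 c (pt k).
have Lpt j k := test_Pi_L2 b c j (pt k).
have n0 f : (0 <= L2normsq f)%E by apply: integral_ge0 => x _; rewrite lee_fin abs2_ge0.
have cvu : L2normsq (fun x => phi k x - u x) @[k --> \oo] --> 0%E.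
  apply: (squeeze_cvge _ (cvg_cst 0%E) cv).
  near=> k; rewrite n0/= leeDl//; exact: sume_ge0.
have cvp j : L2normsq (fun x => Pi j (phi k) x - p j x) @[k --> \oo] --> 0%E.
  apply: (squeeze_cvge _ (cvg_cst 0%E) cv).
  near=> k; rewrite n0/= (bigD1 j)//= addeCA leeDl//.
  by rewrite adde_ge0//; exact: sume_ge0.
have Lc f : gs f -> L2 (cut f) by move=> gf; apply: cut_L2; exact: (gs_L2 b0 gf).
have c1 := ccvgB (ccvg_sum2 (fun j => inner_cvg (Lpt j) (Lp j) (Lc _ (gs_Pi j gs_psi)) (cvp j)))
   (inner_cvg Lt Lu (Lc _ (gs_mag gs_psi)) cvu).
have c2 := ccvgZ (- (2 * r)%:C)
  (circle_inner_cvg r0 (csmooth_gE b c n q) (fun k => test_csmooth (pt k)) Hg cg).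
apply: (ccvg_unique c1); move: c2; congr ccvg; apply/funext => k.
by rewrite green_psi//; exact: test_csmooth.
Unshelve. all: by end_near. Qed.

Lemma estate_trace m : L2inner (estate q m) (cut theta) =
  - (2 * r)%:C * circle_inner c r (estate q m) (gE n q).
Proof.
have ge := gs_estate b c q m; have Le := gs_L2 b0 ge.
rewrite (inner_theta Le) -(eigen_cut (estate_eigen c b0 q m) (gs_gradient b0 ge)).
exact: (green_psi (gs_csmooth ge) Le (fun j => gs_L2 b0 (gs_Pi j ge))).
Qed.

(** All terms of theta belong to the angular sector of psi. *)
Lemma theta_sector v : eig q v -> L2inner v (gE n q) = 0 -> L2inner v (cut theta) = 0.
Proof.
move=> ev v0; have Lv := eigen_L2 ev.
have Lg a k := gs_L2 b0 (gs_gE b c a k).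
have S a k : (a + q = n + k)%N -> L2inner v (cut (gE a k)) = 0.
  move=> ak; apply: gE_radial => // j; apply: (eigen_moment_sector b0 ev v0).
  by rewrite addnAC ak addnA.
have S1 : L2inner v (cut (gE n q)) = 0 by exact: S.
have S2 : L2inner v (cut (gE n.+1 q.+1)) = 0 by apply: S; rewrite addSn addnS.
have M a k : (a + q = n + k)%N -> L2inner v (cut (magH b (gE a k))) = 0.
  move=> ak; rewrite magH_gE.
  have -> : (fun x => (b * (2 * k%:R + 1))%:C * gE a k x -
      4 * a%:R * k%:R * gE a.-1 k.-1 x) = (fun x => (b * (2 * k%:R + 1))%:C * gE a k x +
      (- (4 * a%:R * k%:R)) * gE a.-1 k.-1 x).
    by apply/funext => x; rewrite mulNr.
  rewrite (inner_cutD Lv (L2Z _ (Lg _ _)) (L2Z _ (Lg _ _))) !(inner_cutZ _ Lv (Lg _ _)).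
  rewrite (S _ _ ak) mulr0 add0r.
  case: a k ak => [|a] [|k] ak; rewrite ?mulr0 ?mul0r ?oppr0 ?conjc0 ?mul0r//.
  by rewrite S ?mulr0//; move: ak; rewrite addSn addnS => -[].
rewrite (inner_theta Lv) {1}/psi (inner_cutD Lv (L2Z _ (Lg _ _)) (L2Z _ (Lg _ _))).
rewrite !(inner_cutZ _ Lv (Lg _ _)).
rewrite S1 S2 !mulr0 addr0 mulr0 sub0r /psi 
  (magHD (gsZ (r ^+ 2)%:C (gs_gE b c n q)) (gsZ (-1) (gs_gE b c n.+1 q.+1))).
have Lm a k := gs_L2 b0 (gs_mag (gs_gE b c a k)).
rewrite (magHZ _ (gs_gE b c n q)) (magHZ _ (gs_gE b c n.+1 q.+1)).
rewrite (inner_cutD Lv (L2Z _ (Lm _ _)) (L2Z _ (Lm _ _))) !(inner_cutZ _ Lv (Lm _ _)).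
by rewrite !M ?mulr0 ?addr0 ?oppr0// addSn addnS.
Qed.

(** On the circle the powers of rho are constants, and what remains of the sum
    over i is the Charlier polynomial. *)
Lemma estate_circle x : rho x = r ^+ 2 -> estate q n x * (gE n q x)^*%C =
  ((r ^+ 2) ^+ (n + q) * expR (- (b / 2 * r ^+ 2)) * charlier q n (2 / (b * r ^+ 2)))%:C.
Proof.
move=> xr; rewrite /eigenstate mulr_suml /charlier mulr_sumr (rmorph_sum (real_complex R)).
apply: eq_bigr => i _ /=; have iq : (i <= q)%N by rewrite -ltnS.
rewrite /ecoef; have [ni|ni] := ltnP n i.
  by rewrite ffact_small// muln0 !mul0r !mulr0.
have E : gE n q x = (rho x ^+ i)%:C * gE (n - i) (q - i) x.
  by rewrite -gE_shift !subnK.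
have xi0 : rho x ^+ i != 0 by rewrite xr !expf_neq0// gt_eqF.
have A : gE (n - i) (q - i) x * (gE n q x)^*%C =
    ((rho x ^+ i)^-1 * (rho x ^+ (n + q) * expR (- (b / 2 * rho x))))%:C.
  have H (Z : C) : gE n q x * Z = (rho x ^+ i)%:C * (gE (n - i) (q - i) x * Z).
    by rewrite [in LHS]E -mulrA.
  rewrite -(abs2_gE b c n q x) realcM abs2E H.
  move: (_ * _^*%C) => W; by rewrite mulrA -realcM mulVf// mul1r.
rewrite -mulrA A -realcM; congr (_%:C); rewrite xr.
have -> : - (2 / (b * r ^+ 2)) = - (2 / b) * (r ^+ 2)^-1.
  by rewrite invfM mulrA mulNr.
rewrite (_ : (- (2 / b) / r ^+ 2) ^+ i = (- (2 / b)) ^+ i * ((r ^+ 2) ^+ i)^-1).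
  ring.
by rewrite [LHS]exprMn; congr (_ * _); exact: exprVn.
Qed.

Lemma circle_estate_neq0 : charlier q n (2 / (b * r ^+ 2)) != 0 ->
  circle_inner c r (estate q n) (gE n q) != 0.
Proof.
move=> ch0.
set K := (r ^+ 2) ^+ (n + q) * expR (- (b / 2 * r ^+ 2)).
have K0 : K != 0 by rewrite mulf_neq0 ?expf_neq0 ?gt_eqF ?expR_gt0.
apply/eqP => /(congr1 (@complex.Re R)) E0.
have : r * (K * charlier q n (2 / (b * r ^+ 2))) * (2 * pi) = 0.
  transitivity (Rep (circle_inner c r (estate q n) (gE n q))); last by rewrite E0.
  rewrite /circle_inner /cintegral; cbn [Rep].
  transitivity (\int[mu]_(t in circ) (r * (K * charlier q n (2 / (b * r ^+ 2))))).
    rewrite Rintegral_cst//= lebesgue_measure_itv/= lte_fin mulr_gt0 ?pi_gt0//.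
    by rewrite -EFinB/= subr0.
  apply: eq_Rintegral => t _; rewrite estate_circle ?sqdist_circle//.
  by rewrite Re_cM.
clearbody K; apply/eqP; rewrite !mulf_neq0// ?gt_eqF// ?pi_gt0//.
Qed.

Lemma projection_eigen u : landau_projection_range b q u -> eig q u.
Proof. by move=> [u' []]. Qed.

Lemma estate_theta_neq0 : charlier q n (2 / (b * r ^+ 2)) != 0 ->
  L2inner (estate q n) (cut theta) != 0.
Proof.
move=> ch0; rewrite estate_trace mulf_neq0 ?circle_estate_neq0//.
by rewrite oppr_eq0 eq_complex /= eqxx andbT mulf_neq0 ?gt_eqF.
Qed.

Lemma estate_moment_neq0 : charlier q n (2 / (b * r ^+ 2)) != 0 ->
  L2inner (estate q n) (gE n q) != 0.
Proof.
move=> /estate_theta_neq0; apply: contra_neq; apply: theta_sector.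
exact: estate_eigen.
Qed.

(** An element u of the kernel has zero trace, so that its pairing with theta
    vanishes, whereas that of the eigenstate does not.  The combination of both
    whose moment (n, q) is zero has pairing zero too, so it is u itself. *)
Lemma kernel_moment u : toeplitz_kernel b q c r u ->
  charlier q n (2 / (b * r ^+ 2)) != 0 -> L2inner u (gE n q) = 0.
Proof.
move=> [ur _ [g ug H]] ch0; have eu := projection_eigen ur.
have gg : circle_inner c r g g = 0 by rewrite (H u g ur ug) inner0l.
have ut : L2inner u (cut theta) = 0.
  rewrite (eigen_trace eu ug) (circle_inner_null r0 (csmooth_gE b c n q) ug.1 gg).
  by rewrite mulr0.
set e := estate q n; have ee : eig q e := estate_eigen c b0 q n.
have et : L2inner e (cut theta) != 0 by exact: estate_theta_neq0.
have Lu := eigen_L2 eu; have Le := eigen_L2 ee.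
have Lg := gs_L2 b0 (gs_gE b c n q).
have Lt : L2 (cut theta).
  apply: cut_L2; apply: (gs_L2 b0); rewrite /theta.
  exact: (gsD (gsZ _ gs_psi) (gsZ _ (gs_mag gs_psi))).
have m0 : L2inner e (gE n q) != 0 by exact: estate_moment_neq0.
pose l := - (L2inner u (gE n q) / L2inner e (gE n q)).
have Ll := L2Z l Le.
have ev := eigenD eu (eigenZ l ee).
have : L2inner (fun x => u x + l * e x) (gE n q) = 0.
  rewrite (innerDl Lu Ll Lg) (innerZl _ Le Lg) /l mulNr mulfVK// subrr//.
move/(theta_sector ev); rewrite (innerDl Lu Ll Lt) (innerZl _ Le Lt) ut add0r.
move/eqP; rewrite mulf_eq0 (negPf et) orbF oppr_eq0 mulf_eq0 invr_eq0 (negPf m0) orbF.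
by move/eqP.
Qed.

End trace_formula.

(** * The kernel of the Toeplitz operator *)

Section kernel.
Context {R : realType}.
Variables (b : R) (c : R * R) (r : R).
Hypotheses (b0 : 0 < b) (r0 : 0 < r).
Variable q : nat.
Notation C := R[i].
Notation mu2 := (lebesgue2 R).
Notation Pi := (Pi_classical b).
Notation gs := (gauss_span b c).
Notation gE := (gauss_state b c).
Notation rho := (sqdist c).
Notation eig q := (landau_eigenspace b q).
Notation estate := (eigenstate b c).
Notation cp := (circle_param c r).
Implicit Types (f g u v : R * R -> C) (p : 'I_2 -> R * R -> C).

Lemma eigen_sum (I : Type) (s : seq I) (a : I -> C) (u : I -> R * R -> C) f :
  (forall i, eig q (u i)) -> L2 f ->
  eig q (fun x => \sum_(i <- s) a i * u i x) /\
  L2inner (fun x => \sum_(i <- s) a i * u i x) f = \sum_(i <- s) a i * L2inner (u i) f.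
Proof.
move=> eu Lf; have Lu i := eigen_L2 (eu i); elim: s => [|i s [IH1 IH2]].
  have -> : (fun x => \sum_(i <- [::]) a i * u i x) = (fun x => 0 * estate q 0 x).
    by apply/funext => x; rewrite big_nil mul0r.
  split; first exact: (eigenZ 0 (estate_eigen c b0 q 0)).
  by rewrite innerZl ?big_nil ?mul0r//; exact: (eigen_L2 (estate_eigen c b0 q 0)).
have -> : (fun x => \sum_(i <- i :: s) a i * u i x) =
    (fun x => a i * u i x + \sum_(i <- s) a i * u i x).
  by apply/funext => x; rewrite big_cons.
split; first exact: (eigenD (eigenZ (a i) (eu i)) IH1).
by rewrite big_cons innerDl ?IH2 ?innerZl//; [exact: L2Z|exact: (eigen_L2 IH1)].
Qed.

Lemma kernel_nontrivial m k (A : 'M[C]_(m, k)) : (k < m)%N ->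
  exists2 v : 'I_m -> C, (exists i, v i != 0) & forall j, \sum_(i < m) v i * A i j = 0.
Proof.
move=> km; have : kermx A != 0.
  rewrite kermx_eq0 /row_free neq_ltn; apply/orP; left.
  exact: leq_ltn_trans (rank_leq_col A) km.
move=> /rowV0Pn[v /sub_kermxP vA v0]; exists (fun i => v 0 i).
  by have /rV0Pn[i vi] := v0; exists i.
by move=> j; have := congr1 (fun M : 'M[C]_(1, k) => M 0 j) vA; rewrite !mxE.
Qed.

(** Only the sectors in which the Charlier polynomial vanishes contribute to
    the kernel, each of them at most one dimension. *)
Lemma kernel_dim_le (s : seq nat) :
  (forall n, charlier q n (2 / (b * r ^+ 2)) = 0 -> n \in s) ->
  (L2dim (toeplitz_kernel b q c r) <= (size s)%:R%:E)%E.
Proof.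
move=> sP; apply: ge_ereal_sup => _ [m [u [uK uF]] <-]; rewrite lee_fin ler_nat.
rewrite leqNgt; apply/negP => sm.
have eu i : eig q (u i) by have [ur _ _] := uK i; exact: projection_eigen ur.
have [v [i vi] vA] := kernel_nontrivial
  (\matrix_(i < m, j < size s) L2inner (u i) (gE (nth 0%N s j) q)) sm.
have Lg n := gs_L2 b0 (gs_gE b c n q).
move/eqP: vi; apply; apply: uF.
have [ew _] := eigen_sum (index_enum 'I_m) v eu (Lg 0%N).
apply: (@eigen_zero R b c b0 q _ ew) => n.
rewrite (eigen_sum (index_enum 'I_m) v eu (Lg n)).2.
have [ns|ns] := boolP (n \in s).
  have := vA (Ordinal (etrans (index_mem n s) ns)).
  rewrite (eq_bigr (fun i => v i * L2inner (u i) (gE n q)))// => j _.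
  by rewrite mxE /= nth_index.
apply: big1 => j _; rewrite (kernel_moment b0 r0 (uK j)) ?mulr0//.
by apply: contraNneq ns => /sP.
Qed.

Lemma L2normsq_dct (fn : nat -> R * R -> C) (F : R * R -> R) :
  (forall n, L2 (fn n)) -> (forall x, ccvg (fun n => fn n x) 0) ->
  intg mu2 F -> (forall n x, abs2 (fn n x) <= F x) ->
  L2normsq (fn n) @[n --> \oo] --> 0%E.
Proof.
move=> Lf cf iF fF.
have [|x|n x|_] := @dct _ _ _ mu2 (fun n x => abs2 (fn n x)) (fun=> 0) F _ _ iF.
- by move=> n; apply: cmeasurable_abs2; exact: (Lf n).1.
- have [c1 c2] := cf x; rewrite /abs2 -[X in _ --> X](_ : 0 ^+ 2 + 0 ^+ 2 = 0 :> R); last by ring.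
  by apply: cvgD; apply: cvgM.
- by rewrite ger0_norm ?abs2_ge0.
rewrite Rint0 => h.
have -> : (fun n => L2normsq (fn n)) = (fun n => (\int[mu2]_x abs2 (fn n x))%:E).
  by apply/funext => n; rewrite L2normsqE.
apply: (@cvg_EFin R nat \oo _ (fun n => (\int[mu2]_x abs2 (fn n x))%:E) 0 _ h).
exact: nearW.
Qed.

Lemma circle_integral0 (F : R * R -> \bar R) : (forall t, F (cp t) = 0%E) ->
  circle_integral c r F = 0%E.
Proof. by move=> F0; apply: integral0_eq => t _; rewrite F0 mule0. Qed.

Lemma H12_vanish f : (forall t, f (cp t) = 0) -> H12normsq c r f = 0%E.
Proof.
move=> f0; have a0 : abs2 (0 : C) = 0 by rewrite /abs2 /= expr0n addr0.
rewrite /H12normsq circle_integral0 => [|t]; last by rewrite f0 a0.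
rewrite add0e; apply: circle_integral0 => t; apply: circle_integral0 => s.
by rewrite !f0 subrr a0 mul0r.
Qed.

Lemma abs2B_le (x y : C) : abs2 (x - y) <= 2 * abs2 x + 2 * abs2 y.
Proof. by have := abs2D x (- y); rewrite abs2N. Qed.

Lemma ccvg_sub0 (w : nat -> C) l : ccvg w l -> ccvg (fun n => w n - l) 0.
Proof. by move=> wl; have := ccvgB wl (ccvg_cst l); rewrite subrr. Qed.

Lemma cvg_esum_two (F : 'I_2 -> nat -> \bar R) :
  (forall j, F j n @[n --> \oo] --> 0%E) ->
  (fun n => \sum_(j < 2) F j n)%E @ \oo --> 0%E.
Proof.
move=> F0.
have -> : (fun n => \sum_(j < 2) F j n)%E = (fun n => F ord0 n + F (lift ord0 ord0) n)%E.
  by apply/funext => n; rewrite 2!big_ord_recl big_ord0 adde0.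
by rewrite -[X in _ --> X]adde0; apply: cvgeD; [by []|exact: F0..].
Qed.

(** The smooth cut-offs show that the trace of a Gaussian state that vanishes on
    the circle is zero. *)
Lemma trace_vanish f : gs f -> (forall t, f (cp t) = 0) ->
  dirichlet_trace b c r f (fun=> 0).
Proof.
move=> gf f0; have fs := gs_csmooth gf; have Lf := gs_L2 b0 gf.
have Lp j := gs_L2 b0 (gs_Pi j gf); have ct n := cutoff_test c n fs.
split.
  by split; [split; exact: measurable_cst|rewrite H12_vanish].
exists (fun j => Pi j f), (fun n x => (cutoff c n x)%:C * f x); split => //.
- exact: (gs_gradient b0 gf).
- rewrite -[X in _ --> X]adde0; apply: cvgeD => //.
    apply: (@L2normsq_dct _ (fun x => 2 * abs2 (f x) + 2 * abs2 (f x))).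
    + by move=> n; exact: (L2B (test_L2 c (ct n)) Lf).
    + by move=> x; apply: ccvg_sub0; exact: cutoff_ccvg.
    + by apply: intgD; apply: intgZl; exact: L2_abs2_intg.
    + move=> n x; apply: (le_trans (abs2B_le _ _)).
      by have := cutoff_abs2_le c n x (f x); lra.
  apply: cvg_esum_two => j.
    apply: (@L2normsq_dct _ (fun x => 2 * (2 * abs2 (Pi j f x) +
       32 * ((1 + rho x) * abs2 (f x))) + 2 * abs2 (Pi j f x))).
    + by move=> n; exact: (L2B (test_Pi_L2 b c j (ct n)) (Lp j)).
    + by move=> x; apply: ccvg_sub0; exact: Pi_cutoff_ccvg.
    + by apply: intgD; apply: intgZl; [exact: Pi_cutoff_dom|exact: L2_abs2_intg].
    + move=> n x; apply: (le_trans (abs2B_le _ _)).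
      by have := Pi_cutoff_abs2_le b c j n x fs; lra.
- have -> : (fun n => H12normsq c r (fun x => (cutoff c n x)%:C * f x - 0)) = cst 0%E.
    by apply/funext => n; rewrite H12_vanish// => t; rewrite f0 mulr0 subr0.
  exact: cvg_cst.
Qed.

Lemma eigen_projection u : eig q u -> landau_projection_range b q u.
Proof.
move=> eu; exists u; split => //; first exact: (eigen_L2 eu).
move=> v _; rewrite -[RHS](inner0l v); congr (L2inner _ v).
by apply/funext => x; rewrite subrr.
Qed.

(** The circle is contained in the zero set of the eigenstate as soon as the
    Charlier polynomial vanishes. *)
Lemma estate_kernel n : charlier q n (2 / (b * r ^+ 2)) = 0 ->
  toeplitz_kernel b q c r (estate q n).
Proof.
move=> ch0; have ee := estate_eigen c b0 q n; have ge := gs_estate b c q n.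
have e0 t : estate q n (cp t) = 0.
  have := estate_circle b r0 q n (sqdist_circle c r t).
  rewrite ch0 mulr0 => /eqP; rewrite mulf_eq0 => /orP[/eqP//|].
  rewrite conjc_eq0 => /eqP g0; have := abs2_gE b c n q (cp t).
  rewrite g0 sqdist_circle /abs2 /= expr0n addr0 => /eqP.
  by rewrite eq_sym mulf_eq0 !expf_eq0 (gt_eqF r0) gt_eqF ?expR_gt0// !andbF.
split; first exact: eigen_projection.
- apply: eigen_projection; have := eigenZ 0 ee; congr (landau_eigenspace b q _).
  by apply/funext => x; rewrite mul0r.
- exists (fun=> 0); first exact: trace_vanish.
  move=> v h _ _; rewrite inner0l /circle_inner.
  rewrite -[RHS](cintegral0 (@lebesgue_measure R) `[0, 2 * pi]%classic).
  by apply: eq_cintegral => t _; rewrite mul0r mulr0.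
Qed.

End kernel.

(** * Exceptional radii *)

Section exceptional_radii.
Context {R : realType}.
Variable b : R.
Hypothesis b0 : 0 < b.
Notation mu2 := (lebesgue2 R).
Notation radius y := (Num.sqrt (2 / (b * y))).

Lemma radius_gt0 (y : R) : 0 < y -> 0 < radius y.
Proof. by move=> y0; rewrite sqrtr_gt0 divr_gt0 ?mulr_gt0. Qed.

Lemma radiusK (y : R) : 0 < y -> 2 / (b * radius y ^+ 2) = y.
Proof.
move=> y0; rewrite sqr_sqrtr; last by rewrite divr_ge0// mulr_ge0// ltW.
by field; rewrite !gt_eqF.
Qed.

Lemma radius_inv (r : R) : 0 < r -> radius (2 / (b * r ^+ 2)) = r.
Proof.
move=> r0; rewrite (_ : 2 / _ = r ^+ 2) ?sqrtr_sqr ?gtr0_norm//.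
by field; rewrite !gt_eqF.
Qed.

Lemma mem_le_sum (s : seq R) (x : R) : x \in s -> x <= \sum_(y <- s) `|y|.
Proof.
move=> xs; rewrite (big_rem x xs)/=; apply: (le_trans (ler_norm x)).
by rewrite lerDl sumr_ge0.
Qed.

Lemma charlier_nonzero q n : exists2 y : R, 0 < y & charlier q n y != 0.
Proof.
have [s sP] := @charlier_zeros_finite R q n.
exists (1 + \sum_(y <- s) `|y|); first by rewrite ltr_wpDr// sumr_ge0.
apply/eqP => /sP /mem_le_sum; lra.
Qed.

Lemma charlier_zeros_finite_lt q N : exists s : seq R,
  forall n y, (n < N)%N -> charlier q n y = 0 -> y \in s.
Proof.
elim: N => [|N [s sP]]; first by exists [::].
have [s' sP'] := @charlier_zeros_finite R q N; exists (s ++ s') => n y.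
rewrite ltnS leq_eqVlt mem_cat => /predU1P[->/sP' ->|nN /(sP _ _ nN) ->//].
by rewrite orbT.
Qed.

(** At a radius where the Charlier polynomial does not vanish, the eigenstate
    has a nonzero moment. *)
Lemma estate_not_null c q n : ~ {ae mu2, forall x, eigenstate b c q n x = 0}.
Proof.
move=> e0; have [y y0 cy] := charlier_nonzero q n.
have := @estate_moment_neq0 R b c _ b0 (radius_gt0 y0) q n.
rewrite radiusK// => /(_ cy)/eqP; apply.
rewrite -[RHS](inner0l (gauss_state b c n q)).
exact: (inner_ae (gs_L2 b0 (gs_estate b c q n)) (@L2_0 R) (gs_L2 b0 (gs_gE b c n q)) e0).
Qed.

Lemma kernel_dim_ge1 c r q n : 0 < r -> charlier q n (2 / (b * r ^+ 2)) = 0 ->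
  (1 <= L2dim (toeplitz_kernel b q c r))%E.
Proof.
move=> r0 ch0; apply: ereal_sup_ubound; exists 1%N => //.
exists (fun=> eigenstate b c q n); split=> [_|a ae0 i]; first exact: estate_kernel.
apply/eqP; apply: contrapT => ai; apply: (@estate_not_null c q n).
apply: ae_mono ae0 => x /=; rewrite big_ord1 (ord1 i) in ai *.
by move/eqP; rewrite mulf_eq0 => /orP[/eqP a0|/eqP//]; move: ai; rewrite a0 eqxx.
Qed.

Lemma kernel_dim_zero c r q : 0 < r -> (1 <= L2dim (toeplitz_kernel b q c r))%E ->
  exists n, charlier q n (2 / (b * r ^+ 2)) = 0.
Proof.
move=> r0 d1; apply: contrapT => nz.
have : (L2dim (toeplitz_kernel b q c r) <= (size (Nil nat))%:R%:E)%E.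
  by apply: kernel_dim_le => // n n0; case: nz; exists n.
by move=> /(le_trans d1); rewrite /= lee_fin ler10.
Qed.

(** Uniformly for y >= y0, only finitely many n have to be tested. *)
Lemma charlier_bound q (y0 : R) : 0 < y0 -> exists N, forall n y, y0 <= y ->
  (N <= n)%N -> charlier q n y != 0.
Proof.
move=> y00; exists (Num.truncn (2 / y0 + 2 * q%:R)).+1 => n y y0y Nn.
have nb : 2 / y0 + 2 * q%:R < n%:R.
  by apply: (lt_le_trans (truncnS_gt _)); rewrite ler_nat.
have y1 : 0 < y by exact: lt_le_trans y0y.
apply: charlier_neq0 => //.
have h : 2 / y0 <= n%:R - 2 * q%:R by lra.
have h0 : 0 <= 2 / y0 by rewrite divr_ge0// ltW.
apply: (@le_trans _ _ (y0 * (2 / y0))); first by rewrite mulrC divfK// gt_eqF.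
by apply: ler_pM => //; exact: ltW.
Qed.

Lemma near_notin (s : seq R) (x : R) : \forall r \near x, r \in s -> r = x.
Proof.
elim: s => [|a s IH]; first by apply: (@filterS _ (nbhs x) _ setT) => //; exact: filterT.
have H : \forall r \near x, r = a -> r = x.
  have [ax|ax|->] := ltgtP a x; last by apply: (@filterS _ (nbhs x) _ setT) => //; exact: filterT.
  - by have := lt_nbhsr ax; apply: filterS => r ar ra; rewrite ra ltxx in ar.
  - by have := lt_nbhsl ax; apply: filterS => r ar ra; rewrite ra ltxx in ar.
by apply: filterS2 IH H => r h1 h2; rewrite inE => /predU1P[].
Qed.

End exceptional_radii.

Local Close Scope complex_scope.

Theorem theorem3p9 (R : realType) (b : R) (q : nat) (c : R -> R * R)
    (hb : 0 < b) (hq : (0 < q)%N) :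
  let D := [set r : R | 0 < r /\
                        (1 <= L2dim (toeplitz_kernel b q (c r) r))%E] in
  (forall r : R, 0 < r ->
     (L2dim (toeplitz_kernel b q (c r) r) <= q%:R%:E)%E) /\
  infinite_set D /\
  (forall x : R, 0 < x -> ~ limit_point D x).
Proof.
move=> D; split; [|split].
- move=> r r0; have y0 : 0 < 2 / (b * r ^+ 2) by rewrite divr_gt0 ?mulr_gt0 ?exprn_gt0.
  have [N HN] := charlier_bound q y0.
  pose s := [seq n <- iota 0 N | charlier q n (2 / (b * r ^+ 2)) == 0].
  apply: (@le_trans _ _ (size s)%:R%:E).
    apply: kernel_dim_le => // n n0; rewrite mem_filter n0 eqxx mem_iota/= add0n ltnNge.
    by apply/negP => /(HN _ _ (lexx _)); rewrite n0 eqxx.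
  rewrite lee_fin ler_nat; apply: (charlier_num_zeros y0).
    by rewrite filter_uniq// iota_uniq.
  by move=> n; rewrite mem_filter => /andP[/eqP].
  (* The zero y <= 1 / n gives the radius r with r^2 = 2 / (b y) >= 2 n / b. *)
- move=> /finite_seqP[s Ds].
  pose M := \sum_(y <- s) `|y|.
  have M0 : 0 <= M by exact: sumr_ge0.
  pose n := (Num.truncn (b * M ^+ 2)).+1.
  have nM : b * M ^+ 2 < n%:R by exact: truncnS_gt.
  case: q hq @D Ds => [//|q'] _ D Ds.
  have [y /andP[y0 yn] cy] := @charlier_zero R q' n isT.
  have r0 := radius_gt0 hb y0.
  have : D (Num.sqrt (2 / (b * y))).
    by split => //; apply: (@kernel_dim_ge1 _ _ hb _ _ _ n r0); rewrite radiusK.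
  rewrite Ds /= => /mem_le_sum; rewrite -/M => rM.
  have : 2 / (b * y) <= M ^+ 2.
    rewrite -[leLHS]sqr_sqrtr; last by rewrite divr_ge0// mulr_ge0// ltW.
    by rewrite lerXn2r// nnegrE// sqrtr_ge0.
  rewrite ler_pdivrMr ?mulr_gt0//.
  have : n%:R * y <= 1 by rewrite mulrC -ler_pdivlMr ?ltr0n// div1r.
  nra.
  (* For r < 2 x the parameter 2 / (b r^2) is bounded from below, which leaves
     finitely many n and finitely many radii near x. *)
- move=> x x0 xD.
  have [N HN] := @charlier_bound R q (2 / (b * (2 * x) ^+ 2))
    (divr_gt0 (ltr0Sn _ _) (mulr_gt0 hb (exprn_gt0 2 (mulr_gt0 (ltr0Sn _ _) x0)))).
  have [s sP] := @charlier_zeros_finite_lt R q N.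
  have U : \forall r \near x, r < 2 * x /\
      (r \in [seq Num.sqrt (2 / (b * y)) | y <- s] -> r = x).
    near=> r; split; near: r; last exact: near_notin.
    by apply: lt_nbhsl; lra.
  have [r [rx [r0 d1] [r2 rs]]] := xD _ U.
  have [n n0] := kernel_dim_zero hb r0 d1.
  move/eqP: rx; apply; apply: rs; apply/mapP; exists (2 / (b * r ^+ 2)).
    apply: (sP n) => //; rewrite ltnNge; apply/negP => Nn.
    have := HN n (2 / (b * r ^+ 2)) _ Nn; rewrite n0 eqxx => /(_ _)/negP; apply => //.
    rewrite ler_pM2l// lef_pV2 ?posrE ?mulr_gt0 ?exprn_gt0 ?mulr_gt0//.
    rewrite ler_pM2l//; apply: lerXn2r; rewrite ?nnegrE; lra.
  by rewrite radius_inv.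
Unshelve. all: by end_near. Qed.
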